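(* Let $F:D=\{x_1<\dots<x_n\}\to\mathbb{R}$ satisfy $F(x_i)\neq F(x_{i+1})$ for $i=1,\dots,n-1$. After a precomputation taking $O(n\log n)$ time and using $O(n)$ storage, for any desired upper bound $K$ on the number of segments, one can compute in constant time the segmentation points of a segmentation that has minimal OMAFE among the alternating segmentations of $D$ with at most $K$ segments, together with the corresponding OMAFE value.
   Context: Segmentations. A segmentation of $D$ into $K$ segments is a sequence of closed intervals $X_i=[y_i,y_{i+1}]$, $i=1,\dots,K$, given by segmentation points $y_1<\dots<y_{K+1}$ in $D$ with $y_1=\min D$, $y_{K+1}=\max D$. A segment $X_i$ is increasing if $F(\max X_i)>F(\min X_i)$, decreasing if $F(\max X_i)<F(\min X_i)$, and has no direction if these values are equal. A segmentation is alternating if its segments alternate between increasing and decreasing. OMAFE. For a segment $X$ that is increasing (resp. decreasing), $\mathrm{OMAFE}(F_{|X})=\min_{f}\max_{x\in D\cap X}|f(x)-F(x)|$, where $f:\mathbb{R}\to\mathbb{R}$ ranges over all (weakly) monotonic increasing (resp. decreasing) functions. For a segment with no direction the approximation is the best constant, with error $(\max F_{|X}-\min F_{|X})/2$. The OMAFE of a segmentation is the maximum of $\mathrm{OMAFE}(F_{|X_i})$ over its segments $X_i$. Computational model. Unit-cost random access machine with unit-cost arithmetic and comparisons of the values of $F$. The precomputation may depend on $F$ but not on $K$. ''Computing the segmentation points in constant time'' means identifying, in constant time, a position in a precomputed array (of points of $D$) such that the entries up to that position are the segmentation points (not necessarily sorted by position in $D$), with the first and the last of them, in the order of $D$, replaced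 by $x_1$ and $x_n$.
   Formalization: One precomputed array serves all K except K=2, which may use a second one (a single array fails for F=4,0,6,1,7,3); if K=1 and F(x_1)=F(x_n), no alternating segmentation exists and the one-segment segmentation is returned; n is at least 2. *)

(* Defs.v *)
From mathcomp Require Import all_boot all_order all_algebra.
From mathcomp Require Import all_classical all_reals.

Set Implicit Arguments.
Unset Strict Implicit.
Unset Printing Implicit Defensive.

Import Order.TTheory GRing.Theory Num.Theory.
Local Open Scope ring_scope.

(** * Segmentations and OMAFE

  The domain [x_1 < ... < x_n] is a strictly sorted sequence [D].  The function
  is a total [F : R -> R], but only its values on [D] are ever used.  A
  segmentation is the sequence [y] of its segmentation points. *)

Section Segmentations.
Variable R : realType.
Implicit Types (D y : seq R) (F f : R -> R) (a b : R).

Definition is_domain D : Prop := sorted <%R D /\ (2 <= size D)%N.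

Definition no_equal_neighbours D F : Prop :=
  forall i, (i.+1 < size D)%N -> F D`_i <> F D`_i.+1.

Definition first_pt D : R := head 0 D.
Definition last_pt D : R := last 0 D.

Definition is_segmentation D y : Prop :=
  [/\ sorted <%R y, (2 <= size y)%N, {subset y <= D},
      first_pt y = first_pt D & last_pt y = last_pt D].

Definition nsegments y : nat := (size y).-1.

Definition increasing_seg F a b : bool := F a < F b.
Definition decreasing_seg F a b : bool := F b < F a.

Definition alternating F y : Prop :=
  (forall i, (i < nsegments y)%N ->
     increasing_seg F y`_i y`_i.+1 \/ decreasing_seg F y`_i y`_i.+1) /\
  (forall i, (i.+1 < nsegments y)%N ->
     increasing_seg F y`_i y`_i.+1 = decreasing_seg F y`_i.+1 y`_i.+2).

Definition max_error D F a b f : R :=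
  \big[Num.max/0]_(x <- D | a <= x <= b) `|f x - F x|.

(* The minimum over monotonic functions is attained, so it is this infimum. *)
Definition omafe_increasing D F a b : R :=
  inf [set max_error D F a b f | f in [set f | {homo f : u v / u <= v}]]%classic.

Definition omafe_decreasing D F a b : R :=
  inf [set max_error D F a b f | f in [set f | {homo f : u v /~ u <= v}]]%classic.

(* [a] is itself a point of [D] in the segment, hence the default [F a]. *)
Definition seg_max D F a b : R := \big[Num.max/F a]_(x <- D | a <= x <= b) F x.
Definition seg_min D F a b : R := \big[Num.min/F a]_(x <- D | a <= x <= b) F x.

Definition omafe_seg D F a b : R :=
  if increasing_seg F a b then omafe_increasing D F a b
  else if decreasing_seg F a b then omafe_decreasing D F a b
  else (seg_max D F a b - seg_min D F a b) / 2.

Definition omafe D F y : R :=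
  \big[Num.max/0]_(i < nsegments y) omafe_seg D F y`_i y`_i.+1.

(* [y] lists the entries of [s] in the order of [D], with the first and the last
   of them replaced by [x_1] and [x_n]. *)
Definition represents D (s y : seq R) : Prop :=
  [/\ uniq s, {subset s <= D} &
      exists u v t,
        sort <=%R s = u :: rcons t v /\ y = first_pt D :: rcons t (last_pt D)].

End Segmentations.

(** * Unit-cost random access machine

  There are integer registers and real registers, and an integer memory and a
  real memory which are addressed by the contents of integer registers.  Every
  instruction costs one time unit.

  As in the Cook-Reckhow RAM, integers only have addition and (truncated)
  subtraction: unit-cost multiplication or division of unbounded integers would
  allow to pack a whole table into one cell.  There is no conversion between
  integers and reals, and the constants in a program are integers, so that a
  program cannot hide information in them. *)

Inductive instr : Type :=
| IConst of nat & nat             (* i_d := c                        *)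
| IAdd of nat & nat & nat         (* i_d := i_a + i_b                *)
| ISub of nat & nat & nat         (* i_d := i_a - i_b                *)
| ILoad of nat & nat              (* i_d := imem[i_a]                *)
| IStore of nat & nat             (* imem[i_a] := i_b                *)
| IJumpLe of nat & nat & nat      (* if i_a <= i_b then goto l       *)
| RConst of nat & nat             (* r_d := c                        *)
| RAdd of nat & nat & nat         (* r_d := r_a + r_b                *)
| RSub of nat & nat & nat         (* r_d := r_a - r_b                *)
| RMul of nat & nat & nat         (* r_d := r_a * r_b                *)
| RDiv of nat & nat & nat         (* r_d := r_a / r_b                *)
| RLoad of nat & nat              (* r_d := rmem[i_a]                *)
| RStore of nat & nat             (* rmem[i_a] := r_b                *)
| RJumpLe of nat & nat & nat.     (* if r_a <= r_b then goto l       *)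

Definition program := seq instr.

Section Machine.
Variable R : realType.

Record state : Type := State {
  pc : nat;
  ireg : nat -> nat;
  rreg : nat -> R;
  imem : nat -> nat;
  rmem : nat -> R
}.

Definition upd (T : Type) (f : nat -> T) (a : nat) (v : T) : nat -> T :=
  fun k => if k == a then v else f k.

Definition exec (c : instr) (s : state) : state :=
  let: State p i r im rm := s in
  match c with
  | IConst d k => State p.+1 (upd i d k) r im rm
  | IAdd d a b => State p.+1 (upd i d (i a + i b)%N) r im rm
  | ISub d a b => State p.+1 (upd i d (i a - i b)%N) r im rm
  | ILoad d a => State p.+1 (upd i d (im (i a))) r im rm
  | IStore a b => State p.+1 i r (upd im (i a) (i b)) rm
  | IJumpLe a b l => State (if (i a <= i b)%N then l else p.+1) i r im rm
  | RConst d k => State p.+1 i (upd r d k%:R) im rm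
  | RAdd d a b => State p.+1 i (upd r d (r a + r b)) im rm
  | RSub d a b => State p.+1 i (upd r d (r a - r b)) im rm
  | RMul d a b => State p.+1 i (upd r d (r a * r b)) im rm
  | RDiv d a b => State p.+1 i (upd r d (r a / r b)) im rm
  | RLoad d a => State p.+1 i (upd r d (rm (i a))) im rm
  | RStore a b => State p.+1 i r im (upd rm (i a) (r b))
  | RJumpLe a b l => State (if r a <= r b then l else p.+1) i r im rm
  end.

(* The machine halts when the program counter leaves the program. *)
Definition halted (P : program) (s : state) : bool := (size P <= pc s)%N.

Definition step (P : program) (s : state) : state :=
  if onth P (pc s) is Some c then exec c s else s.

Definition run (P : program) (t : nat) (s : state) : state :=
  iter t (step P) s.

Definition halts_within (P : program) (T : nat) (s s' : state) : Prop :=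
  exists2 t, (t <= T)%N & run P t s = s' /\ halted P s'.

(* The number of memory cells needed for the next instruction to access an
   existing cell: one more than the address that it uses. *)
Definition cells_needed (P : program) (s : state) : nat :=
  match onth P (pc s) with
  | Some (ILoad _ a | IStore a _ | RLoad _ a | RStore a _) => (ireg s a).+1
  | _ => 0
  end.

(* The registers are not counted: a program only mentions finitely many. *)
Definition uses_storage (P : program) (M : nat) (s : state) : Prop :=
  forall t, (cells_needed P (run P t s) <= M)%N.

(* [n] is in integer register 0; the real memory contains
   [x_1, ..., x_n, F x_1, ..., F x_n]; everything else is zero. *)
Definition input_state (D : seq R) (F : R -> R) : state :=
  State 0 (upd (fun _ => 0%N) 0 (size D)) (fun _ => 0)
        (fun _ => 0%N) (nth 0 (D ++ [seq F x | x <- D])).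

(* The query starts from the state [s] left by the precomputation, with [K] in
   integer register 0. *)
Definition query_state (s : state) (K : nat) : state :=
  State 0 (upd (ireg s) 0 K) (rreg s) (imem s) (rmem s).

Definition array_prefix (s : state) (start len : nat) : seq R :=
  [seq rmem s k | k <- iota start len].

(* A query returns the address at which a precomputed array starts, a position
   in that array, and an OMAFE value. *)
Definition out_start (s : state) : nat := ireg s 0.
Definition out_position (s : state) : nat := ireg s 1.
Definition out_value (s : state) : R := rreg s 0.

End Machine.

(** * Specification of a query *)

Section Specification.
Variable R : realType.
Implicit Types (D y : seq R) (F : R -> R).

Definition minimal_omafe D F (K : nat) y : Prop :=
  alternating F y /\
  forall z, is_segmentation D z -> alternating F z -> (nsegments z <= K)%N ->
    omafe D F y <= omafe D F z.

(* An alternating segmentation with at most [K] segments exists unless [K = 1]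
   and [F x_1 = F x_n], where the only candidate is one segment without
   direction; that segmentation is then what has to be returned. *)
Definition query_answer D F (K : nat) (s : seq R) (v : R) : Prop :=
  exists y,
    [/\ represents D s y, is_segmentation D y, (nsegments y <= K)%N,
        (exists z, [/\ is_segmentation D z, alternating F z &
                       (nsegments z <= K)%N]) -> minimal_omafe D F K y
      & v = omafe D F y].

End Specification.

(* Main.v *)
(* For a threshold d, call a point a maximum if, on each side, F drops by more
   than d before exceeding its value there, where on a side on which F never
   exceeds this value no drop is needed, as long as there is one on the other
   side; minima are defined dually. These extrema alternate, consecutive ones
   differ by more than d, and using the inner ones together with x_1 and x_n as
   segmentation points gives error at most d/2. Conversely each swing between
   two consecutive extrema needs a segment of its own in every alternating
   segmentation with error at most d/2, so d/2 is optimal as soon as all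
   smaller thresholds leave more than K + 1 extrema.

   A point is an extremum exactly for the thresholds below its persistence,
   which is the smaller one of its drops on the two sides (not counting a side on
   which F never exceeds its value, unless there is no other). So one array with the
   points sorted by decreasing persistence contains the extrema of every
   threshold as a prefix, and only ties and the case of exactly two extrema need
   special care. The drops are computed in linear time by following pointers to
   previous larger values, as on a monotone stack. *)
Require Import Defs.
From mathcomp Require Import all_boot all_order all_algebra.
From mathcomp Require Import all_classical all_reals.
From mathcomp Require Import zify lra.

Set Implicit Arguments.
Unset Strict Implicit.
Unset Printing Implicit Defensive.

Import Order.TTheory GRing.Theory Num.Theory.
Local Open Scope ring_scope.

(** * Persistent extrema *)

(** A threshold is any upward closed predicate that fails at 0. This covers [d < x], which cuts the
    sorted persistences at a strict drop, as well as [d <= x], which gives access to the points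
    inside a group of ties. Such a predicate distributes over maximum and minimum, so a single real
    number built from drops by these two operations decides extremality for all thresholds at once.

    Two extrema form the obstacle: both ends of the only swing are moved, to x_1 and x_n, and the
    resulting segment may be flat or run the wrong way. With three or more extrema every segment
    keeps an end that is a true extremum, and moving the other end cannot use up the whole swing. In
    the bad case an inner point has to be kept. For K >= 3 the next points of the array provide the
    additional entries; for K = 2 a separate array is used.

    On the machine side, programs are written in a structured language over nine arrays of length n.
    Its compiler is verified once, and running times are passed on as upper bounds. *)

Section Extrema.
Variable R : realType.
Implicit Types (g : nat -> R) (big : R -> bool).

Definition threshold big : Prop := (forall x y, x <= y -> big x -> big y) /\ ~~ big 0.

Lemma threshold_gt (d : R) : 0 <= d -> threshold (fun x => d < x).
Proof. by move=> Hd; split=> [x y xy /lt_le_trans|]; [apply | rewrite -leNgt]. Qed.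

Lemma threshold_ge (d : R) : 0 < d -> threshold (fun x => d <= x).
Proof. by move=> Hd; split=> [x y xy /le_trans|]; [apply | rewrite -ltNge]. Qed.

(* Among equal values the leftmost one counts as the maximum: the inequality is
   strict on the left and weak on the right. *)
Definition left_max big g p : Prop :=
  (exists q, [/\ (q < p)%N, big (g p - g q) & forall k, (q < k < p)%N -> g k < g p]) \/
  (forall k, (k < p)%N -> g k < g p).
Definition right_max n big g p : Prop :=
  (exists q, [/\ (p < q < n)%N, big (g p - g q) & forall k, (p < k < q)%N -> g k <= g p]) \/
  (forall k, (p < k < n)%N -> g k <= g p).
Definition is_max n big g p : Prop :=
  [/\ left_max big g p, right_max n big g p & exists q, (q < n)%N /\ big (g p - g q)].

(** Taking the leftmost maximizer matches the tie rule of [left_max] and [right_max]. *)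
Lemma argmaxP g a b : (a <= b)%N -> exists p, [/\ (a <= p <= b)%N,
  forall k, (a <= k <= b)%N -> g k <= g p & forall k, (a <= k < p)%N -> g k < g p].
Proof.
move=> /subnKC <-; elim: (b - a)%N => [|d [p [Hp H1 H2]]].
  exists a; split; [by lia| |by lia].
  by move=> k Hk; have -> : k = a by lia.
have [Hle|Hlt] := leP (g (a + d.+1)%N) (g p).
  exists p; split=> //; first lia.
  move=> k Hk; have [->//|Hne] := eqVneq k (a + d.+1)%N; apply: H1; lia.
exists (a + d.+1)%N; split; first lia.
  move=> k Hk; have [->//|Hne] := eqVneq k (a + d.+1)%N.
  by apply: ltW; apply: le_lt_trans Hlt; apply: H1; lia.
by move=> k Hk; apply: le_lt_trans Hlt; apply: H1; lia.
Qed.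

Lemma argminP g a b : (a <= b)%N -> exists p, [/\ (a <= p <= b)%N,
  forall k, (a <= k <= b)%N -> g p <= g k & forall k, (a <= k < p)%N -> g p < g k].
Proof.
move=> /(argmaxP (fun k => - g k)) [p [H1 H2 H3]]; exists p; split=> // k /[dup].
  by move=> _ /H2; rewrite lerN2.
by move=> _ /H3; rewrite ltrN2.
Qed.

End Extrema.

(** * Existence, alternation and gaps of persistent extrema *)

Section Zigzag.
Variables (R : realType) (n : nat) (f : nat -> R) (big : R -> bool).
Hypothesis big_th : threshold big.

(* [s = false] turns [f] upside down, so that each fact is proved only once. *)
Definition flip (s : bool) (i : nat) : R := if s then f i else - f i.
Local Notation g := flip.

Lemma flipN s i : g (~~ s) i = - g s i.
Proof. by case: s; rewrite /flip //= opprK. Qed.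

Definition ext s p : Prop := is_max n big (g s) p.

Lemma bigW x y : big x -> x <= y -> big y.
Proof. by case: big_th => H _ Hx /H; apply. Qed.
Lemma big_gt0 x : big x -> 0 < x.
Proof. by case: big_th => H /negP H0 Hx; rewrite ltNge; apply/negP => /H /(_ Hx). Qed.

Lemma bigN x y : big x -> ~~ big y -> y < x.
Proof. by move=> Hx Hy; rewrite ltNge; apply/negP => /(bigW Hx); apply/negP. Qed.

(** The leftmost maximum of [g s] on [0, b] has only smaller values on its left, and [b] itself
    witnesses the drop on its right. *)
Lemma ext_first s a b : (a < b < n)%N -> big (g s a - g s b) ->
  exists p, (p < b)%N /\ ext s p.
Proof.
move=> Hab Hbig.
have [p [Hp H1 H2]] := argmaxP (g s) (leq0n b).
have Hpb : big (g s p - g s b) by apply: bigW Hbig _; rewrite lerD2r; apply: H1; lia.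
have Hlt : (p < b)%N.
  by rewrite ltn_neqAle; apply/andP; split; [apply: contraTneq Hpb => ->; rewrite subrr; case: big_th | lia].
exists p; split=> //; split.
- by right=> k Hk; apply: H2; lia.
- by left; exists b; split=> //; [lia| move=> k Hk; apply: H1; lia].
- by exists b; split=> //; lia.
Qed.

(** Take the leftmost minimum of [g s] from [a] to the end: [a] is its witness on the left, and
    nothing lower follows on the right. *)
Lemma ext_last s a b : (a < b < n)%N -> big (g s a - g s b) ->
  exists q, [/\ (a < q < n)%N, ext (~~ s) q & big (g s a - g s q)].
Proof.
move=> Hab Hbig.
have /(argminP (g s)) [q [Hq H1 H2]] : (a <= n.-1)%N by lia.
have Hpb : big (g s a - g s q) by apply: bigW Hbig _; rewrite lerD2l lerN2; apply: H1; lia.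
have Hne : q != a by apply: contraTneq Hpb => ->; rewrite subrr; case: big_th.
have Hd : g (~~ s) q - g (~~ s) a = g s a - g s q by rewrite !flipN; lra.
exists q; split=> //; first lia; split.
- left; exists a; split; [lia|by rewrite Hd|].
  by move=> k Hk; rewrite !flipN ltrN2; apply: H2; lia.
- by right=> k Hk; rewrite !flipN lerN2; apply: H1; lia.
- by exists a; split; [lia|rewrite Hd].
Qed.

(** The leftmost minimum on [p, b] works. It is far below [p]: otherwise [b] lies above [p], so [p]
    must drop before [b], and that drop would go below the minimum. *)
Lemma ext_between s p a b : ext s p -> (p <= a < b)%N -> (b < n)%N ->
  big (g s b - g s a) -> exists q, (p < q < b)%N /\ ext (~~ s) q.
Proof.
move=> [_ HR _] Hab Hbn Hbig.
have /(argminP (g s)) [q [Hq H1 H2]] : (p <= b)%N by lia.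
have Hqb : big (g s b - g s q) by apply: bigW Hbig _; rewrite lerD2l lerN2; apply: H1; lia.
have Hq_b : q != b by apply: contraTneq Hqb => ->; rewrite subrr; case: big_th.
have Hpq : big (g s p - g s q).
  apply/negPn/negP => Hn; have Hlt := bigN Hqb Hn.
  have {}Hlt : g s p < g s b by lra.
  case: HR => [[r [Hr Hbr Hk]]|/(_ b)]; last by move=> /(_ ltac:(lia)); lra.
  have Hrb : (r <= b)%N.
    by rewrite leqNgt; apply/negP => Hbr'; have := Hk b ltac:(lia); lra.
  by have := H1 r ltac:(lia); have := bigN Hbr Hn; lra.
have Hne : q != p by apply: contraTneq Hpq => ->; rewrite subrr; case: big_th.
exists q; split; first lia; split.
- left; exists p; split; [lia| by rewrite !flipN opprK addrC |].
  by move=> k Hk; rewrite !flipN ltrN2; apply: H2; lia.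
- left; exists b; split; [lia| by rewrite !flipN opprK addrC |].
  by move=> k Hk; rewrite !flipN lerN2; apply: H1; lia.
- by exists b; split; [lia| rewrite !flipN opprK addrC].
Qed.

(** The lower of the two maxima has to drop before the other one is reached, since the other one
    blocks its view. From the bottom of this drop the climb to [p'] is big, and [ext_between]
    applies. *)
Lemma ext_sep s p p' : ext s p -> ext s p' -> (p < p')%N -> (p' < n)%N ->
  exists q, (p < q < p')%N /\ ext (~~ s) q.
Proof.
move=> Hp Hp' Hlt Hn.
suff [q [Hq Hb]] : exists q, (p < q < p')%N /\ big (g s p' - g s q).
  have [r [Hr Er]] := ext_between Hp (a := q) (b := p') ltac:(lia) Hn Hb.
  by exists r; split.
have [Hle|Hgt] := leP (g s p') (g s p).
  case: Hp' => [[[q [Hq Hb Hk]]|H] _ _]; last by have := H p Hlt; lra.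
  exists q; split=> //.
  have Hqp : q != p by apply/eqP => E; move: (big_gt0 Hb); rewrite E; lra.
  by case: (ltnP q p) => Hqp'; [have := Hk p ltac:(lia); lra | lia].
case: Hp => [_ [[q [Hq Hb Hk]]|H] _]; last by have := H p' ltac:(lia); lra.
exists q; split; last by apply: bigW Hb _; lra.
have := big_gt0 Hb => Hb0.
have Hqp : q != p' by apply/eqP => E; move: Hb0; rewrite E; lra.
by case: (ltnP p' q) => Hqp'; [have := Hk p' ltac:(lia); lra | lia].
Qed.

(** A value far above [p] forces a witness of its drop on the same side, and this witness in turn
    forces a witness of its rise there. The one nearer to [p] breaks the condition attached to the
    other. *)
Lemma ext_nodouble s p : (p < n)%N -> ext s p -> ~ ext (~~ s) p.
Proof.
move=> Hpn [L1 R1 [q [Hq Hbq]]] [L2 R2 [r [Hr Hbr]]].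
move: Hbr; rewrite !flipN opprK addrC => Hbr.
have := big_gt0 Hbq; have := big_gt0 Hbr => Hr0 Hq0.
have Hrp : r != p by apply/eqP => E; move: Hr0; rewrite E; lra.
case: (ltnP r p) => Hrp'.
  case: L1 => [[u [Hu Hbu Hk]]|/(_ r Hrp')]; last by lra.
  have Hu0 := big_gt0 Hbu.
  case: L2 => [[v [Hv Hbv Hk2]]|/(_ u Hu)]; last by rewrite !flipN; lra.
  move: Hbv; rewrite !flipN opprK addrC => Hbv; have Hv0 := big_gt0 Hbv.
  have Huv : u != v by apply/eqP => E; move: Hv0 Hu0; rewrite E; lra.
  case: (ltnP u v) => Huv'; first by have := Hk v ltac:(lia); lra.
  by have := Hk2 u ltac:(lia); rewrite !flipN; lra.
case: R1 => [[u [Hu Hbu Hk]]|/(_ r ltac:(lia))]; last by lra.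
have Hu0 := big_gt0 Hbu.
case: R2 => [[v [Hv Hbv Hk2]]|/(_ u Hu)]; last by rewrite !flipN; lra.
move: Hbv; rewrite !flipN opprK addrC => Hbv; have Hv0 := big_gt0 Hbv.
have Huv : u != v by apply/eqP => E; move: Hv0 Hu0; rewrite E; lra.
case: (ltnP u v) => Huv'; last by have := Hk v ltac:(lia); lra.
by have := Hk2 u ltac:(lia); rewrite !flipN; lra.
Qed.

Definition Ext p : Prop := exists s, ext s p.

Lemma extP s p : Ext p -> ext s p \/ ext (~~ s) p.
Proof. by move=> [[]]; case: s; auto. Qed.

Lemma largest (P : nat -> Prop) b : (exists p, (p < b)%N /\ P p) ->
  exists p, [/\ (p < b)%N, P p & forall q, (p < q < b)%N -> ~ P q].
Proof.
elim: b => [[p []//]|b IH [p [Hp HP]]].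
case: (pselect (P b)) => Hb; first by exists b; split=> // q; lia.
have [|p' [H1 H2 H3]] := IH.
  exists p; split=> //; rewrite ltn_neqAle; apply/andP; split; last lia.
  by apply/eqP => E; rewrite E in HP.
exists p'; split=> //; first lia.
move=> q Hq; have [->//|Hne] := eqVneq q b; apply: H3; lia.
Qed.

(* A downswing meets some descent between consecutive extrema. *)
Lemma swing_meets s a b : (a < b < n)%N -> big (g s a - g s b) ->
  exists p, [/\ (p < b)%N, ext s p, forall c, (p < c <= a)%N -> ~ Ext c
    & exists q, (p < q < n)%N /\ ext (~~ s) q].
Proof.
move=> Hab Hbig.
have [q [Hq Eq Hbq]] := ext_last Hab Hbig.
(* Cutting at [q] as well guarantees that the maximum chosen next lies before [q], so that a minimum
   follows it. *)
pose b' := minn b q.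
have Hbb' : big (g s a - g s b') by rewrite /b'; case: leqP.
have Hab' : (a < b' < n)%N by rewrite /b'; lia.
have [p [Hp Ep Hmax]] := largest (ext_first Hab' Hbb').
exists p; split=> //; first by lia.
  move=> c Hc /(extP s) [Ec|Ec]; first by apply: (Hmax c) => //; lia.
  have [|||r [Hr]] := ext_between Ec (a := a) (b := b').
  - by lia.
  - by lia.
  - by rewrite !flipN; apply: bigW Hbb' _; lra.
  by rewrite negbK => /Hmax; apply; lia.
by exists q; split=> //; lia.
Qed.

(** If the drop from [p] to [q] were not big, a witness of the drop after [p] would lie below [q];
    then the rise required at [q] yields either a big drop from [p] to [q] after all or an extremum
    in between. If [p] is never exceeded on its right, [q] turns out to be a global minimum, hence
    as deep as the point that makes [p] an extremum. *)
Lemma ext_gap s p q : ext s p -> ext (~~ s) q -> (p < q < n)%N ->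
  (forall c, (p < c < q)%N -> ~ Ext c) -> big (g s p - g s q).
Proof.
move=> Ep Eq Hpq Hno; apply/negPn/negP => Hn.
have [Lp Rp [e [He Hbe]]] := Ep; have [Lq Rq _] := Eq.
have EN : g (~~ s) = fun k => - g s k by apply/funext => k; rewrite flipN.
rewrite EN in Lq Rq; move: Lq Rq => Hq1 Hq2.
case: Rp => [[r [Hr Hbr Hk]]|Rp].
  have Hrq : g s r < g s q by have := bigN Hbr Hn; lra.
  have Hne : r != q by apply/eqP => E; move: Hrq; rewrite E ltxx.
  case: (ltnP q r) => Hqr.
    case: Hq2 => [[u [Hu Hbu Hk2]]|/(_ r ltac:(lia))]; last by lra.
    have Hu0 := big_gt0 Hbu.
    have Hur : u != r by apply/eqP => E; move: Hu0; rewrite E; lra.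
    case: (ltnP u r) => Hur'; last by have := Hk2 r ltac:(lia); lra.
    by have := Hk u ltac:(lia) => Hup; move/negP: Hn; apply; apply: bigW Hbu _; lra.
  case: Hq1 => [[u [Hu Hbu Hk2]]|/(_ r ltac:(lia))]; last by lra.
  have Hu0 := big_gt0 Hbu.
  have Hur : u != r by apply/eqP => E; move: Hu0; rewrite E; lra.
  case: (ltnP u r) => Hur'; first by have := Hk2 r ltac:(lia); lra.
  have [|||v [Hv Ev]] := ext_between Ep (a := r) (b := u).
  - by lia.
  - by lia.
  - by apply: bigW Hbu _; lra.
  by apply: (Hno v); [lia|exists (~~ s)].
have {}Hq2 : forall k, (q < k < n)%N -> g s q <= g s k.
  case: Hq2 => [[u [Hu Hbu _]]|H k /H]; last by rewrite lerN2.
  by have := Rp u ltac:(lia) => ?; exfalso; move/negP: Hn; apply; apply: bigW Hbu _; lra.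
have {}Hq1 : forall k, (k < q)%N -> g s q < g s k.
  case: Hq1 => [[u [Hu Hbu Hk2]]|H k /H]; last by rewrite ltrN2.
  have Hup : g s p < g s u by have := bigN Hbu Hn; lra.
  have Hne : u != p by apply/eqP => E; move: Hup; rewrite E ltxx.
  case: (ltnP p u) => Hpu; first by have := Rp u ltac:(lia); lra.
  case: Lp => [[r [Hr Hbr Hk]]|/(_ u ltac:(lia))]; last by lra.
  have Hru : u != r by apply/eqP => E; move: Hbr; rewrite -E => /big_gt0; lra.
  case: (ltnP u r) => Hur; last by have := Hk u ltac:(lia); lra.
  by have := Hk2 r ltac:(lia) => ?; exfalso; move/negP: Hn; apply; apply: bigW Hbr _; lra.
move/negP: Hn; apply; apply: bigW Hbe _.
suff : g s q <= g s e by lra.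
by have [->//|H] := eqVneq e q; case: (ltnP e q) => Hlt; [apply/ltW/Hq1|apply: Hq2]; lia.
Qed.

End Zigzag.

(** * Alternating chains *)

Section Cost.
Variables (R : realType) (n : nat) (f : nat -> R) (cost : nat -> R).
Local Notation g := (flip f).

Definition persistence : Prop := forall p big, (p < n)%N -> threshold big ->
  big (cost p) <-> Ext n f big p.
Hypothesis costP : persistence.

Definition chain (big : R -> bool) : seq nat := [seq p <- iota 0 n | big (cost p)].

(* [i]-th segment of [z] descends (resp. has no ascent that is [big]) in the
   function [f], turned upside down if [s (+) odd i] is false. *)
Definition zig (s : bool) (z : seq nat) : Prop := forall i, (i.+1 < size z)%N ->
  g (s (+) odd i) (nth 0%N z i.+1) < g (s (+) odd i) (nth 0%N z i).
Definition tame (big : R -> bool) (s : bool) (z : seq nat) : Prop :=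
  forall i a b, (i.+1 < size z)%N -> (nth 0%N z i <= a < b)%N -> (b <= nth 0%N z i.+1)%N ->
  ~~ big (g (s (+) odd i) b - g (s (+) odd i) a).
Definition ends (e : seq nat) : seq nat :=
  set_nth 0%N (set_nth 0%N e 0 0%N) (size e).-1 n.-1.

Lemma size_ends e : (2 <= size e)%N -> size (ends e) = size e.
Proof. by move=> H; rewrite !size_set_nth; lia. Qed.

Lemma nth_ends e i : (2 <= size e)%N -> (i < size e)%N ->
  nth 0%N (ends e) i = if i == (size e).-1 then n.-1 else if i == 0%N then 0%N else nth 0%N e i.
Proof. by move=> H Hi; rewrite nth_set_nth /= nth_set_nth. Qed.

Lemma ends_cons_rcons u t v : ends (u :: rcons t v) = 0%N :: rcons t n.-1.
Proof.
rewrite /ends /= size_rcons /=; congr (_ :: _).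
by elim: t => [//|a t /= ->].
Qed.

Lemma sorted_nth_lt (e : seq nat) i j : sorted ltn e -> (i < j < size e)%N ->
  (nth 0%N e i < nth 0%N e j)%N.
Proof. by move=> He Hij; apply: (sorted_ltn_nth ltn_trans) => //; rewrite ?inE; lia. Qed.

Lemma sorted_nth_le (e : seq nat) i j : sorted ltn e -> (i <= j < size e)%N ->
  (nth 0%N e i <= nth 0%N e j)%N.
Proof.
by move=> He Hij; have [->//|Hne] := eqVneq i j; apply/ltnW/sorted_nth_lt => //; lia.
Qed.

Lemma mem_nthP (e : seq nat) p : p \in e -> exists i, (i < size e)%N /\ p = nth 0%N e i.
Proof. by move=> /(nthP 0%N) [i Hi <-]; exists i. Qed.

Section Threshold.
Variable big : R -> bool.
Hypothesis big_th : threshold big.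
Local Notation E := (chain big).
Local Notation ext := (ext n f big).

Lemma chain_sorted : sorted ltn E.
Proof. by apply: sorted_filter; [exact: ltn_trans|exact: iota_ltn_sorted]. Qed.

Lemma mem_chain p : (p \in E) = (p < n)%N && big (cost p).
Proof. by rewrite mem_filter mem_iota /= andbC. Qed.

Lemma chainP p : p \in E <-> (p < n)%N /\ Ext n f big p.
Proof.
rewrite mem_chain; split=> [/andP [H1 H2]|[H1 H2]]; first by split=> //; apply/costP.
by rewrite H1; apply/costP.
Qed.

Lemma chain_lt i : (i < size E)%N -> (nth 0%N E i < n)%N.
Proof. by move=> /(mem_nth 0%N) /chainP []. Qed.

Lemma chain_ext i : (i < size E)%N -> Ext n f big (nth 0%N E i).
Proof. by move=> /(mem_nth 0%N) /chainP []. Qed.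

Lemma chain_succ i c : (i.+1 < size E)%N -> (nth 0%N E i < c < nth 0%N E i.+1)%N ->
  ~ Ext n f big c.
Proof.
move=> Hi Hc Hext.
have Hcn : (c < n)%N by have := chain_lt Hi; lia.
have : c \in E by apply/chainP.
move=> /mem_nthP [k [Hk Ek]].
have [Hki|Hki] := leqP k i.
  by have := sorted_nth_le chain_sorted (i := k) (j := i) ltac:(lia); lia.
by have := sorted_nth_le chain_sorted (i := i.+1) (j := k) ltac:(lia); lia.
Qed.

Definition alternates s : Prop := forall i, (i < size E)%N -> ext (s (+) odd i) (nth 0%N E i).

Lemma chain_alt s : ext s (nth 0%N E 0) -> alternates s.
Proof.
move=> H0; elim=> [|i IH] Hi; first by rewrite addbF.
have Hi' := IH ltac:(lia).
rewrite /= addbN; case: (extP (s (+) odd i) (chain_ext Hi)) => // He.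
have [q [Hq Eq]] := ext_sep big_th Hi' He (sorted_nth_lt chain_sorted (i := i) (j := i.+1) ltac:(lia))
  (chain_lt Hi).
by case: (chain_succ Hi Hq); exists (~~ (s (+) odd i)).
Qed.

Lemma chain_alternates : exists s, alternates s.
Proof.
case: (posnP (size E)) => [H0|HE]; first by exists true => i; rewrite H0.
by have [s /chain_alt Hs] := chain_ext HE; exists s.
Qed.

Lemma chain_gap s i : alternates s -> (i.+1 < size E)%N ->
  big (g (s (+) odd i) (nth 0%N E i) - g (s (+) odd i) (nth 0%N E i.+1)).
Proof.
move=> Hs Hi; apply: (ext_gap (n := n)) => //.
- by apply: Hs; lia.
- by have := Hs _ Hi; rewrite /= addbN.
- by rewrite chain_lt // sorted_nth_lt ?chain_sorted //; lia.
- by move=> c Hc; exact: chain_succ Hc.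
Qed.

Lemma swing_chain s a b : (a < b < n)%N -> big (g s a - g s b) -> (2 <= size E)%N.
Proof.
move=> Hab Hb.
have [p [Hp Ep _ [q [Hq Eq]]]] := swing_meets big_th Hab Hb.
have Up : p \in E by apply/chainP; split; [lia|exists s].
have Uq : q \in E by apply/chainP; split; [lia|exists (~~ s)].
have : (size [:: p; q] <= size E)%N.
  apply: uniq_leq_size => [|x]; first by rewrite /= inE; lia.
  by rewrite !inE => /orP [] /eqP ->.
by [].
Qed.

(** An extremum comes with a big drop to some point, and a big swing in either direction produces an
    extremum of each kind. *)
Lemma chain_size : (0 < size E)%N -> (2 <= size E)%N.
Proof.
move=> HE; have [s [_ _ [q [Hq Hb]]]] := chain_ext HE.
have Hp := chain_lt HE; have H0 := big_gt0 big_th Hb.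
have Hne : q != nth 0%N E 0 by apply/eqP => Eq; move: H0; rewrite Eq; lra.
case: (ltnP q (nth 0%N E 0)) => Hlt.
  apply: (@swing_chain (~~ s) q (nth 0%N E 0)); first lia.
  by rewrite !flipN; apply: (bigW big_th Hb); lra.
by apply: (@swing_chain s (nth 0%N E 0) q); first lia.
Qed.

(** By [swing_meets], a big swing against segment [i] yields a point [j] of the chain that starts a
    descent of the wrong kind, with no extremum between it and [a]. Alternation excludes [j = i],
    and for [j < i] the point [j.+1] would be in between. For [j > i] the segment ends too early to
    contain the swing, because [j] is not the last point of the chain. *)
Lemma chain_tame s : alternates s -> (2 <= size E)%N -> tame big s (ends E).
Proof.
move=> Hs HE i a b; rewrite size_ends // => Hi.
rewrite !nth_ends //; [|lia].
rewrite (_ : (i == (size E).-1) = false); last lia.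
rewrite (_ : (i.+1 == 0)%N = false) // => Hia Hb; apply/negP => Hbig.
have Hn : (b < n)%N.
  have := chain_lt Hi; move: Hb; case: eqP; lia.
have Hbig' : big (g (~~ (s (+) odd i)) a - g (~~ (s (+) odd i)) b).
  by rewrite !flipN; apply: (bigW big_th Hbig); lra.
have [p [Hpb Ep Hno [q [Hq Eq]]]] := swing_meets (n := n) big_th (s := ~~ (s (+) odd i)) (a := a)
  (b := b) ltac:(lia) Hbig'.
have : p \in E by apply/chainP; split; [lia|exists (~~ (s (+) odd i))].
move=> /mem_nthP [j [Hj Ej]]; subst p.
have : q \in E by apply/chainP; split; [lia|exists (~~ ~~ (s (+) odd i))].
move=> /mem_nthP [k [Hk Ek]]; subst q.
have Hjk : (j < k)%N.
  by rewrite ltnNge; apply/negP => H; have := sorted_nth_le chain_sorted (i := k) (j := j); lia.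
have Hij : i != j.
  apply/eqP => Eij; apply: (ext_nodouble big_th _ (Hs j Hj)); first exact: chain_lt.
  by rewrite -[in odd j]Eij.
case: (ltnP j i) => Hji.
  have /Hno : (nth 0%N E j < nth 0%N E j.+1 <= a)%N.
    have := sorted_nth_lt chain_sorted (i := j) (j := j.+1) ltac:(lia).
    have := sorted_nth_le chain_sorted (i := j.+1) (j := i) ltac:(lia).
    by move: Hia; case: eqP; lia.
  by apply; apply: chain_ext; lia.
have := sorted_nth_le chain_sorted (i := i.+1) (j := j) ltac:(lia).
by move: Hb; case: eqP; lia.
Qed.

(** By tameness, moving an end of the chain to 0 or [n.-1] loses less than a big amount, while the
    gap to the neighbouring extremum is big. This needs a segment to have only one of its ends
    moved, hence at least three extrema. *)
Lemma chain_zig s : alternates s -> (3 <= size E)%N -> zig s (ends E).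
Proof.
move=> Hs HE i; have HE2 : (2 <= size E)%N by lia.
have Ht := chain_tame Hs HE2; rewrite size_ends // => Hi.
have := Ht i; rewrite size_ends // !nth_ends //; last lia.
rewrite (_ : (i == (size E).-1) = false); last lia.
rewrite (_ : (i.+1 == 0)%N = false) //; have Hgap := chain_gap Hs Hi; have Hg0 := big_gt0 big_th Hgap.
case: (i.+1 =P (size E).-1) => [E1|N1]; case: (i =P 0%N) => [E0|N0].
- lia.
- have Hl := chain_lt Hi.
  have [E2|N2] := eqVneq (nth 0%N E i.+1) n.-1; first by rewrite -E2; lra.
  have Hlt := sorted_nth_lt chain_sorted (i := i) (j := i.+1) ltac:(lia).
  move/(_ (nth 0%N E i.+1) n.-1 Hi ltac:(lia) (leqnn _)) => /(bigN big_th Hgap); lra.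
- subst i; have [E2|N2] := eqVneq (nth 0%N E 0) 0%N; first by move: Hg0; rewrite E2; lra.
  have Hlt := sorted_nth_lt chain_sorted (i := 0) (j := 1) ltac:(lia).
  move/(_ 0%N (nth 0%N E 0) Hi ltac:(lia) ltac:(lia)) => /(bigN big_th Hgap); lra.
- by move=> _; lra.
Qed.

(* Each swing of the chain needs a segment of its own: going through the swings
   from left to right, a segment which reaches beyond the start of the [i]-th
   swing and has its direction is at least the [i]-th one. *)
Lemma chain_lower s z : sorted ltn z -> (2 <= size z)%N -> nth 0%N z 0 = 0%N ->
  nth 0%N z (size z).-1 = n.-1 -> tame big s z -> (size E <= size z)%N.
Proof.
move=> Hz Hz2 Hz0 Hzn Ht.
case: (ltnP (size E) 2) => HE; first lia.
have [s0 Hs] := chain_alternates.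
have key i j : (i.+1 < size E)%N -> (j.+1 < size z)%N -> s (+) odd j = s0 (+) odd i ->
    (nth 0%N E i < nth 0%N z j.+1)%N -> (i <= j)%N.
  elim: i j => [//|i IH] j Hi Hj Hd Hlt.
  have Hlti := sorted_nth_lt chain_sorted (i := i) (j := i.+1) ltac:(lia).
  have Hzj : (nth 0%N E i < nth 0%N z j)%N.
    rewrite ltnNge; apply/negP => Hle.
    have := Ht j (nth 0%N E i) (nth 0%N E i.+1) Hj; rewrite Hlti Hle (ltnW Hlt) => /(_ isT isT).
    rewrite Hd /= addbN !flipN => /negP; apply.
    have := chain_gap Hs (i := i) ltac:(lia) => H; apply: (bigW big_th H); lra.
  case: j Hj Hd Hlt Hzj => [|j] Hj Hd Hlt Hzj; first by rewrite Hz0 in Hzj.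
  apply: IH => //; [lia|lia|].
  by move: Hd => /=; rewrite !addbN => /negb_inj.
set m := (size E).-2; set l := (size z).-2.
have Em : m.+2 = size E by rewrite /m; lia.
have El : l.+2 = size z by rewrite /l; lia.
have Hlti := sorted_nth_lt chain_sorted (i := m) (j := m.+1) ltac:(lia).
have Hmn : (nth 0%N E m.+1 < n)%N by apply: chain_lt; lia.
have Ezl : nth 0%N z l.+1 = n.-1 by rewrite -Hzn -El.
(* The last segment may run against the last swing. Then this swing starts before the last segment
   does, and [key] is applied to the segment before. *)
case: (eqVneq (s (+) odd l) (s0 (+) odd m)) => Hd.
  have := key m l ltac:(lia) ltac:(lia) Hd; rewrite Ezl => /(_ ltac:(lia)); lia.
have {}Hd : s (+) odd l = ~~ (s0 (+) odd m) by move: Hd; case: (s (+) _); case: (s0 (+) _).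
have Hzj : (nth 0%N E m < nth 0%N z l)%N.
  rewrite ltnNge; apply/negP => Hle.
  have := Ht l (nth 0%N E m) (nth 0%N E m.+1) ltac:(lia); rewrite Hlti Hle Ezl.
  move=> /(_ isT ltac:(lia)); rewrite Hd !flipN => /negP; apply.
  have := chain_gap Hs (i := m) ltac:(lia) => H; apply: (bigW big_th H); lra.
case: l El Ezl Hd Hzj => [|l] El Ezl Hd Hzj; first by rewrite Hz0 in Hzj.
have := key m l ltac:(lia) ltac:(lia) _ Hzj.
rewrite /= addbN in Hd; move=> /(_ (negb_inj Hd)); lia.
Qed.

End Threshold.
End Cost.

(** * OMAFE and segmentations by index *)

Section Omafe.
Variable R : realType.
Implicit Types (D y : seq R) (F h : R -> R).

Lemma bigmax_seq_leP (I : eqType) (x0 : R) (r : seq I) (P : pred I) (F : I -> R) e :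
  \big[Num.max/x0]_(x <- r | P x) F x <= e <->
  x0 <= e /\ forall x, x \in r -> P x -> F x <= e.
Proof.
elim: r => [|a r IH]; first by rewrite big_nil; split=> [H|[]//]; split.
rewrite big_cons; case: ifP => Pa.
  rewrite ge_max; split=> [/andP [H1 /IH [H2 H3]]|[H1 H2]].
    by split=> // x; rewrite inE => /orP [/eqP -> //|]; exact: H3.
  apply/andP; split; first by apply: H2; rewrite ?mem_head.
  by apply/IH; split=> // x Hx; apply: H2; rewrite inE Hx orbT.
split=> [/IH [H1 H2]|[H1 H2]].
  by split=> // x; rewrite inE => /orP [/eqP ->|]; [rewrite Pa|exact: H2].
by apply/IH; split=> // x Hx; apply: H2; rewrite inE Hx orbT.
Qed.

Lemma bigmax_seq_ge (I : eqType) (x0 : R) (r : seq I) (P : pred I) (F : I -> R) x :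
  x \in r -> P x -> F x <= \big[Num.max/x0]_(x <- r | P x) F x.
Proof. by move=> H1 H2; have /bigmax_seq_leP [_] := lexx (\big[Num.max/x0]_(x <- r | P x) F x); apply. Qed.

Lemma bigmax_seq_ge0 (I : eqType) (x0 : R) (r : seq I) (P : pred I) (F : I -> R) :
  x0 <= \big[Num.max/x0]_(x <- r | P x) F x.
Proof. by have /bigmax_seq_leP [] := lexx (\big[Num.max/x0]_(x <- r | P x) F x). Qed.

(* The optimal increasing approximation is the running maximum minus [e]. *)
Lemma omafe_increasing_le D F a b e : 0 <= e -> a \in D -> a <= b ->
  omafe_increasing D F a b <= e <->
  forall u v, u \in D -> v \in D -> a <= u -> u <= v -> v <= b -> F u - F v <= 2 * e.
Proof.
move=> He Da Hab; rewrite /omafe_increasing; set A := [set _ | _ in _]%classic.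
have A0 : (A !=set0)%classic.
  by exists (max_error D F a b (fun _ => 0)); exists (fun _ => 0).
have Alb : has_lbound A by exists 0 => _ [h _ <-]; exact: bigmax_seq_ge0.
split=> [Hle u v Du Dv Hau Huv Hvb|H].
  suff : (F u - F v) / 2 <= inf A by lra.
  apply: lb_le_inf => // _ [h Hh <-].
  have Hu : `|h u - F u| <= max_error D F a b h.
    by apply: (bigmax_seq_ge _ (fun x => `|h x - F x|)) => //; rewrite Hau (le_trans Huv).
  have Hv : `|h v - F v| <= max_error D F a b h.
    by apply: (bigmax_seq_ge _ (fun x => `|h x - F x|)) => //; rewrite Hvb (le_trans Hau).
  have /= := Hh _ _ Huv; move: Hu Hv; rewrite !ler_norml => /andP [? ?] /andP [? ?]; lra.
pose h x := \big[Num.max/F a]_(u <- D | (a <= u) && (u <= x)) F u - e.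
apply: (@le_trans _ _ (max_error D F a b h)).
  apply: ge_inf => //; exists h => //= x y Hxy; rewrite lerD2r.
  apply/bigmax_seq_leP; split; first exact: bigmax_seq_ge0.
  move=> u Du /andP [H1 H2]; apply: bigmax_seq_ge => //.
  by rewrite H1 (le_trans H2).
apply/bigmax_seq_leP; split=> // x Dx /andP [Hax Hxb].
rewrite ler_norml /h; apply/andP; split.
  suff : F x <= \big[Num.max/F a]_(u <- D | (a <= u) && (u <= x)) F u by lra.
  by apply: bigmax_seq_ge => //; rewrite Hax lexx.
suff : \big[Num.max/F a]_(u <- D | (a <= u) && (u <= x)) F u <= F x + 2 * e by lra.
apply/bigmax_seq_leP; split; first by have := H a x Da Dx (lexx _) Hax Hxb; lra.
by move=> u Du /andP [H1 H2]; have := H u x Du Dx H1 H2 Hxb; lra.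
Qed.

Lemma omafe_decreasingE D F a b :
  omafe_decreasing D F a b = omafe_increasing D (fun x => - F x) a b.
Proof.
have E h h' : (forall x, h' x = - h x) -> max_error D (fun x => - F x) a b h' = max_error D F a b h.
  by move=> Eh; apply: eq_bigr => x _; rewrite Eh -opprD normrN.
rewrite /omafe_decreasing /omafe_increasing; congr inf; apply/seteqP; split=> _ [h Hh <-].
  exists (fun x => - h x); last exact: E.
  by move=> x y /Hh /=; rewrite lerN2.
exists (fun x => - h x); last by rewrite -(E _ h) // => x; rewrite opprK.
by move=> x y /Hh /=; rewrite lerN2.
Qed.

(** * From points of the domain to their indices *)

Section Domain.
Variables (D : seq R) (F : R -> R).
Hypothesis domD : is_domain D.
Local Notation n := (size D).
Local Notation f := (fun i : nat => F D`_i).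

Lemma dom_sorted : sorted <%R D. Proof. by case: domD. Qed.
Lemma dom_size : (2 <= n)%N. Proof. by case: domD. Qed.

Lemma dom_ltW i j : (i < j < n)%N -> D`_i < D`_j.
Proof.
move=> Hij; have [Hi Hj Hlt] : [/\ (i < n)%N, (j < n)%N & (i < j)%N] by split; lia.
by apply: (sorted_ltn_nth lt_trans 0 dom_sorted).
Qed.

Lemma dom_le i j : (i < n)%N -> (j < n)%N -> (D`_i <= D`_j) = (i <= j)%N.
Proof.
move=> Hi Hj; case: (ltnP j i) => H.
  by rewrite leNgt dom_ltW ?H.
by have [->|Hne] := eqVneq i j; [rewrite lexx | apply/ltW/dom_ltW; lia].
Qed.

Lemma dom_uniq : uniq D.
Proof. by apply: sorted_uniq dom_sorted; [exact: lt_trans|exact: ltxx]. Qed.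

Lemma mem_dom i : (i < n)%N -> D`_i \in D. Proof. exact: mem_nth. Qed.

Lemma dom_nthP x : x \in D -> exists i, (i < n)%N /\ x = D`_i.
Proof. by move=> /(nthP 0) [i Hi <-]; exists i. Qed.

Lemma dom_gt0 : (0 < n)%N. Proof. exact: ltnW dom_size. Qed.
Lemma dom_pred : (n.-1 < n)%N. Proof. by rewrite prednK // dom_gt0. Qed.

Lemma dom_last : last_pt D = D`_n.-1.
Proof. by rewrite nth_last /last_pt; have := dom_size; case: D. Qed.

Lemma dom_first : first_pt D = D`_0.
Proof. by rewrite nth0. Qed.

(* [s] is true for a decreasing segment. *)
Lemma omafe_seg_le s a b e : 0 <= e -> (a < b < n)%N -> flip f s b < flip f s a ->
  omafe_seg D F D`_a D`_b <= e <->
  forall i j, (a <= i < j)%N -> (j <= b)%N -> ~~ (2 * e < flip f s j - flip f s i).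
Proof.
move=> He Hab Hs.
pose F' x := if s then - F x else F x.
have -> : omafe_seg D F D`_a D`_b = omafe_increasing D F' D`_a D`_b.
  rewrite /omafe_seg /increasing_seg /decreasing_seg /F'; case: s Hs {F'} => /= Hs.
    by rewrite ltNge ltW // Hs /= omafe_decreasingE.
  by move: Hs; rewrite ltrN2 => ->.
rewrite omafe_increasing_le //; last 2 first.
- by apply: mem_dom; lia.
- by rewrite dom_le; lia.
split=> [H i j Hij Hj|H _ _ /dom_nthP [i [Hi ->]] /dom_nthP [j [Hj ->]]].
  have := H D`_i D`_j; rewrite !mem_dom ?dom_le; try lia.
  move=> /(_ isT isT ltac:(lia) ltac:(lia) ltac:(lia)).
  by rewrite /F' /flip -leNgt; case: (s); lra.
rewrite !dom_le; try lia.
move=> H1 H2 H3; have [->|Hne] := eqVneq i j; first by rewrite subrr; lra.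
have := H i j ltac:(lia) ltac:(lia).
by rewrite /F' /flip -leNgt; case: (s); lra.
Qed.

Definition pts (z : seq nat) : seq R := [seq D`_i | i <- z].

Lemma nth_pts z i : (i < size z)%N -> (pts z)`_i = D`_(nth 0%N z i).
Proof. by move=> Hi; rewrite (nth_map 0%N). Qed.

Definition index_seg (z : seq nat) : Prop :=
  [/\ sorted ltn z, (2 <= size z)%N, nth 0%N z 0 = 0%N & nth 0%N z (size z).-1 = n.-1].

Lemma index_seg_lt z i j : index_seg z -> (i < j < size z)%N ->
  (nth 0%N z i < nth 0%N z j < n)%N.
Proof.
move=> [Hs H2 H0 H1] Hij; rewrite sorted_nth_lt //=.
by have := sorted_nth_le Hs (i := j) (j := (size z).-1) ltac:(lia); have := dom_size; lia.
Qed.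

Lemma seg_index y : is_segmentation D y -> exists z, index_seg z /\ y = pts z.
Proof.
move=> [Hs H2 Hsub Hf Hl]; have Hy0 := ltnW H2.
have Hy1 : ((size y).-1 < size y)%N by rewrite prednK.
exists [seq index x D | x <- y]; split; last first.
  rewrite /pts -map_comp -[LHS]map_id; apply/eq_in_map => x Hx /=.
  by rewrite nth_index // Hsub.
split; rewrite ?size_map //.
- apply/(sortedP 0%N) => i; rewrite size_map => Hi.
  rewrite !(nth_map 0) ?(ltnW Hi) //.
  have H : y`_i < y`_i.+1 by apply/(sortedP 0): Hi.
  have Hyi : y`_i \in D by apply/Hsub/mem_nth/ltnW.
  have Hyi' : y`_i.+1 \in D by apply/Hsub/mem_nth.
  rewrite /= ltnNge; apply/negP; rewrite -dom_le ?index_mem //.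
  by rewrite !nth_index // leNgt H.
- rewrite (nth_map 0) //.
  rewrite nth0 -/(first_pt y) Hf dom_first.
  by apply: index_uniq; [exact: dom_gt0|exact: dom_uniq].
- rewrite (nth_map 0) //.
  have -> : y`_(size y).-1 = last_pt y by rewrite nth_last; case: (y) H2.
  rewrite Hl dom_last.
  by apply: index_uniq; [exact: dom_pred|exact: dom_uniq].
Qed.

Lemma pts_seg z : index_seg z -> is_segmentation D (pts z).
Proof.
move=> Hz; have [Hs H2 H0 H1] := Hz; split; rewrite ?size_map //.
- apply/(sortedP 0) => i; rewrite size_map => Hi.
  rewrite !nth_pts //; last lia.
  by apply: dom_ltW; apply: index_seg_lt => //; lia.
- move=> _ /mapP [i Hi ->]; apply: mem_dom.
  have [k [Hk ->]] := mem_nthP Hi.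
  have [E|Hne] := eqVneq k (size z).-1; first by rewrite E H1; have := dom_size; lia.
  by have := index_seg_lt Hz (i := k) (j := (size z).-1) ltac:(lia); lia.
- by rewrite dom_first /first_pt -nth0 nth_pts ?H0 //; lia.
- have -> : last_pt (pts z) = (pts z)`_(size (pts z)).-1.
    by rewrite nth_last; case: (z) H2.
  by rewrite size_map nth_pts ?H1 ?dom_last //; lia.
Qed.

Lemma zig_alternating s z : (2 <= size z)%N -> zig f s z -> alternating F (pts z).
Proof.
move=> H2 Hz; rewrite /alternating /nsegments size_map; split=> i Hi.
  rewrite !nth_pts; try lia.
  have := Hz i ltac:(lia); rewrite /flip /increasing_seg /decreasing_seg.
  by case: (s (+) odd i); [right | rewrite ltrN2; left].
rewrite !nth_pts; try lia.
have := Hz i ltac:(lia); have := Hz i.+1 ltac:(lia).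
rewrite /flip /increasing_seg /decreasing_seg /= addbN.
case: (s (+) odd i) => /=; rewrite ?ltrN2 => H3 H4; last by rewrite H3 H4.
by rewrite !ltNge (ltW H3) (ltW H4).
Qed.

Lemma alternating_zig z : (2 <= size z)%N -> alternating F (pts z) -> exists s, zig f s z.
Proof.
move=> H2; rewrite /alternating /nsegments size_map => -[H3 H4].
exists (decreasing_seg F (pts z)`_0 (pts z)`_1).
suff key : forall i, (i.+1 < size z)%N ->
    decreasing_seg F (pts z)`_0 (pts z)`_1 (+) odd i = decreasing_seg F (pts z)`_i (pts z)`_i.+1.
  move=> i Hi; rewrite key //; have := H3 i ltac:(lia).
  rewrite /flip /increasing_seg /decreasing_seg !nth_pts; try lia.
  by case: ifP => Hd [H|H] //=; rewrite ?ltrN2 //; move: H; rewrite ?Hd // => H; rewrite Hd in H.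
elim=> [|i IH] Hi; first by rewrite addbF.
rewrite /= addbN IH; last lia.
have := H4 i ltac:(lia); have := H3 i.+1 ltac:(lia); have := H3 i ltac:(lia).
rewrite /increasing_seg /decreasing_seg.
set u := (pts z)`_i; set v := (pts z)`_i.+1; set w := (pts z)`_i.+2.
move=> A B C; rewrite -C.
case: A => HA; first by rewrite HA ltNge (ltW HA).
by rewrite HA ltNge (ltW HA).
Qed.

Lemma omafe_le s z e : 0 <= e -> index_seg z -> zig f s z ->
  omafe D F (pts z) <= e <-> tame f (fun x => 2 * e < x) s z.
Proof.
move=> He Hz Hzig; have [_ H2 _ _] := Hz.
rewrite /omafe /nsegments size_map bigmax_seq_leP; split=> [[_ H] i a b Hi Ha Hb|H].
  have Hi' : (i < (size z).-1)%N by lia.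
  have := H (Ordinal Hi') (mem_index_enum _) isT; rewrite /= !nth_pts; try lia.
  move/(omafe_seg_le (s := s (+) odd i) He (index_seg_lt Hz (i := i) (j := i.+1) ltac:(lia))).
  by move=> /(_ (Hzig i Hi)); apply; lia.
split=> // -[i Hi] _ _ /=.
rewrite !nth_pts; try lia.
apply/(omafe_seg_le (s := s (+) odd i) He).
- by apply: index_seg_lt => //; lia.
- by apply: Hzig; lia.
- by move=> a b Ha Hb; apply: H => //; lia.
Qed.

Lemma omafe_ge0 y : 0 <= omafe D F y.
Proof. exact: bigmax_seq_ge0. Qed.

Lemma ends_seg e : sorted ltn e -> all (fun i => i < n)%N e -> (2 <= size e)%N ->
  index_seg (ends n e).
Proof.
move=> Hs /allP Hn H2.
have Hlt i : (i < size e)%N -> (nth 0%N e i < n)%N by move=> Hi; apply/Hn/mem_nth.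
split; rewrite ?size_ends //.
- apply/(sortedP 0%N) => i; rewrite size_ends // => Hi.
  rewrite !nth_ends //; last lia.
  rewrite (_ : (i == (size e).-1) = false); last lia.
  rewrite (_ : (i.+1 == 0)%N = false) //.
  have := sorted_nth_lt Hs (i := i) (j := i.+1) ltac:(lia); have := Hlt i.+1 Hi.
  by case: (i.+1 =P (size e).-1); case: (i =P 0%N); lia.
- rewrite nth_ends //; last lia.
  by rewrite (_ : (0 == (size e).-1)%N = false) //; lia.
- by rewrite nth_ends ?eqxx //; lia.
Qed.

Lemma ends_represents e s : sorted ltn e -> all (fun i => i < n)%N e -> (2 <= size e)%N ->
  perm_eq s (pts e) -> represents D s (pts (ends n e)).
Proof.
move=> Hs Hn H2 Hp.
have Hss : sorted <%R (pts e).
  apply/(sortedP 0) => i; rewrite size_map => Hi; rewrite !nth_pts //; last lia.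
  apply: dom_ltW; rewrite sorted_nth_lt //; last lia.
  by move/allP: Hn; apply; apply: mem_nth.
split.
- rewrite (perm_uniq Hp).
  by apply: sorted_uniq Hss; [exact: lt_trans|exact: ltxx].
- move=> x; rewrite (perm_mem Hp) => /mapP [i Hi ->]; apply: mem_dom.
  by move/allP: Hn; apply.
have -> : sort <=%R s = pts e.
  rewrite (_ : sort _ s = sort <=%R (pts e)); last first.
    by apply/(perm_sortP le_total le_trans le_anti).
  rewrite sorted_sort //; first exact: le_trans.
  by apply: sub_sorted Hss => x y /ltW.
case: e H2 {Hs Hn Hp Hss} => [//|u e]; case: (lastP e) => [//|t v _].
exists D`_u, D`_v, (pts t); split; first by rewrite /pts /= map_rcons.
by rewrite ends_cons_rcons /pts /= map_rcons dom_first dom_last.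
Qed.

(** Tameness bounds the error of the constructed segmentation by [v], and [v] bounds all competitors
    from below; this gives optimality and the exact value together. *)
Lemma query_answerI K e s v d : sorted ltn e -> all (fun i => i < n)%N e ->
  (2 <= size e <= K.+1)%N -> perm_eq s (pts e) -> 0 <= v ->
  (forall w, is_segmentation D w -> alternating F w -> (nsegments w <= K)%N -> v <= omafe D F w) ->
  zig f d (ends n e) -> tame f (fun x => 2 * v < x) d (ends n e) ->
  query_answer D F K s v.
Proof.
move=> He Hn /andP [H2 HK] Hp Hv HLB Hz Ht.
have Hi := ends_seg He Hn H2.
have Hseg := pts_seg Hi.
have Halt : alternating F (pts (ends n e)).
  by apply: zig_alternating Hz; rewrite size_ends.
have HsK : (nsegments (pts (ends n e)) <= K)%N.
  by rewrite /nsegments size_map size_ends //; lia.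
have Hle : omafe D F (pts (ends n e)) <= v by apply/(omafe_le Hv Hi Hz).
exists (pts (ends n e)); split=> //.
- exact: ends_represents.
- move=> _; split=> // w H3 H4 H5.
  exact: le_trans Hle (HLB _ H3 H4 H5).
- by apply/le_anti; rewrite Hle HLB.
Qed.

End Domain.
End Omafe.

(** * Choice of the segmentation *)

Lemma ext_mono (R : realType) n (f : nat -> R) (big big' : R -> bool) s p :
  (forall x, big x -> big' x) -> ext n f big s p -> ext n f big' s p.
Proof.
move=> H [[[q [A1 A2 A3]]|A] [[r [B1 B2 B3]]|B] [t [C1 C2]]]; split; try by [left; exists q; split; auto
  | right | left; exists r; split; auto | exists t; auto].
Qed.

(** Points of equal persistence are listed from left to right. This is what locates tied extrema
    relative to each other in the exceptional cases. *)
Definition cost_order (R : realType) (cost : nat -> R) (p q : nat) : bool :=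
  (cost q < cost p) || ((cost p == cost q) && (p <= q)%N).

(** * Short segmentations, and K beyond the number of points *)

Section Single.
Variables (R : realType) (D : seq R) (F : R -> R).
Local Notation n := (size D).
Local Notation f := (fun i : nat => F D`_i).
Local Notation g := (flip f).

Lemma tame_single (big : R -> bool) s (a b : nat) :
  (forall i j, (a <= i < j)%N -> (j <= b)%N -> ~~ big (g s j - g s i)) ->
  tame f big s [:: a; b].
Proof. by move=> H [|i] i' j' //= _; rewrite addbF; exact: H. Qed.

Lemma zig_single s (a b : nat) : g s b < g s a -> zig f s [:: a; b].
Proof. by move=> H [|i] //= _; rewrite addbF. Qed.

Lemma tame_cons (big : R -> bool) s (a b : nat) z :
  (forall i j, (a <= i < j)%N -> (j <= b)%N -> ~~ big (g s j - g s i)) ->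
  tame f big (~~ s) (b :: z) -> tame f big s (a :: b :: z).
Proof.
move=> H Hz [|i] i' j'; first by move=> /= _; rewrite addbF; exact: H.
by move=> Hi; rewrite /= addbN -addNb; apply: Hz.
Qed.

Lemma zig_cons s (a b : nat) z : g s b < g s a -> zig f (~~ s) (b :: z) ->
  zig f s (a :: b :: z).
Proof.
move=> H Hz [|i]; first by move=> /= _; rewrite addbF.
by move=> Hi; rewrite /= addbN -addNb; apply: Hz.
Qed.

Hypothesis domD : is_domain D.

Definition max_swing s d : Prop :=
  (forall a b, (a <= b < n)%N -> g s b - g s a <= d) /\
  exists a b, (a <= b < n)%N /\ d = g s b - g s a.

Lemma index_seg2 : index_seg D [:: 0%N; n.-1].
Proof. by split=> //=; rewrite andbT; have := (dom_size domD); lia. Qed.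

Lemma omafe_one s d : g s n.-1 < g s 0 -> max_swing s d ->
  omafe D F (pts D [:: 0%N; n.-1]) = d / 2.
Proof.
move=> Hs [Hle [a [b [Hab Ed]]]].
have Hz := zig_single Hs.
have d0 : 0 <= d by have := Hle 0%N 0%N (dom_gt0 domD); rewrite subrr.
apply/le_anti/andP; split.
  apply/(omafe_le domD _ index_seg2 Hz); first by rewrite divr_ge0.
  apply: tame_single => i j Hi Hj; rewrite -leNgt.
  by have := Hle i j ltac:(lia); lra.
have He := omafe_ge0 D F (pts D [:: 0%N; n.-1]).
have /(omafe_le domD He index_seg2 Hz) Ht := lexx (omafe D F (pts D [:: 0%N; n.-1])).
have [E|Hne] := eqVneq a b; first by move: Ed; rewrite E subrr; lra.
have := Ht 0%N a b isT; rewrite /= addbF => /(_ ltac:(lia) ltac:(lia)).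
by rewrite -leNgt -Ed; lra.
Qed.

Lemma omafe_one_flat mx mn : F D`_0 = F D`_n.-1 ->
  (forall i, (i < n)%N -> mn <= f i <= mx) ->
  (exists i, (i < n)%N /\ mx = f i) -> (exists i, (i < n)%N /\ mn = f i) ->
  omafe D F (pts D [:: 0%N; n.-1]) = (mx - mn) / 2.
Proof.
move=> Heq Hb [i [Hi Ei]] [j [Hj Ej]].
rewrite /omafe /nsegments /= big_ord_recl big_ord0 /=.
rewrite /omafe_seg /increasing_seg /decreasing_seg Heq ltxx.
have Hin k : (k < n)%N -> D`_0 <= D`_k <= D`_n.-1.
  move=> Hk; have H2 := (dom_size domD); rewrite !(dom_le domD); lia.
have -> : seg_max D F D`_0 D`_n.-1 = mx.
  apply/le_anti/andP; split.
    apply/bigmax_seq_leP; split; first by have /andP [] := Hb 0%N (dom_gt0 domD).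
    by move=> _ /dom_nthP [k [Hk ->]] _; have /andP [] := Hb k Hk.
  by rewrite Ei; apply: (bigmax_seq_ge _ F); [exact: mem_dom | exact: Hin].
have -> : seg_min D F D`_0 D`_n.-1 = mn.
  apply/le_anti/andP; split.
    by rewrite Ej; apply: ge_bigmin_seq; [exact: mem_dom | exact: Hin].
  rewrite /seg_min big_seq_cond; elim/big_rec: _.
    by have /andP [] := Hb 0%N (dom_gt0 domD); rewrite Heq.
  move=> _ y /andP [/dom_nthP [k [Hk ->]] _] Hy; rewrite le_min Hy andbT.
  by have /andP [] := Hb k Hk.
have : mn <= mx by have /andP [] := Hb 0%N (dom_gt0 domD); exact: le_trans.
by move=> Hle; apply/max_idPl; rewrite divr_ge0 // subr_ge0.
Qed.

(** Segmentation points are distinct points of D, so a bound of [n.-1] segments is no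
    restriction. *)
Lemma answer_large K s v : (n <= K)%N -> query_answer D F n.-1 s v -> query_answer D F K s v.
Proof.
have H2 := dom_size domD.
move=> HK [y [H1 H3 H4 H5 H6]]; exists y; split=> //; first lia.
have key w : is_segmentation D w -> (nsegments w <= n.-1)%N.
  move=> [Hs _ Hsub _ _].
  suff : (size w <= n)%N by rewrite /nsegments -!subn1 => ?; exact: leq_sub2r.
  apply: uniq_leq_size Hsub.
  by apply: sorted_uniq Hs; [exact: lt_trans|exact: ltxx].
move=> [w [A1 A2 A3]]; have [|B1 B2] := H5; first by exists w; split=> //; exact: key.
by split=> // z C1 C2 _; apply: B2 => //; exact: key.
Qed.

End Single.

(** * Reading an optimal segmentation off the sorted persistences *)

Section Selection.
Variables (R : realType) (D : seq R) (F : R -> R).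
Hypothesis domD : is_domain D.
Hypothesis neqF : no_equal_neighbours D F.
Local Notation n := (size D).
Local Notation f := (fun i : nat => F D`_i).
Variables (cost : nat -> R) (sg : seq nat).
Hypothesis costP : persistence n f cost.
Hypothesis cost_ge0 : forall p, (p < n)%N -> 0 <= cost p.
Hypothesis sg_perm : perm_eq sg (iota 0 n).
Hypothesis sg_sorted : sorted (cost_order cost) sg.
Local Notation g := (flip f).
Local Notation "'s_ i" := (nth 0%N sg i) (at level 8, i at level 2, format "''s_' i").

(** The default 0 past the end acts as one more persistence: for [K = n.-1] the value [cs K.+1 / 2]
    is the error 0. *)
Definition cs j : R := nth 0 (map cost sg) j.

Lemma dom2 : (2 <= n)%N. Proof. exact: dom_size. Qed.

Lemma size_sg : size sg = n.
Proof. by rewrite (perm_size sg_perm) size_iota. Qed.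

Lemma sg_uniq : uniq sg.
Proof. by rewrite (perm_uniq sg_perm) iota_uniq. Qed.

Lemma sg_lt i : (i < n)%N -> ('s_i < n)%N.
Proof.
move=> Hi; have : 's_i \in sg by apply: mem_nth; rewrite size_sg.
by rewrite (perm_mem sg_perm) mem_iota.
Qed.

Lemma sg_inj i j : (i < n)%N -> (j < n)%N -> 's_i = 's_j -> i = j.
Proof. by move=> Hi Hj /eqP; rewrite nth_uniq ?size_sg ?sg_uniq // => /eqP. Qed.

Lemma sg_surj p : (p < n)%N -> exists i, (i < n)%N /\ p = 's_i.
Proof.
move=> Hp; have : p \in sg by rewrite (perm_mem sg_perm) mem_iota.
by move=> /mem_nthP [i]; rewrite size_sg; exists i.
Qed.

Lemma csE i : (i < n)%N -> cs i = cost 's_i.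
Proof. by move=> Hi; rewrite /cs (nth_map 0%N) ?size_sg. Qed.

Lemma cs_out i : (n <= i)%N -> cs i = 0.
Proof. by move=> Hi; rewrite /cs nth_default // size_map size_sg. Qed.

Lemma cs_ge0 i : 0 <= cs i.
Proof. by case: (ltnP i n) => Hi; [rewrite csE // cost_ge0 // sg_lt|rewrite cs_out]. Qed.

Lemma cost_order_trans : transitive (cost_order cost).
Proof.
move=> y x z /orP [H1|/andP [/eqP H1 H2]] /orP [H3|/andP [/eqP H3 H4]]; apply/orP.
- by left; apply: lt_trans H1.
- by left; rewrite -H3.
- by left; rewrite H1.
- by right; rewrite H1 H3 eqxx (leq_trans H2).
Qed.

Lemma sg_order i j : (i < j < n)%N -> cost_order cost 's_i 's_j.
Proof.
move=> Hij; have [Hi Hj Hlt] : [/\ (i < n)%N, (j < n)%N & (i < j)%N] by split; lia.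
by apply: (sorted_ltn_nth cost_order_trans 0%N sg_sorted) => //; rewrite inE size_sg.
Qed.

Lemma cs_mono i j : (i <= j)%N -> cs j <= cs i.
Proof.
move=> Hij; case: (ltnP j n) => Hj; last by rewrite (cs_out Hj) cs_ge0.
have [->//|Hne] := eqVneq i j.
have /orP [H|/andP [/eqP H _]] := sg_order (i := i) (j := j) ltac:(lia).
  by rewrite !csE ?(ltW H) //; lia.
by rewrite !csE ?H //; lia.
Qed.

Lemma sg_index i j : (i < j < n)%N -> cs i = cs j -> ('s_i < 's_j)%N.
Proof.
move=> Hij; rewrite !csE; try lia; move=> Hc.
have /orP [|/andP [_ Hle]] := sg_order Hij; first by rewrite Hc ltxx.
rewrite ltn_neqAle Hle andbT; apply/eqP => /sg_inj; lia.
Qed.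

Lemma size_chain_sg j big : (forall i, (i < n)%N -> big (cs i) = (i < j)%N) ->
  perm_eq (take j sg) (chain n cost big).
Proof.
move=> Hb; apply: uniq_perm.
- exact/take_uniq/sg_uniq.
- by rewrite filter_uniq // iota_uniq.
move=> p; rewrite mem_chain; apply/idP/andP => [Hp|[Hp Hbp]].
  have [i [Hi Ei]] := mem_nthP Hp; rewrite size_take size_sg in Hi.
  have {}Hi : (i < j)%N /\ (i < n)%N by move: Hi; case: ifP; lia.
  have Ep : p = 's_i by rewrite Ei nth_take //; lia.
  by rewrite Ep sg_lt -?csE ?Hb; lia.
have [i [Hi Ei]] := sg_surj Hp.
have Hij : (i < j)%N by rewrite -Hb // csE // -Ei.
apply/(nthP 0%N); exists i; last by rewrite nth_take.
by rewrite size_take size_sg; case: ifP => //.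
Qed.

Lemma boundary_chain j : (j <= n)%N -> cs j < cs j.-1 ->
  perm_eq (take j sg) (chain n cost (fun x => cs j < x)).
Proof.
move=> Hj Hb; apply: size_chain_sg => i Hi.
case: (ltnP i j) => Hij; last by rewrite ltNge cs_mono.
by apply: lt_le_trans Hb _; apply: cs_mono; lia.
Qed.

(** A larger swing would produce an extremum whose persistence exceeds the largest one. *)
Lemma swing_le s a b : (a < b < n)%N -> g s a - g s b <= cs 0.
Proof.
move=> Hab; rewrite leNgt; apply/negP => Hb.
have th := threshold_gt (cs_ge0 0).
have := swing_chain costP th Hab Hb.
case E : (chain _ _ _) => [//|p l] _.
have : p \in chain n cost (fun x => cs 0 < x) by rewrite E mem_head.
rewrite mem_chain => /andP [Hp]; have [i [Hi ->]] := sg_surj Hp.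
by rewrite -csE // ltNge cs_mono.
Qed.

Lemma cs0_gt0 : 0 < cs 0.
Proof.
rewrite ltNge; apply/negP => H; apply: (neqF (i := 0)) dom2 _.
have A := @swing_le true 0 1 dom2; have B := @swing_le false 0 1 dom2.
by move: A B; rewrite /flip => A B; apply/le_anti/andP; split; lra.
Qed.

(** A chain never consists of a single point, so the largest persistence occurs at least twice. *)
Lemma cs01 : cs 1 = cs 0.
Proof.
apply/le_anti; rewrite cs_mono // leNgt; apply/negP => H.
have := perm_size (boundary_chain (j := 1) (ltnW dom2) H).
rewrite size_takel ?size_sg ?(ltnW dom2) // => E.
have := chain_size costP (threshold_gt (cs_ge0 1)); rewrite -E; lia.
Qed.

Lemma sg01 : ('s_0 < 's_1)%N.
Proof. by apply: sg_index; rewrite ?dom2 // cs01. Qed.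

(* With [K] segments, any threshold below [cs K.+1] leaves a chain of more than
   [K.+1] extrema. *)
Lemma omafe_lower K w : is_segmentation D w -> alternating F w -> (nsegments w <= K)%N ->
  cs K.+1 / 2 <= omafe D F w.
Proof.
move=> /(seg_index domD) [z [Hz ->]] Halt Hns.
have [_ H2 H0 Hl] := Hz.
have [s Hs] := alternating_zig H2 Halt.
rewrite leNgt; apply/negP => Hlt.
have He := omafe_ge0 D F (pts D z).
have /(omafe_le domD He Hz Hs) Ht := lexx (omafe D F (pts D z)).
set big := (fun x => _ < x) in Ht.
have th : threshold big by apply: threshold_gt; lra.
have Hsz := chain_lower costP th (let: And4 a _ _ _ := Hz in a) H2 H0 Hl Ht.
have HKn : (K.+1 < n)%N by rewrite ltnNge; apply/negP => /cs_out E; move: Hlt; rewrite E; lra.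
have : (size (take K.+2 sg) <= size (chain n cost big))%N.
  apply: uniq_leq_size; first exact/take_uniq/sg_uniq.
  move=> p Hp; have [i [Hi ->]] := mem_nthP Hp.
  rewrite size_takel ?size_sg // in Hi.
  rewrite nth_take // mem_chain sg_lt -?csE; try lia.
  by rewrite /big /=; have := cs_mono (i := i) (j := K.+1) ltac:(lia); lra.
rewrite size_takel ?size_sg //.
by move: Hns; rewrite /nsegments size_map; lia.
Qed.

Lemma half_cs K : 2 * (cs K / 2) = cs K.
Proof. by lra. Qed.

Lemma answer K e s d : sorted ltn e -> all (fun i => i < n)%N e ->
  (2 <= size e <= K.+1)%N -> perm_eq s e -> zig f d (ends n e) ->
  tame f (fun x => cs K.+1 < x) d (ends n e) ->
  query_answer D F K (pts D s) (cs K.+1 / 2).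
Proof.
move=> H1 H2 H3 H4 H5 H6.
apply: (query_answerI domD H1 H2 H3 _ _ _ H5).
- exact: perm_map.
- by rewrite divr_ge0 ?cs_ge0.
- exact: omafe_lower.
- by rewrite half_cs.
Qed.

Lemma answer_many K b : (K < n)%N -> (3 <= b <= K.+1)%N -> cs b < cs b.-1 ->
  cs K.+1 = cs b -> query_answer D F K (pts D (take b sg)) (cs K.+1 / 2).
Proof.
move=> HK Hb Hlt Ecs.
have Hp := boundary_chain (j := b) ltac:(lia) Hlt.
have th := threshold_gt (cs_ge0 b).
have Hsz : size (chain n cost (fun x => cs b < x)) = b.
  by rewrite -(perm_size Hp) size_takel // size_sg; lia.
have [s Hs] := chain_alternates costP th.
apply: (@answer K _ _ s _ _ _ Hp).
- exact: chain_sorted.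
- by apply/allP => p; rewrite mem_chain => /andP [].
- by rewrite Hsz; lia.
- by apply: (chain_zig costP th Hs); rewrite ?Hsz //; lia.
- by rewrite Ecs; apply: (chain_tame costP th Hs); rewrite ?Hsz //; lia.
Qed.

Lemma sg_take2 : take 2 sg = [:: 's_0; 's_1].
Proof. by have := size_sg; have := dom2; case: (sg) => [|a [|b l]] /= H1 H2; rewrite ?take0 //; lia. Qed.

Lemma take_sgS j : (j < n)%N -> take j.+1 sg = rcons (take j sg) 's_j.
Proof. by move=> Hj; rewrite (take_nth 0%N) // size_sg. Qed.

(** No swing exceeds [cs 0], so one segment already attains the bound. The two listed points are
    only placeholders for x_1 and x_n. *)
Lemma answer_flat K : (1 < K < n)%N -> cs K.+1 = cs 0 -> F D`_0 != F D`_n.-1 ->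
  query_answer D F K (pts D (take 2 sg)) (cs K.+1 / 2).
Proof.
move=> HK E Hne; rewrite sg_take2; have H2 := dom2.
have Hsw s i j : (0 <= i < j)%N -> (j <= n.-1)%N -> ~~ (cs 0 < g s j - g s i).
  move=> Hij Hj; rewrite -leNgt.
  by have := @swing_le (~~ s) i j ltac:(lia); rewrite !flipN; lra.
have Hlt := sg01; have Hn := sg_lt H2.
apply: (@answer K [:: 's_0; 's_1] _ (F D`_n.-1 < F D`_0)) => //=.
- by rewrite Hlt.
- by rewrite Hn !(ltn_trans Hlt).
- by lia.
- apply: zig_single; rewrite /flip; case: (ltP (F D`_n.-1)) => // Hle; by rewrite ltrN2 lt_neqAle Hne.
- by rewrite E; apply: tame_single => i j; exact: Hsw.
Qed.

(** A single segment would have no direction. The middle one of the three leftmost points of maximal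
    persistence splits it; tameness is clear since no swing exceeds [cs 0], and what remains is that
    F differs there from its value at the ends. *)
Lemma answer_flat_loop K : (1 < K < n)%N -> cs K.+1 = cs 0 -> F D`_0 = F D`_n.-1 ->
  query_answer D F K (pts D (take 3 sg)) (cs K.+1 / 2).
Proof.
move=> HK E Heq; have H2 := dom2.
have E2 : cs 2 = cs 0.
  by apply/le_anti; rewrite cs_mono // -E cs_mono //; lia.
have Hlt01 := sg01.
have Hlt12 : ('s_1 < 's_2)%N by apply: sg_index; [lia|rewrite cs01 E2].
have Hn : ('s_2 < n)%N by apply: sg_lt; lia.
pose big := fun x : R => cs 0 <= x.
have th : threshold big := threshold_ge cs0_gt0.
have Hext i : (i < 3)%N -> Ext n f big 's_i.
  move=> Hi; apply/costP => //; [apply: sg_lt; lia|rewrite -csE; last lia].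
  by rewrite /big /= -E2; apply: cs_mono; lia.
have Hno c : (c < 's_1)%N -> c != 's_0 -> ~ Ext n f big c.
  move=> Hc Hc0 Hx; have Hcn : (c < n)%N by lia.
  have /costP := Hx => /(_ Hcn th); rewrite /big /=.
  have [i [Hi Ei]] := sg_surj Hcn; rewrite Ei -csE // => Hle.
  have Ecs : cs i = cs 0 by apply/le_anti; rewrite Hle cs_mono.
  case: i Hi Ei Hle Ecs => [|[|i]] Hi Ei _ Ecs; first by rewrite Ei eqxx in Hc0.
    by rewrite Ei ltnn in Hc.
  by have := @sg_index 1 i.+2 ltac:(lia); rewrite Ecs cs01 => /(_ erefl); lia.
have [s Es] := Hext 0%N isT.
have E1 : ext n f big (~~ s) 's_1.
  case: (extP s (Hext 1%N isT)) => // Es1.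
  have [q [Hq Eq]] := ext_sep th Es Es1 Hlt01 ltac:(lia).
  by case: (Hno q); [lia|lia|exists (~~ s)].
have Hgap : big (g s 's_0 - g s 's_1).
  apply: (ext_gap th Es E1) => [|c Hc]; [lia|apply: Hno; lia].
(* Otherwise the swing from the first point to ['s_0] would be as large as the gap and produce an
   extremum to the left of ['s_0], which is the leftmost one at this threshold. *)
have Hne : g s 's_1 != g s 0%N.
  apply/eqP => Eg; rewrite Eg in Hgap.
  case: (posnP 's_0) => H0; first by move: (big_gt0 th Hgap); rewrite H0 subrr ltxx.
  have [||p [Hp Ep]] := @ext_first _ n f big th (~~ s) 0 's_0; first lia.
    by rewrite !flipN opprK addrC.
  by case: (Hno p); [lia|lia|exists (~~ s)].
have HneF : F D`_('s_1) != F D`_0.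
  by apply: contraNneq Hne => Ef; rewrite /flip Ef.
have Hsw d i j : (i < j)%N -> (j <= n.-1)%N -> ~~ (cs 0 < g d j - g d i).
  move=> Hij Hj; rewrite -leNgt.
  by have := @swing_le (~~ d) i j ltac:(lia); rewrite !flipN; lra.
rewrite (take_sgS (j := 2)) ?sg_take2; last lia.
apply: (@answer K [:: 's_0; 's_1; 's_2] _ (F D`_('s_1) < F D`_0)) => //=.
- by rewrite Hlt01 Hlt12.
- by rewrite Hn (ltn_trans Hlt12 Hn) (ltn_trans Hlt01 (ltn_trans Hlt12 Hn)).
- by lia.
- rewrite (ends_cons_rcons n 's_0 [:: 's_1] 's_2) /=.
  apply: zig_cons; last apply: zig_single; rewrite /flip -?Heq; case: (ltP (F D`_('s_1))) => //= Hle;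
    by rewrite ?ltrN2 // lt_neqAle eq_sym HneF.
- rewrite E (ends_cons_rcons n 's_0 [:: 's_1] 's_2) /=.
  apply: tame_cons; last apply: tame_single; move=> i j Hi Hj; apply: Hsw; lia.
Qed.

(* Exactly two extrema of persistence above [cs 2]: [f] has no swing above this
   threshold in one of the two directions. *)
Section Pair.
Hypothesis n_gt2 : (2 < n)%N.
Hypothesis cs21 : cs 2 < cs 1.
Local Notation big := (fun x : R => cs 2 < x).

Let th : threshold big := threshold_gt (cs_ge0 2).

Lemma pair_chain c : (c < n)%N -> Ext n f big c -> c = 's_0 \/ c = 's_1.
Proof.
move=> Hc Hx; have : c \in chain n cost big by apply/(chainP costP th).
rewrite -(perm_mem (boundary_chain (j := 2) (ltnW n_gt2) cs21)) sg_take2 !inE.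
by move=> /orP [] /eqP; auto.
Qed.

Lemma pair_ext : exists s, ext n f big s 's_0 /\ ext n f big (~~ s) 's_1.
Proof.
have Hx i : (i < 2)%N -> Ext n f big 's_i.
  move=> Hi; apply/(costP _ th); first by apply: sg_lt; lia.
  rewrite -csE; last lia.
  by apply: lt_le_trans cs21 _; apply: cs_mono; lia.
have Hlt := sg01; have Hn := sg_lt dom2.
have [s Es] := Hx 0%N isT; exists s; split=> //.
case: (extP s (Hx 1%N isT)) => // Es1.
have [q [Hq Eq]] := ext_sep th Es Es1 Hlt Hn.
by case: (@pair_chain q); [lia|exists (~~ s)|lia|lia].
Qed.

Section Direction.
Variable s : bool.
Hypothesis ext0 : ext n f big s 's_0.
Hypothesis ext1 : ext n f big (~~ s) 's_1.

Lemma pair_ext_eq d c : (c < n)%N -> ext n f big d c -> c = if d == s then 's_0 else 's_1.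
Proof.
move=> Hc Hd; have [E|E] := pair_chain Hc (ex_intro _ d Hd); subst c; case: eqP => // Hds.
  case: (ext_nodouble th Hc ext0); rewrite (_ : ~~ s = d) //.
  by move: Hds; case: (d); case: (s).
by case: (ext_nodouble th Hc Hd); rewrite Hds.
Qed.

(** Such a swing would come with an extremum of the kind of ['s_1] followed by one of the kind of
    ['s_0], but ['s_0] is on the left. *)
Lemma pair_swing a b : (a < b < n)%N -> g s b - g s a <= cs 2.
Proof.
move=> Hab; rewrite leNgt; apply/negP => Hb.
have Hb' : cs 2 < g (~~ s) a - g (~~ s) b by rewrite !flipN; lra.
have [p [Hp Ep _ [q [Hq Eq]]]] := swing_meets th Hab Hb'.
have Hlt := sg01.
have Hp1 := pair_ext_eq (c := p) ltac:(lia) Ep; have Hq0 := pair_ext_eq (c := q) ltac:(lia) Eq.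
have Nss : (~~ s == s) = false by case: (s).
by move: Hp1 Hq0; rewrite negbK eqxx Nss; lia.
Qed.

Lemma pair_swing_le a b : (a <= b < n)%N -> g s b - g s a <= cs 2.
Proof.
move=> Hab; have [->|Hne] := eqVneq a b; first by rewrite subrr cs_ge0.
by apply: pair_swing; lia.
Qed.

Lemma pair_gap : cs 2 < g s 's_0 - g s 's_1.
Proof.
have Hlt := sg01; have Hn := sg_lt dom2.
apply: (ext_gap th ext0 ext1) => [|c Hc Hx]; first lia.
by case: (@pair_chain c); [lia|exact: Hx|lia|lia].
Qed.

(** The direction [s] is known only to exist; the sign of this product is something that the program
    can test. *)
Lemma pair_agree : (0 < (F D`_n.-1 - F D`_0) * (F D`_('s_1) - F D`_('s_0))) =
  (g s n.-1 < g s 0).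
Proof.
have := pair_gap; have := cs_ge0 2; rewrite /flip; case: (s) => H1 H2.
  rewrite nmulr_lgt0; last lra.
  by rewrite subr_lt0.
rewrite pmulr_lgt0; last lra.
by rewrite subr_gt0 ltrN2.
Qed.

Lemma pair_answer_agree K : (1 < K)%N -> cs K.+1 = cs 2 -> g s n.-1 < g s 0 ->
  query_answer D F K (pts D (take 2 sg)) (cs K.+1 / 2).
Proof.
move=> HK E Hs; rewrite sg_take2; have Hlt := sg01; have Hn := sg_lt dom2.
apply: (@answer K [:: 's_0; 's_1] _ s) => //=.
- by rewrite Hlt.
- by rewrite Hn !(ltn_trans Hlt).
- by lia.
- exact: zig_single.
- rewrite E; apply: tame_single => i j Hi Hj; rewrite -leNgt.
  by apply: pair_swing; lia.
Qed.

(** * Two extrema whose swing runs against the trend from x_1 to x_n *)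

Section Disagree.
Hypothesis disagree : g s 0 <= g s n.-1.

(** The rise from x_1 to ['s_0] is at most [cs 2], which is less than the gap from ['s_0] down to
    ['s_1]. *)
Lemma pair_low : g s 's_1 < g s 0 /\ g s 's_1 < g s n.-1.
Proof.
have Hn := sg_lt (ltnW dom2); have := @pair_swing_le 0 's_0 Hn; have := pair_gap.
by move: disagree; lra.
Qed.

Lemma pair_high : g s 0 < g s 's_0 /\ g s n.-1 < g s 's_0.
Proof.
have Hn := sg_lt dom2; have := @pair_swing_le 's_1 n.-1 ltac:(lia); have := pair_gap.
by move: disagree; lra.
Qed.

Lemma pair_zig1 : zig f s [:: 0%N; 's_1; n.-1].
Proof.
have [H1 H2] := pair_low.
by apply: zig_cons => //; apply: zig_single; rewrite !flipN ltrN2.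
Qed.

(** A big drop after ['s_1] would create, by [ext_between], another extremum of the kind of ['s_0],
    but the only one lies before ['s_1]. *)
Lemma pair_tame1 : tame f big s [:: 0%N; 's_1; n.-1].
Proof.
have Hn := sg_lt dom2.
apply: tame_cons; last apply: tame_single; move=> i j Hi Hj.
  by rewrite -leNgt; apply: pair_swing; lia.
apply/negP => Hb.
have [q [Hq Eq]] := ext_between th ext1 (a := i) (b := j) ltac:(lia) ltac:(lia) Hb.
have Hlt := sg01; rewrite negbK in Eq.
by have := pair_ext_eq (c := q) ltac:(lia) Eq; rewrite eqxx; lia.
Qed.

Lemma pair_zig0 : zig f (~~ s) [:: 0%N; 's_0; n.-1].
Proof.
have [H1 H2] := pair_high.
by apply: zig_cons; [rewrite !flipN ltrN2 | apply: zig_single; rewrite negbK].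
Qed.

Lemma pair_tame0 : tame f big (~~ s) [:: 0%N; 's_0; n.-1].
Proof.
have Hn := sg_lt (ltnW dom2).
apply: tame_cons; last apply: tame_single; move=> i j Hi Hj; last first.
  by rewrite negbK -leNgt; apply: pair_swing; lia.
apply/negP => Hb.
have Hb' : cs 2 < g s i - g s j by move: Hb; rewrite !flipN; lra.
have [p [Hp Ep]] := ext_first (n := n) th (s := s) (a := i) (b := j) ltac:(lia) Hb'.
by have := pair_ext_eq (c := p) ltac:(lia) Ep; rewrite eqxx; lia.
Qed.

Lemma pair_inner1 : (0 < 's_1 < n.-1)%N.
Proof.
have [H1 H2] := pair_low; have Hn := sg_lt dom2.
have H3 : 's_1 != 0%N by apply/eqP => E; move: H1; rewrite E ltxx.
have H4 : 's_1 != n.-1 by apply/eqP => E; move: H2; rewrite E ltxx.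
by lia.
Qed.

(** With K = 2 there is room for one inner point only, and a prefix of the sorted array need not
    have ['s_1] as its inner point. *)
Lemma pair_answer_special K : (1 < K)%N -> cs K.+1 = cs 2 ->
  query_answer D F K (pts D [:: 0%N; 's_1; n.-1]) (cs K.+1 / 2).
Proof.
move=> HK E; have H := pair_inner1.
have Ee : ends n [:: 0%N; 's_1; n.-1] = [:: 0%N; 's_1; n.-1] by [].
apply: (@answer K [:: 0%N; 's_1; n.-1] _ s) => //.
- by rewrite /=; lia.
- by rewrite /=; lia.
- by rewrite Ee; exact: pair_zig1.
- by rewrite Ee E; exact: pair_tame1.
Qed.

(** If [cs 2] were 0, [g s] would never rise; with the strict drop from ['s_0] to ['s_1] its value
    at x_n would then be below that at x_1, against [disagree]. *)
Lemma pair_cs2_gt0 : 0 < cs 2.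
Proof.
rewrite lt_neqAle cs_ge0 andbT; apply/eqP => E.
have Hn0 := sg_lt (ltnW dom2); have Hn1 := sg_lt dom2.
have := @pair_swing_le 0 's_0 Hn0; have := @pair_swing_le 's_1 n.-1 ltac:(lia).
by have := pair_gap; move: disagree; rewrite -E; lra.
Qed.

Hypothesis n_gt4 : (4 < n)%N.

(** Being outside, ['s_2] is an end of the sorted prefix and gets replaced by x_1 or x_n. One of the
    two extrema stays as the inner point, and either of them will do. *)
Lemma pair_answer_outer K : (1 < K)%N -> cs K.+1 = cs 2 ->
  ~~ ('s_0 < 's_2 < 's_1)%N ->
  query_answer D F K (pts D (take 3 sg)) (cs K.+1 / 2).
Proof.
move=> HK E Hout; rewrite (take_sgS (j := 2)) // sg_take2 [rcons _ _]/=.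
have H := pair_inner1; have Hlt := sg01.
have Hn2 := sg_lt n_gt2.
have N0 : 's_2 != 's_0 by apply/eqP => /(@sg_inj 2 0 n_gt2 (ltnW dom2)).
have N1 : 's_2 != 's_1 by apply/eqP => /(@sg_inj 2 1 n_gt2 dom2).
case: (ltnP 's_2 's_0) => Hlt2.
  have Hp : perm_eq [:: 's_0; 's_1; 's_2] [:: 's_2; 's_0; 's_1].
    by rewrite (perm_catC [:: 's_0; 's_1] [:: 's_2]).
  apply: (@answer K _ _ (~~ s) _ _ _ Hp) => /=; rewrite ?(ends_cons_rcons n 's_2 [:: 's_0] 's_1); try lia.
  - exact: pair_zig0.
  - by rewrite E; exact: pair_tame0.
apply: (@answer K [:: 's_0; 's_1; 's_2] _ s) => /=; rewrite ?(ends_cons_rcons n 's_0 [:: 's_1] 's_2) //; try lia.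
- exact: pair_zig1.
- by rewrite E; exact: pair_tame1.
Qed.

Local Notation big' := (fun x : R => cs 2 <= x).
Let th' : threshold big' := threshold_ge pair_cs2_gt0.

(** Three entries would leave ['s_2] as the inner point, but the drop from ['s_3] to ['s_1] exceeds
    [cs 2]. At the weak threshold [cs 2 <= x] the tied points ['s_2] and ['s_3] are a minimum and a
    maximum of [g s] between ['s_0] and ['s_1]. With four entries, ['s_0] and ['s_1] become
    placeholders of the ends and three segments result. *)
Lemma pair_answer_inner K : (2 < K)%N -> cs K.+1 = cs 2 -> cs 3 = cs 2 ->
  ('s_0 < 's_2 < 's_1)%N ->
  query_answer D F K (pts D (take 4 sg)) (cs K.+1 / 2).
Proof.
move=> HK E E3 /andP [Hlt02 Hlt21].
have Hn3 : (3 < n)%N by exact: ltnW n_gt4.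
rewrite (take_sgS Hn3) (take_sgS n_gt2) sg_take2 [rcons _ _]/=.
have /andP [Hgt1 Hltn1] := pair_inner1.
have Hn1 : ('s_1 < n)%N := sg_lt dom2.
have Hlt23 : ('s_2 < 's_3)%N by apply: sg_index; rewrite ?E3.
have Ext' i : (i < 4)%N -> Ext n f big' 's_i.
  move=> Hi; have Hin : (i < n)%N := ltn_trans Hi n_gt4.
  apply/(costP _ th'); first exact: sg_lt.
  by rewrite -csE // -[X in X <= _]E3; apply: cs_mono.
have Hno c : (c < n)%N -> Ext n f big' c -> [|| c == 's_0, c == 's_1, c == 's_2 | ('s_3 <= c)%N].
  move=> Hc /(costP Hc th').
  have [i [Hi Ei]] := sg_surj Hc; rewrite Ei -csE // => Hle.
  case: i Hi Ei Hle => [|[|[|i]]] Hi Ei Hle; rewrite ?eqxx ?orbT //.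
  apply/or4P; constructor 4; case: i Hi Ei Hle => [|i] Hi Ei Hle; first by rewrite leqnn.
  apply/ltnW/sg_index; first by rewrite Hi.
  by apply/le_anti; rewrite (cs_mono (i := 3)) // E3 Hle.
have up x : cs 2 < x -> cs 2 <= x by exact: ltW.
have E0 : ext n f big' s 's_0 := ext_mono up ext0.
have E1 : ext n f big' (~~ s) 's_1 := ext_mono up ext1.
have Nlow c : (c < 's_2)%N -> c != 's_0 -> ~ Ext n f big' c.
  move=> Hc Hc0 /(Hno c (ltn_trans Hc (ltn_trans Hlt21 Hn1))).
  by move: Hc Hc0 Hlt21 Hlt23; clear; lia.
have E2 : ext n f big' (~~ s) 's_2.
  case: (extP s (Ext' 2%N isT)) => // Es2.
  have [q [/andP [Hq0 Hq2] Eq]] := ext_sep th' E0 Es2 Hlt02 (ltn_trans Hlt21 Hn1).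
  by case: (Nlow q Hq2); [rewrite gtn_eqF|exists (~~ s)].
have Hlt31 : ('s_3 < 's_1)%N.
  have [q [/andP [Hq1 Hq2] Eq]] := ext_sep th' E2 E1 Hlt21 Hn1.
  have := Hno q (ltn_trans Hq2 Hn1) (ex_intro _ (~~ ~~ s) Eq).
  by move: Hq1 Hq2 Hlt02; clear; lia.
have N23 c : (c < 's_3)%N -> ('s_2 < c)%N -> ~ Ext n f big' c.
  move=> Hc Hc2 /(Hno c (ltn_trans Hc (ltn_trans Hlt31 Hn1))).
  by move: Hc Hc2 Hlt02 Hlt31; clear; lia.
have Es3 : ext n f big' s 's_3.
  case: (extP s (Ext' 3%N isT)) => // Es3.
  have [q [/andP [Hq0 Hq2] Eq]] := ext_sep th' E2 Es3 Hlt23 (ltn_trans Hlt31 Hn1).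
  by case: (N23 q Hq2 Hq0); exists (~~ ~~ s).
have G02 : cs 2 <= g s 's_0 - g s 's_2.
  apply: (ext_gap th' E0 E2) => [|c /andP [Hc0 Hc2]].
    by rewrite Hlt02 (ltn_trans Hlt21 Hn1).
  by apply: Nlow => //; rewrite gtn_eqF.
have G23 : cs 2 <= g s 's_3 - g s 's_2.
  have : cs 2 <= g (~~ s) 's_2 - g (~~ s) 's_3.
    apply: (ext_gap th' E2) => [||c /andP [Hc2 Hc3]]; first by rewrite negbK.
      by rewrite Hlt23 (ltn_trans Hlt31 Hn1).
    exact: N23.
  by rewrite !flipN; lra.
have cs2 := pair_cs2_gt0.
(* A rise of [cs 2] or more from x_1 to ['s_0] would create an extremum at the weak threshold before
   ['s_0], but ['s_0] is the only one before ['s_2]. *)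
have Z0 : g s 's_2 < g s 0.
  case: (posnP 's_0) => H0; first by move: G02; rewrite H0; lra.
  suff : ~~ (cs 2 <= g s 's_0 - g s 0) by rewrite -ltNge; lra.
  apply/negP => Hb.
  have Hb' : cs 2 <= g (~~ s) 0%N - g (~~ s) 's_0 by rewrite !flipN opprK addrC.
  have Hs0n : (0 < 's_0 < n)%N by rewrite H0 (ltn_trans sg01 Hn1).
  have [p [Hp Ep]] := ext_first (n := n) th' (a := 0%N) (b := 's_0) Hs0n Hb'.
  by case: (Nlow p (ltn_trans Hp Hlt02)); [rewrite ltn_eqF|exists (~~ s)].
(* Otherwise the drop that leads to ['s_1] would start at or after ['s_2], and by [pair_swing_le] it
   cannot start high enough. *)
have Z12 : g s 's_1 < g s 's_2.
  have [Hle|//] := leP (g s 's_2) (g s 's_1).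
  case: ext1 => [[[q [Hq Hb Hk]]|Hk] _ _]; last by have := Hk 's_2 Hlt21; rewrite !flipN; lra.
  case: (ltnP q 's_2) => Hq2.
    by have := Hk 's_2; rewrite Hq2 Hlt21 => /(_ isT); rewrite !flipN; lra.
  have := @pair_swing_le 's_2 q; rewrite Hq2 (ltn_trans Hq Hn1) => /(_ isT).
  by move: Hb; rewrite !flipN; lra.
have Z2 : g s n.-1 < g s 's_3.
  have := @pair_swing_le 's_1 n.-1; rewrite (ltnW Hltn1) dom_pred // => /(_ isT).
  by lra.
have Hp : perm_eq [:: 's_0; 's_1; 's_2; 's_3] [:: 's_0; 's_2; 's_3; 's_1].
  by rewrite perm_cons (perm_catC [:: 's_1] [:: 's_2; 's_3]).
have Ee : ends n [:: 's_0; 's_2; 's_3; 's_1] = [:: 0%N; 's_2; 's_3; n.-1].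
  by rewrite (ends_cons_rcons n 's_0 [:: 's_2; 's_3] 's_1).
have Hs3n := ltn_trans Hlt31 Hn1; have Hs2n := ltn_trans Hlt23 Hs3n.
apply: (@answer K _ _ s _ _ _ Hp).
- by rewrite /= Hlt02 Hlt23 Hlt31.
- by rewrite /= (ltn_trans Hlt02 Hs2n) Hs2n Hs3n Hn1.
- by [].
- rewrite Ee; apply: zig_cons => //; apply: zig_cons; first by rewrite !flipN ltrN2; lra.
  by rewrite negbK; apply: zig_single.
have Hswing i j k : (k <= n.-1)%N -> (i < j)%N -> (j <= k)%N -> ~~ (cs 2 < g s j - g s i).
  move=> Hk Hij Hj; rewrite -leNgt; apply: pair_swing.
  by rewrite Hij (leq_ltn_trans (leq_trans Hj Hk)) // dom_pred.
have Hs2n1 : ('s_2 <= n.-1)%N by exact: ltnW (ltn_trans Hlt21 Hltn1).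
rewrite Ee E; apply: tame_cons => [i j /andP [_ Hij]|]; first exact: Hswing.
apply: tame_cons => [i j Hi Hj|]; last first.
  by rewrite negbK; apply: tame_single => i j /andP [_ Hij]; exact: Hswing.
apply/negP => /up Hb.
have [q [/andP [Hq2 Hqj] Eq]] := ext_between th' E2 Hi (leq_ltn_trans Hj Hs3n) Hb.
by case: (N23 q (leq_trans Hqj Hj) Hq2); exists (~~ ~~ s).
Qed.

End Disagree.
End Direction.
End Pair.

(** There is just one segmentation with a single segment, so optimality is immediate whatever its
    direction. *)
Lemma answer_one : query_answer D F 1 (pts D (take 2 sg)) (omafe D F (pts D [:: 0%N; n.-1])).
Proof.
have Hlt := sg01; have Hn := sg_lt dom2.
have Ee : ends n (take 2 sg) = [:: 0%N; n.-1] by rewrite sg_take2.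
exists (pts D [:: 0%N; n.-1]); split=> //.
- rewrite -Ee; apply: ends_represents => //.
  + by rewrite sg_take2 /= Hlt.
  + by rewrite sg_take2 /= Hn (ltn_trans Hlt Hn).
  + by rewrite sg_take2.
- exact: pts_seg (index_seg2 domD).
have key w : is_segmentation D w -> (nsegments w <= 1)%N -> w = pts D [:: 0%N; n.-1].
  move=> /(seg_index domD) [z [[_ H2 H0 H1] ->]]; rewrite /nsegments size_map => Hsz.
  have Es : size z = 2 by lia.
  by congr pts; move: H0 H1; case: z Es {H2 Hsz} => [|a [|b [|]]] //= _ -> ->.
move=> [w [H1 H2 H3]]; split; first by rewrite -(key w).
by move=> z H4 _ H6; rewrite (key z).
Qed.

(** The last strict drop of [cs] up to index [K.+1], where 0 means that there is none; from there to
    [K.+1] the persistence is constant. *)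
Definition last_boundary K b : Prop :=
  [/\ (b <= K.+1)%N, (0 < b)%N -> cs b < cs b.-1
    & forall i, (b < i <= K.+1)%N -> ~~ (cs i < cs i.-1)].

Lemma last_boundary_cs K b : last_boundary K b ->
  forall i, (b <= i <= K.+1)%N -> cs i = cs b.
Proof.
move=> [_ _ H] i /andP [Hb]; rewrite -(subnKC Hb); elim: (i - b)%N => [|d IH] Hi.
  by rewrite addn0.
rewrite -IH; last lia.
apply/le_anti; rewrite cs_mono ?leq_add2l //= leNgt addnS.
by apply: (H (b + d).+1); lia.
Qed.

Definition agree : bool := 0 < (F D`_n.-1 - F D`_0) * (F D`_('s_1) - F D`_('s_0)).

Definition use_special K b : bool := [&& (0 < b <= 2)%N, ~~ agree & (K <= 2)%N].

(** By [cs01] the case [b = 1] does not occur, so [b <= 2] means exactly two extrema. The 3 for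
    [K <= 2] is the length of the separate array. *)
Definition position K b : nat :=
  if b == 0%N then (if F D`_0 == F D`_n.-1 then 3 else 2)
  else if (b <= 2)%N then
    (if agree then 2 else if (K <= 2)%N then 3 else if ('s_0 < 's_2 < 's_1)%N then 4 else 3)
  else b.

Lemma select K b : (1 < K < n)%N -> last_boundary K b ->
  query_answer D F K
    (if use_special K b then pts D [:: 0%N; 's_1; n.-1] else pts D (take (position K b) sg))
    (cs K.+1 / 2).
Proof.
move=> HK Hb; have Ecs := last_boundary_cs Hb; case: Hb => Hle Hlt _.
have E := Ecs K.+1 ltac:(lia).
rewrite /use_special /position; case: b Hle Hlt Ecs E => [|[|[|b]]] Hle Hlt Ecs E /=.
- by case: eqP => [/answer_flat_loop|/eqP /answer_flat]; apply.
- by have := Hlt isT; rewrite cs01 ltxx.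
- have n2 : (2 < n)%N by lia.
  have HK1 : (1 < K)%N by lia.
  have c21 := Hlt isT.
  have [s [E0 E1]] := pair_ext n2 c21.
  rewrite /agree (pair_agree n2 c21 E0 E1); case: ltP => Hd /=.
    by apply: (pair_answer_agree n2 c21 E0 E1 HK1 E Hd).
  case: (leqP K 2) => HK2 /=.
    by apply: (pair_answer_special n2 c21 E0 E1 Hd HK1 E).
  have Hpos := pair_cs2_gt0 n2 c21 E0 E1 Hd.
  (* [cs 4 = cs 2] is positive, while [cs] vanishes from index [n] on. *)
  have n4 : (4 < n)%N.
    have E4' : cs 4 = cs 2 by apply: Ecs; move: HK2; clear; lia.
    by rewrite ltnNge; apply/negP => /cs_out E4; move: Hpos; rewrite -E4' E4 ltxx.
  case: ifP => Hin.
    by apply: (pair_answer_inner n2 c21 E0 E1 Hd n4 HK2 E _ Hin); apply: Ecs; lia.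
  by apply: (pair_answer_outer n2 c21 E0 E1 Hd n4 HK1 E); rewrite Hin.
- have /andP [_ HKn] := HK.
  exact: (answer_many HKn (b := b.+3) Hle (Hlt isT) E).
Qed.

(** The two ends and the two extrema are four distinct points. Hence K capped at [n.-1] is 2 only if
    K itself is 2, the one value for which the array may change. *)
Lemma special_size K b : (1 < K < n)%N -> last_boundary K b -> use_special K b -> (3 < n)%N.
Proof.
move=> HK [_ Hlt _] /and3P [Hb Ha _].
case: b Hb Hlt => [//|[|[|//]]] _ Hlt; first by have := Hlt isT; rewrite cs01 ltxx.
have n2 : (2 < n)%N by lia.
have c21 := Hlt isT.
have [s [E0 E1]] := pair_ext n2 c21.
move: Ha; rewrite /agree (pair_agree n2 c21 E0 E1) -leNgt => Hd.
have [H0 _] := pair_high n2 c21 E0 E1 Hd.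
have /andP [_ H1] := pair_inner1 n2 c21 E0 E1 Hd.
have Hpos : (0 < 's_0)%N by rewrite lt0n; apply/eqP => E; move: H0; rewrite E ltxx.
by move: Hpos sg01 H1; clear; lia.
Qed.

Lemma position_le K b : (1 < K < n)%N -> (b <= K.+1)%N -> (position K b <= n)%N.
Proof. by rewrite /position; clear; do !case: ifP; lia. Qed.

End Selection.

(** * A structured language for the machine *)

Section Language.
Variable R : realType.

Inductive op : Type :=
| OConst of nat & nat
| OAdd of nat & nat & nat
| OSub of nat & nat & nat
| OLd of nat & nat & nat
| OSt of nat & nat & nat
| QConst of nat & nat
| QAdd of nat & nat & nat
| QSub of nat & nat & nat
| QMul of nat & nat & nat
| QDiv of nat & nat & nat
| QLd of nat & nat & nat
| QSt of nat & nat & nat.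

Inductive test : Type := TI of nat & nat | TR of nat & nat.

Inductive cmd : Type :=
| Blk of seq op
| Seq of cmd & cmd
| If of test & cmd & cmd
| Until of test & cmd.

Record hst : Type := Hst {
  hi : nat -> nat;
  hr : nat -> R;
  ha : nat -> nat -> nat;
  hb : nat -> nat -> R
}.

(** Same function as [aupd], but register and array numbers are literals, so updates of them are set
    to compute under simplification; indices into an array are symbolic. *)
Definition rupd (T : Type) (f : nat -> T) (a : nat) (v : T) : nat -> T :=
  fun k => if k == a then v else f k.
Definition aupd (T : Type) (f : nat -> T) (a : nat) (v : T) : nat -> T :=
  fun k => if k == a then v else f k.
Definition aupd2 (T : Type) (h : nat -> nat -> T) k i v : nat -> nat -> T :=
  fun k' => if k' == k then aupd (h k) i v else h k'.
#[global] Arguments rupd T f a v k /.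
#[global] Arguments aupd2 T h k i v k' /.

Definition opexec (o : op) (s : hst) : hst :=
  match o with
  | OConst d c => Hst (rupd (hi s) d c) (hr s) (ha s) (hb s)
  | OAdd d a b => Hst (rupd (hi s) d (hi s a + hi s b)%N) (hr s) (ha s) (hb s)
  | OSub d a b => Hst (rupd (hi s) d (hi s a - hi s b)%N) (hr s) (ha s) (hb s)
  | OLd d k a => Hst (rupd (hi s) d (ha s k (hi s a))) (hr s) (ha s) (hb s)
  | OSt k a b => Hst (hi s) (hr s) (aupd2 (ha s) k (hi s a) (hi s b)) (hb s)
  | QConst d c => Hst (hi s) (rupd (hr s) d c%:R) (ha s) (hb s)
  | QAdd d a b => Hst (hi s) (rupd (hr s) d (hr s a + hr s b)) (ha s) (hb s)
  | QSub d a b => Hst (hi s) (rupd (hr s) d (hr s a - hr s b)) (ha s) (hb s)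
  | QMul d a b => Hst (hi s) (rupd (hr s) d (hr s a * hr s b)) (ha s) (hb s)
  | QDiv d a b => Hst (hi s) (rupd (hr s) d (hr s a / hr s b)) (ha s) (hb s)
  | QLd d k a => Hst (hi s) (rupd (hr s) d (hb s k (hi s a))) (ha s) (hb s)
  | QSt k a b => Hst (hi s) (hr s) (ha s) (aupd2 (hb s) k (hi s a) (hr s b))
  end.

Definition opok (n : nat) (o : op) (s : hst) : bool :=
  match o with
  | OLd _ _ a | OSt _ a _ | QLd _ _ a | QSt _ a _ => (hi s a < n)%N
  | _ => true
  end.

(** The address of a cell of array [k] takes [k + 2] instructions, as [n] is added [k] times for
    want of an integer multiplication; the access is one more. *)
Definition opcost (o : op) : nat :=
  match o with
  | OLd _ k _ | OSt k _ _ | QLd _ k _ | QSt k _ _ => k.+3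
  | _ => 1
  end.

Fixpoint blk_ok n (l : seq op) s : bool :=
  if l is o :: l' then opok n o s && blk_ok n l' (opexec o s) else true.
Fixpoint blk_exec (l : seq op) s : hst :=
  if l is o :: l' then blk_exec l' (opexec o s) else s.
Fixpoint blk_cost (l : seq op) : nat :=
  if l is o :: l' then (opcost o + blk_cost l')%N else 0%N.

Definition tst (t : test) (s : hst) : bool :=
  match t with
  | TI a b => (hi s a <= hi s b)%N
  | TR a b => hr s a <= hr s b
  end.

Inductive eval (n : nat) : cmd -> hst -> hst -> nat -> Prop :=
| EBlk l s : blk_ok n l s -> eval n (Blk l) s (blk_exec l s) (blk_cost l)
| ESeq c1 c2 s1 s2 s3 t1 t2 : eval n c1 s1 s2 t1 -> eval n c2 s2 s3 t2 ->
    eval n (Seq c1 c2) s1 s3 (t1 + t2)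
| EIfT t c1 c2 s s' k : tst t s -> eval n c1 s s' k -> eval n (If t c1 c2) s s' (k + 2)
| EIfF t c1 c2 s s' k : ~~ tst t s -> eval n c2 s s' k -> eval n (If t c1 c2) s s' (k + 2)
| EUntT t c s : tst t s -> eval n (Until t c) s s 2
| EUntF t c s1 s2 s3 k1 k2 : ~~ tst t s1 -> eval n c s1 s2 k1 ->
    eval n (Until t c) s2 s3 k2 -> eval n (Until t c) s1 s3 (k1 + k2 + 2).

Definition wf_dst (a : nat) := (1 < a)%N.
Definition wf_src (a : nat) := (a != 1)%N.
Definition wf_op (o : op) : bool :=
  match o with
  | OConst d _ => wf_dst d
  | OAdd d a b | OSub d a b => [&& wf_dst d, wf_src a & wf_src b]
  | OLd d k a => [&& wf_dst d, (k < 9)%N & wf_src a]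
  | OSt k a b => [&& (k < 9)%N, wf_src a & wf_src b]
  | QLd _ k a | QSt k a _ => (k < 9)%N && wf_src a
  | _ => true
  end.
Definition wf_test t := if t is TI a b then wf_src a && wf_src b else true.
Fixpoint wf (c : cmd) : bool :=
  match c with
  | Blk l => all wf_op l
  | Seq c1 c2 => wf c1 && wf c2
  | If t c1 c2 => [&& wf_test t, wf c1 & wf c2]
  | Until t c => wf_test t && wf c
  end.

(* Array [k] of length [n] occupies the cells [k * n, ..., k * n + n - 1];
   register 0 holds [n] and register 1 is scratch space for addresses. *)
Definition addr_code (k a : nat) : seq instr :=
  IConst 1 0 :: nseq k (IAdd 1 1 0) ++ [:: IAdd 1 1 a].

Definition compile_op (o : op) : seq instr :=
  match o with
  | OConst d c => [:: IConst d c]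
  | OAdd d a b => [:: IAdd d a b]
  | OSub d a b => [:: ISub d a b]
  | OLd d k a => rcons (addr_code k a) (ILoad d 1)
  | OSt k a b => rcons (addr_code k a) (IStore 1 b)
  | QConst d c => [:: RConst d c]
  | QAdd d a b => [:: RAdd d a b]
  | QSub d a b => [:: RSub d a b]
  | QMul d a b => [:: RMul d a b]
  | QDiv d a b => [:: RDiv d a b]
  | QLd d k a => rcons (addr_code k a) (RLoad d 1)
  | QSt k a b => rcons (addr_code k a) (RStore 1 b)
  end.

Definition jump (t : test) (l : nat) : instr :=
  match t with TI a b => IJumpLe a b l | TR a b => RJumpLe a b l end.

(** A test jumps when it holds, so the branch for failure comes first. [IJumpLe 0 0] is an
    unconditional jump. *)
Fixpoint compile (p : nat) (c : cmd) : seq instr :=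
  match c with
  | Blk l => flatten (map compile_op l)
  | Seq c1 c2 => let a := compile p c1 in a ++ compile (p + size a) c2
  | If t c1 c2 =>
      let a := compile p.+1 c2 in
      let b := compile (p + size a + 2) c1 in
      jump t (p + size a + 2) :: a ++ IJumpLe 0 0 (p + size a + 2 + size b) :: b
  | Until t c =>
      let a := compile p.+1 c in
      jump t (p + size a + 2) :: a ++ [:: IJumpLe 0 0 p]
  end.

Lemma compile_IfE p t c1 c2 : compile p (If t c1 c2) =
  jump t (p + size (compile p.+1 c2) + 2) :: compile p.+1 c2 ++
  IJumpLe 0 0 (p + size (compile p.+1 c2) + 2 + size (compile (p + size (compile p.+1 c2) + 2) c1))
  :: compile (p + size (compile p.+1 c2) + 2) c1.
Proof. by []. Qed.

Lemma compile_UntilE p t c : compile p (Until t c) =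
  jump t (p + size (compile p.+1 c) + 2) :: compile p.+1 c ++ [:: IJumpLe 0 0 p].
Proof. by []. Qed.

(** * Correctness of the compiler, with time and storage *)

Definition code_at (P : program) (p : nat) (l : seq instr) : Prop :=
  exists l1 l2, P = l1 ++ l ++ l2 /\ size l1 = p.

Lemma code_at_cat P p l1 l2 :
  code_at P p (l1 ++ l2) -> code_at P p l1 /\ code_at P (p + size l1) l2.
Proof.
move=> [a [b [-> <-]]]; split.
  by exists a, (l2 ++ b); rewrite !catA.
by exists (a ++ l1), b; rewrite !catA size_cat.
Qed.

Lemma code_at_cons P p c l :
  code_at P p (c :: l) -> onth P p = Some c /\ code_at P p.+1 l.
Proof.
rewrite -cat1s => /code_at_cat [] [a [b [-> <-]]] H; split; last by rewrite -addn1.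
by rewrite onth_cat ltnn subnn.
Qed.

Definition trace (P : program) (M : nat) (l : state R) (t : nat) (l' : state R) :=
  run P t l = l' /\ forall k, (k < t)%N -> (cells_needed P (run P k l) <= M)%N.

Lemma trace_add P M l t l1 t2 l2 :
  trace P M l t l1 -> trace P M l1 t2 l2 -> trace P M l (t + t2) l2.
Proof.
move=> [H1 H2] [H3 H4]; split; first by rewrite /run addnC iterD -[iter t _ _]/(run _ _ _) H1.
move=> k; case: (ltnP k t) => [/H2 //|le_tk] lt_k.
have -> : run P k l = run P (k - t) l1.
  by rewrite -{1}(subnK le_tk) /run iterD -[iter t _ _]/(run _ _ _) H1.
by apply: H4; lia.
Qed.

Lemma trace1 P M (l : state R) c : onth P (pc l) = Some c ->
  (cells_needed P l <= M)%N -> trace P M l 1 (exec c l).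
Proof.
move=> H1 H2; split; first by rewrite /run /= /step H1.
by case.
Qed.

Definition simulates (n : nat) (h : hst) (l : state R) : Prop :=
  [/\ forall r, r != 1%N -> ireg l r = hi h r,
      hi h 0 = n,
      forall r, rreg l r = hr h r,
      forall k i, (k < 9)%N -> (i < n)%N -> imem l (k * n + i) = ha h k i
    & forall k i, (k < 9)%N -> (i < n)%N -> rmem l (k * n + i) = hb h k i].

Lemma addr_inj n k k' i i' : (i < n)%N -> (i' < n)%N ->
  (k * n + i == k' * n + i')%N = (k == k') && (i == i').
Proof.
move=> Hi Hi'; apply/eqP/andP => [H|[/eqP -> /eqP -> //]].
have := congr1 (divn^~ n) H; rewrite /= !divnMDl ?(leq_ltn_trans _ Hi) //.
rewrite !divn_small // !addn0 => E; move: H; rewrite E => /addnI ->.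
by rewrite !eqxx.
Qed.

Lemma cells_needed_onth P (l : state R) c : onth P (pc l) = Some c ->
  cells_needed P l = match c with
  | ILoad _ a | IStore a _ | RLoad _ a | RStore a _ => (ireg l a).+1
  | _ => 0 end.
Proof. by rewrite /cells_needed => ->; case: c. Qed.

Lemma addr_code_sim n P k a p h l : code_at P p (addr_code k a) -> pc l = p ->
  simulates n h l -> a != 1%N ->
  exists l', [/\ trace P (9 * n) l k.+2 l', pc l' = (p + k.+2)%N, simulates n h l'
    & ireg l' 1 = (k * n + hi h a)%N].
Proof.
move=> Hc Hp Hr Ha.
have [Hc1 Hc2] := code_at_cons Hc.
have [Hc3 Hc4] := code_at_cat Hc2.
have [Hc5 _] := code_at_cons Hc4.
have [l1 [T1 P1 R1 A1]] : exists l', [/\ trace P (9 * n) l k.+1 l', pc l' = (p + k.+1)%N,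
    simulates n h l' & ireg l' 1 = (k * n)%N].
  move: Hc3 => {Hc Hc2 Hc4 Hc5}; elim: k => [|k IH] Hc3.
    exists (exec (IConst 1 0) l); split.
    - by apply: trace1; rewrite ?Hp // (@cells_needed_onth _ _ (IConst 1 0)) ?Hp.
    - by case: l Hp {Hr} => ? ? ? ? ? /= ->; rewrite addn1.
    - case: Hr => H1 H2 H3 H4 H5; case: l H1 H3 H4 H5 {Hp} => q i r im rm /= *.
      by split=> //= r0 Hr0; rewrite /upd (negPf Hr0); auto.
    - by case: l {Hp Hr}.
  have /code_at_cat [Hca Hcb] : code_at P p.+1 (nseq k (IAdd 1 1 0) ++ [:: IAdd 1 1 0]).
    by rewrite -[[:: _]]/(nseq 1 _) -nseqD addn1.
  have [l1 [T1 P1 R1 A1]] := IH Hca.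
  have [Hcc _] := code_at_cons Hcb; rewrite size_nseq in Hcc.
  have E1 : onth P (pc l1) = Some (IAdd 1 1 0) by rewrite P1 addnS.
  exists (exec (IAdd 1 1 0) l1); split.
  - rewrite -[in k.+2]addn1; apply: trace_add T1 _; apply: trace1 => //.
    by rewrite (cells_needed_onth E1).
  - by case: l1 P1 {T1 R1 A1 E1} => ? ? ? ? ? /= ->; rewrite -addnS.
  - case: R1 => H1 H2 H3 H4 H5; case: l1 H1 H3 H4 H5 {P1 T1 A1 E1} => q i r im rm /= *.
    by split=> //= r0 Hr0; rewrite /upd (negPf Hr0); auto.
  - case: R1 => H1 H2 _ _ _; case: l1 H1 A1 {P1 T1 E1} => q i r im rm /= H1 A1.
    by rewrite /upd /= A1 H1 // H2; lia.
have E1 : onth P (pc l1) = Some (IAdd 1 1 a) by rewrite P1 addnS -addSn; move: Hc5; rewrite size_nseq.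
exists (exec (IAdd 1 1 a) l1); split.
- rewrite -[in k.+2]addn1; apply: trace_add T1 _; apply: trace1 => //.
  by rewrite (cells_needed_onth E1).
- by case: l1 P1 {T1 R1 A1 E1} => ? ? ? ? ? /= ->; rewrite -addnS.
- case: R1 => H1 H2 H3 H4 H5; case: l1 H1 H3 H4 H5 {P1 T1 A1 E1} => q i r im rm /= *.
  by split=> //= r0 Hr0; rewrite /upd (negPf Hr0); auto.
- case: R1 => H1 H2 _ _ _; case: l1 H1 A1 {P1 T1 E1} => q i r im rm /= H1 A1.
  by rewrite /upd /= A1 H1.
Qed.

Lemma size_addr_code k a : size (addr_code k a) = k.+2.
Proof. by rewrite /= size_cat size_nseq addn1. Qed.

Lemma mem_bound n k i : (k < 9)%N -> (i < n)%N -> (k * n + i < 9 * n)%N.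
Proof. by nia. Qed.

Lemma compile_op_sim n P o p h l : code_at P p (compile_op o) -> pc l = p ->
  simulates n h l -> wf_op o -> opok n o h ->
  exists l', [/\ trace P (9 * n) l (opcost o) l', pc l' = (p + size (compile_op o))%N
    & simulates n (opexec o h) l'].
Proof.
case: o => [d c|d a b|d a b|d k a|k a b|d c|d a b|d a b|d a b|d a b|d k a|k a b] /=.
1-3,6-10: move=> /code_at_cons [Hc _] Hp Hr Hw _.
1-8: have E1 := Hc; rewrite -Hp in E1.
1-8: eexists; split; [apply: trace1; [exact: E1 | by rewrite (cells_needed_onth E1)] | | ].
1-16: case: l Hp Hr {E1} => q i r im rm /=.
1,3,5,7,9,11,13,15: by move=> -> _; rewrite addn1.
1-8: move=> _ [H1 H2 H3 H4 H5].
1-3: split=> //=; [ move=> r0 Hr0; rewrite /upd; case: eqP => // _; rewrite -?H1 //; auto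
                  | case: eqP Hw => // <- //].
1-4: by case/and3P: Hw.
1-5: split=> //=; move=> r0; rewrite /upd -?H3; by [|case: eqP].
all: rewrite -cats1 => /(@code_at_cat P p (addr_code k a) [:: _]) [Hc1 Hc2] Hp Hr Hw Hok.
all: have [Hc3 _] := code_at_cons Hc2; rewrite size_addr_code in Hc3.
all: have Ha : a != 1%N by (case/and3P: Hw || case/andP: Hw).
all: have Hk : (k < 9)%N by (case/and3P: Hw || case/andP: Hw).
all: have [l1 [T1 P1 R1 A1]] := addr_code_sim Hc1 Hp Hr Ha.
all: have E1 := Hc3; rewrite -P1 in E1.
all: eexists; split;
  [ rewrite -(addn1 k.+2); apply: trace_add T1 _; apply: trace1;
    [exact: E1 | rewrite (cells_needed_onth E1) A1; exact: mem_bound]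
  | case: l1 P1 {T1 R1 A1 E1} => ? ? ? ? ? /= ->; rewrite !size_cat size_nseq /=; lia | ].
all: case: R1; case: l1 A1 {P1 T1 E1} => q i r im rm /= A1 H1 H2 H3 H4 H5.
- split=> //= [r0 Hr0|].
    by rewrite /upd; case: eqP => // _; [rewrite A1 H4 | rewrite H1].
  by case/and3P: Hw => Hd _ _; case: eqP Hd => // <-.
- split=> //= k0 i0 Hk0 Hi0; rewrite /upd A1 addr_inj // /aupd2 /aupd.
  case: eqP => [->|_] /=; last by rewrite H4.
  by case: eqP => _; rewrite ?H4 // H1 //; case/and3P: Hw.
- split=> //= r0; rewrite /upd; case: eqP => // _; by [rewrite A1 H5].
- split=> //= k0 i0 Hk0 Hi0; rewrite /upd A1 addr_inj // /aupd2 /aupd.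
  case: eqP => [->|_] /=; last by rewrite H5.
  by case: eqP => _; rewrite ?H5 // H3 //; case/and3P: Hw.
Qed.

Lemma blk_sim n P (b : seq op) p h l : code_at P p (flatten (map compile_op b)) -> pc l = p ->
  simulates n h l -> all wf_op b -> blk_ok n b h ->
  exists l', [/\ trace P (9 * n) l (blk_cost b) l',
    pc l' = (p + size (flatten (map compile_op b)))%N & simulates n (blk_exec b h) l'].
Proof.
elim: b p h l => [|o b IH] p h l /=.
  by move=> *; exists l; split; rewrite ?addn0.
move=> /code_at_cat [C1 C2] Hp Hr /andP [W1 W2] /andP [O1 O2].
have [l1 [T1 P1 R1]] := compile_op_sim C1 Hp Hr W1 O1.
have [l2 [T2 P2 R2]] := IH _ _ _ C2 P1 R1 W2 O2.
exists l2; split=> //; first exact: trace_add T1 T2.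
by rewrite size_cat addnA.
Qed.

Lemma jump_sim n P t q p h l : code_at P p [:: jump t q] -> pc l = p -> simulates n h l ->
  wf_test t -> exists l', [/\ trace P (9 * n) l 1 l',
    pc l' = (if tst t h then q else p.+1) & simulates n h l'].
Proof.
move=> /code_at_cons [Hc _] Hp Hr Hw.
have E1 := Hc; rewrite -Hp in E1.
exists (exec (jump t q) l); split.
- apply: trace1 => //; rewrite (cells_needed_onth E1); by case: (t).
- case: Hr => H1 _ H3 _ _; move: H1 H3; rewrite -Hp; case: l {Hp E1} => pc0 i r im rm /= H1 H3.
  case: t Hw {Hc} => a b /=; last by rewrite !H3.
  by move=> /andP [Ha Hb]; rewrite !H1.
- by case: Hr => H1 H2 H3 H4 H5; case: l H1 H3 H4 H5 {Hp E1} => q0 i r im rm *; case: (t); split.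
Qed.

Lemma code_at_cons1 P p c l :
  code_at P p (c :: l) -> code_at P p [:: c] /\ code_at P p.+1 l.
Proof. by rewrite -cat1s -[p.+1]addn1 => /code_at_cat. Qed.

(** The induction is on the evaluation and not on the command, because each iteration of a loop
    returns to the same code. Time is an inequality since the costs of branches and loops are
    rounded up. *)
Lemma compile_sim n c h h' t : eval n c h h' t -> wf c -> forall P p l,
  code_at P p (compile p c) -> pc l = p -> simulates n h l ->
  exists t' l', [/\ (t' <= t)%N, trace P (9 * n) l t' l',
    pc l' = (p + size (compile p c))%N & simulates n h' l'].
Proof.
elim=> {c h h' t}.
- move=> b s Hok Hw P p l Hc Hp Hr.
  have [l' [T1 P1 R1]] := blk_sim Hc Hp Hr Hw Hok.
  by exists (blk_cost b), l'.
- move=> c1 c2 s1 s2 s3 t1 t2 _ IH1 _ IH2 /andP [W1 W2] P p l /code_at_cat [C1 C2] Hp Hr.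
  have [k1 [l1 [le1 T1 P1 R1]]] := IH1 W1 _ _ _ C1 Hp Hr.
  have [k2 [l2 [le2 T2 P2 R2]]] := IH2 W2 _ _ _ C2 P1 R1.
  exists (k1 + k2)%N, l2; split=> //; [exact: leq_add|exact: trace_add T1 T2|].
  by rewrite P2 /= size_cat addnA.
- move=> t c1 c2 s s' k Ht _ IH /and3P [W0 W1 W2] P p l; rewrite compile_IfE => /code_at_cons1 [C0].
  move=> /code_at_cat [_ /code_at_cons1 [_ C2]] Hp Hr.
  have [l0 [T0 P0 R0]] := jump_sim C0 Hp Hr W0.
  rewrite Ht in P0.
  have Eq : (p.+1 + size (compile p.+1 c2)).+1 = (p + size (compile p.+1 c2) + 2)%N by lia.
  rewrite Eq in C2.
  have [k1 [l1 [le1 T1 P1 R1]]] := IH W1 _ _ _ C2 P0 R0.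
  exists (1 + k1)%N, l1; split=> //; [lia|exact: trace_add T0 T1|].
  rewrite P1 [size (_ :: _)]/= size_cat [size (_ :: _)]/=; lia.
- move=> t c1 c2 s s' k Ht _ IH /and3P [W0 W1 W2] P p l; rewrite compile_IfE => /code_at_cons1 [C0].
  move=> /code_at_cat [C1 /code_at_cons1 [C2 _]] Hp Hr.
  have [l0 [T0 P0 R0]] := jump_sim C0 Hp Hr W0.
  rewrite (negPf Ht) in P0.
  have [k1 [l1 [le1 T1 P1 R1]]] := IH W2 _ _ _ C1 P0 R0.
  have [l2 [T2 P2 R2]] := @jump_sim n P (TI 0 0) _ _ _ _ C2 P1 R1 isT.
  exists (1 + (k1 + 1))%N, l2; split=> //; [lia| |].
    by apply: trace_add T0 _; apply: trace_add T1 T2.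
  rewrite P2 [tst _ _]leqnn [size (_ :: _)]/= size_cat [size (_ :: _)]/=; lia.
- move=> t c s Ht /andP [W0 _] P p l; rewrite compile_UntilE => /code_at_cons1 [C0 _] Hp Hr.
  have [l0 [T0 P0 R0]] := jump_sim C0 Hp Hr W0.
  exists 1%N, l0; split=> //; rewrite P0 Ht [size (_ :: _)]/= size_cat [size (_ :: _)]/=; lia.
- move=> t c s1 s2 s3 k1 k2 Ht _ IH1 _ IH2 Hw P p l Hc Hp Hr.
  have /andP [W0 W1] := Hw.
  have Hc' := Hc; rewrite compile_UntilE in Hc'.
  have [C0 /code_at_cat [C1 C2]] := code_at_cons1 Hc'.
  have [l0 [T0 P0 R0]] := jump_sim C0 Hp Hr W0.
  rewrite (negPf Ht) in P0.
  have [t1 [l1 [le1 T1 P1 R1]]] := IH1 W1 _ _ _ C1 P0 R0.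
  have [l2 [T2 P2 R2]] := @jump_sim n P (TI 0 0) _ _ _ _ C2 P1 R1 isT.
  rewrite [tst _ _]leqnn in P2.
  have [t3 [l3 [le3 T3 P3 R3]]] := IH2 Hw _ _ _ Hc P2 R2.
  exists (1 + (t1 + (1 + t3)))%N, l3; split=> //; first lia.
  by apply: trace_add T0 _; apply: trace_add T1 _; apply: trace_add T2 T3.
Qed.

End Language.

(** * Weakest preconditions with time *)

Section Wp.
Variables (R : realType) (n : nat).
Local Notation hst := (hst R).
Implicit Types (c : cmd) (s : hst) (Q : hst -> nat -> Prop).

Definition op_hi o := match o with
  | OConst d _ | OAdd d _ _ | OSub d _ _ | OLd d _ _ => [:: d] | _ => [::] end.
Definition op_hr o := match o with
  | QConst d _ | QAdd d _ _ | QSub d _ _ | QMul d _ _ | QDiv d _ _ | QLd d _ _ => [:: d]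
  | _ => [::] end.
Definition op_ha o := if o is OSt k _ _ then [:: k] else [::].
Definition op_hb o := if o is QSt k _ _ then [:: k] else [::].

Fixpoint writes (f : op -> seq nat) (c : cmd) : seq nat :=
  match c with
  | Blk l => flatten (map f l)
  | Seq c1 c2 | If _ c1 c2 => writes f c1 ++ writes f c2
  | Until _ c => writes f c
  end.

(** The write sets are computed from the syntax, so loop invariants need not list untouched
    registers and arrays. *)
Definition frame c s s' : Prop :=
  [/\ forall r, r \notin writes op_hi c -> hi s' r = hi s r,
      forall r, r \notin writes op_hr c -> hr s' r = hr s r,
      forall k, k \notin writes op_ha c -> ha s' k = ha s k
    & forall k, k \notin writes op_hb c -> hb s' k = hb s k].

Lemma frame_op o s : [/\ forall r, r \notin op_hi o -> hi (opexec o s) r = hi s r,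
      forall r, r \notin op_hr o -> hr (opexec o s) r = hr s r,
      forall k, k \notin op_ha o -> ha (opexec o s) k = ha s k
    & forall k, k \notin op_hb o -> hb (opexec o s) k = hb s k].
Proof.
by case: o => *; split=> // k; rewrite inE /= => /negPf ->.
Qed.

Lemma frame_blk l s : frame (Blk l) s (blk_exec l s).
Proof.
elim: l s => [|o l IH] s //=.
have [A1 A2 A3 A4] := IH (opexec o s); have [B1 B2 B3 B4] := frame_op o s.
by split=> k; rewrite /= mem_cat negb_or => /andP [H1 H2]; rewrite (A1,A2,A3,A4) // (B1,B2,B3,B4).
Qed.

Lemma frame_eval c s s' t : eval n c s s' t -> frame c s s'.
Proof.
elim=> {c s s' t} [l s _|c1 c2 s1 s2 s3 t1 t2 _ A _ B|t c1 c2 s s' j _ _ A|t c1 c2 s s' j _ _ A|//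
  |t c s1 s2 s3 k1 k2 _ _ A _ B]; first exact: frame_blk.
- case: A B => A1 A2 A3 A4 [B1 B2 B3 B4].
  by split=> k; rewrite /= mem_cat negb_or => /andP [H1 H2]; rewrite (B1,B2,B3,B4) // (A1,A2,A3,A4).
- case: A => A1 A2 A3 A4.
  by split=> k; rewrite /= mem_cat negb_or => /andP [H1 H2]; rewrite (A1,A2,A3,A4).
- case: A => A1 A2 A3 A4.
  by split=> k; rewrite /= mem_cat negb_or => /andP [H1 H2]; rewrite (A1,A2,A3,A4).
- case: A B => A1 A2 A3 A4 [B1 B2 B3 B4].
  by split=> k /= H; rewrite (B1,B2,B3,B4) // (A1,A2,A3,A4).
Qed.

Lemma frame_refl c s : frame c s s. Proof. by []. Qed.

Lemma frame_trans c s1 s2 s3 : frame c s1 s2 -> frame c s2 s3 -> frame c s1 s3.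
Proof.
by move=> [A1 A2 A3 A4] [B1 B2 B3 B4]; split=> k H; rewrite (B1,B2,B3,B4) // (A1,A2,A3,A4).
Qed.

Definition wp c s Q : Prop := exists s' t, eval n c s s' t /\ Q s' t.

Lemma wp_blk l s Q : blk_ok n l s -> Q (blk_exec l s) (blk_cost l) -> wp (Blk l) s Q.
Proof. by move=> H1 H2; exists (blk_exec l s), (blk_cost l); split=> //; apply: EBlk. Qed.

Lemma wp_seq c1 c2 s Q :
  wp c1 s (fun s1 t1 => wp c2 s1 (fun s2 t2 => Q s2 (t1 + t2)%N)) -> wp (Seq c1 c2) s Q.
Proof.
move=> [s1 [t1 [E1 [s2 [t2 [E2 H]]]]]]; exists s2, (t1 + t2)%N; split=> //.
exact: ESeq E1 E2.
Qed.

Lemma wp_if t c1 c2 s Q :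
  (tst t s -> wp c1 s (fun s' k => Q s' (k + 2)%N)) ->
  (~~ tst t s -> wp c2 s (fun s' k => Q s' (k + 2)%N)) -> wp (If t c1 c2) s Q.
Proof.
case: (boolP (tst t s)) => H A B.
  have [s' [k [E HQ]]] := A isT; exists s', (k + 2)%N; split=> //; exact: EIfT.
have [s' [k [E HQ]]] := B isT; exists s', (k + 2)%N; split=> //; exact: EIfF.
Qed.

Lemma wp_frame c s Q Q' :
  wp c s Q' -> (forall s' t, frame c s s' -> Q' s' t -> Q s' t) -> wp c s Q.
Proof.
move=> [s' [t [E H]]] HQ; exists s', t; split=> //; exact: HQ (frame_eval E) H.
Qed.

(** [mu] bounds the remaining time and, as every iteration lowers it by at least 2, also serves as
    termination measure. *)
Lemma wp_until t c s (I : hst -> Prop) (mu : hst -> nat) Q :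
  I s ->
  (forall s', frame c s s' -> I s' -> ~~ tst t s' ->
     wp c s' (fun s'' k => I s'' /\ (k + 2 + mu s'' <= mu s')%N)) ->
  (forall s' k, frame c s s' -> I s' -> tst t s' -> (k + mu s' <= mu s + 2)%N -> Q s' k) ->
  wp (Until t c) s Q.
Proof.
move=> HI Hb HQ.
have key m : forall s0, (mu s0 <= m)%N -> frame c s s0 -> I s0 -> wp (Until t c) s0
    (fun s' k => [/\ frame c s s', I s', tst t s' & (k + mu s' <= mu s0 + 2)%N]).
  elim: m => [|m IH] s0 Hm Hf HI0.
    case: (boolP (tst t s0)) => Ht.
      by exists s0, 2%N; split; [exact: EUntT | split=> //; lia].
    by have [s1 [k [_ [_ ?]]]] := Hb _ Hf HI0 Ht; lia.
  case: (boolP (tst t s0)) => Ht.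
    by exists s0, 2%N; split; [exact: EUntT | split=> //; lia].
  have [s1 [k [E [HI1 Hk]]]] := Hb _ Hf HI0 Ht.
  have Hm1 : (mu s1 <= m)%N by lia.
  have [s2 [k2 [E2 [? ? ? ?]]]] := IH _ Hm1 (frame_trans Hf (frame_eval E)) HI1.
  exists s2, (k + k2 + 2)%N; split; first exact: EUntF E E2.
  by split=> //; lia.
have [s' [k [E [H1 H2 H3 H4]]]] := key _ _ (leqnn _) (frame_refl c s) HI.
by exists s', k; split=> //; exact: HQ.
Qed.

(* [For i b c] runs [c] with register [i] going from 0 up to register [b]
   (excluded); register 2 must hold 1. *)
Definition For i b c : cmd :=
  Seq (Blk [:: OConst i 0]) (Until (TI b i) (Seq c (Blk [:: OAdd i i 2]))).

(** [phi] may depend on the state, which permits amortized bounds: a long iteration is paid by a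
    fall of the potential. The 3 covers the increment and the loop test. *)
Lemma wp_for i b c s (I : nat -> hst -> Prop) (phi : nat -> hst -> nat) Q :
  hi s 2 = 1%N -> 2 \notin i :: writes op_hi c -> i \notin b :: writes op_hi c ->
  b \notin writes op_hi c ->
  I 0%N (opexec (OConst i 0) s) ->
  (forall k s', frame (For i b c) s s' -> (k < hi s b)%N -> hi s' i = k -> I k s' ->
     wp c s' (fun s'' t => I k.+1 (opexec (OAdd i i 2) s'') /\
        (t + 3 + phi k.+1 (opexec (OAdd i i 2) s'') <= phi k s')%N)) ->
  (forall s' t, frame (For i b c) s s' -> I (hi s b) s' ->
     (t <= phi 0%N (opexec (OConst i 0) s) + 3)%N -> Q s' t) ->
  wp (For i b c) s Q.
Proof.
rewrite !inE !negb_or => H2 /andP [N2i N2] /andP [Nib Ni] Nb HI0 Hb HQ.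
have Efr s' : frame (Seq c (Blk [:: OAdd i i 2])) (opexec (OConst i 0) s) s' ->
    frame (For i b c) s s'.
  move=> [A1 A2 A3 A4]; split=> k.
  - rewrite /= inE negb_or => /andP [Hk1 Hk2].
    by rewrite A1 //= (negPf Hk1).
  - by move=> Hk; rewrite A2.
  - by move=> Hk; rewrite A3.
  - by move=> Hk; rewrite A4.
apply: wp_seq; apply: wp_blk => //=.
apply: (@wp_until _ _ _ (fun s' => [/\ I (hi s' i) s', (hi s' i <= hi s b)%N, hi s' 2 = 1%N & hi s' b = hi s b])
  (fun s' => phi (hi s' i) s')).
- by rewrite /= eqxx (negPf N2i) (negbTE (_ : b != i)) // eq_sym.
- move=> s' Hf [HI Hle E2 Eb]; rewrite /= Eb -ltnNge => Hlt.
  apply: wp_seq; have := Hb _ _ (Efr _ Hf) Hlt erefl HI.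
  move/wp_frame; apply=> s1 t Hf1 [HI1 Ht].
  have E2' : hi s1 2 = 1%N by case: Hf1 => ->.
  have Ei' : hi s1 i = hi s' i by case: Hf1 => ->.
  have Eb' : hi s1 b = hi s b by case: Hf1 => ->.
  apply: wp_blk => //=; rewrite eqxx (negPf N2i) (negbTE (_ : b != i)) 1?eq_sym //.
  rewrite Ei' E2' Eb' addn1; split; first by split=> //; move: HI1; rewrite /= Ei' E2' addn1.
  by move: Ht; rewrite /= Ei' E2' addn1; lia.
- move=> s' k Hf [HI Hle _ Eb]; rewrite /= Eb => Hge Hk.
  apply: HQ; first exact: Efr.
    by have <- : hi s' i = hi s b by lia.
  by move: Hk; rewrite /= eqxx; lia.
Qed.

Lemma wp_for_const i b c s (I : nat -> hst -> Prop) (d : nat) Q :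
  hi s 2 = 1%N -> 2 \notin i :: writes op_hi c -> i \notin b :: writes op_hi c ->
  b \notin writes op_hi c ->
  I 0%N (opexec (OConst i 0) s) ->
  (forall k s', frame (For i b c) s s' -> (k < hi s b)%N -> hi s' i = k -> I k s' ->
     wp c s' (fun s'' t => I k.+1 (opexec (OAdd i i 2) s'') /\ (t + 3 <= d)%N)) ->
  (forall s' t, frame (For i b c) s s' -> I (hi s b) s' ->
     (t <= d * hi s b + 3)%N -> Q s' t) ->
  wp (For i b c) s Q.
Proof.
move=> H2 N1 N2 N3 HI Hb HQ.
apply: (@wp_for _ _ _ _ I (fun k _ => d * (hi s b - k))%N) => //.
- move=> k s' Hf Hk Hi HI'; apply: wp_frame (Hb _ _ Hf Hk Hi HI') _ => s1 t _ [H Ht].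
  by split=> //; nia.
- by move=> s' t Hf HI' Ht; apply: HQ => //; lia.
Qed.

End Wp.

(** * Computing the persistence *)

Section Depth.
Local Open Scope nat_scope.

Fixpoint depth_fuel (pg : nat -> nat) fuel j : nat :=
  if fuel is fuel'.+1 then (if j is j'.+1 then (depth_fuel pg fuel' (pg j')).+1 else 0) else 0.
(* Number of steps from [j] to 0 along the pointers [j.+1 |-> pg j]: the height
   of the stack, and the potential of the amortized analysis. *)
Definition depth pg j := depth_fuel pg j j.

Lemma depth_fuelE pg f1 f2 j : j <= f1 -> j <= f2 -> (forall k, k < j -> pg k <= k) ->
  depth_fuel pg f1 j = depth_fuel pg f2 j.
Proof.
elim: f1 f2 j => [|f1 IH] [|f2] [|j] //= H1 H2 Hpg; congr _.+1.
have Hp := Hpg j (ltnSn j).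
by apply: IH => [||k Hk]; [lia|lia|apply: Hpg; lia].
Qed.

Lemma depthS pg j : (forall k, k <= j -> pg k <= k) -> depth pg j.+1 = (depth pg (pg j)).+1.
Proof.
move=> Hpg; have Hp := Hpg j (leqnn j); rewrite {1}/depth /=; congr _.+1.
by apply: depth_fuelE => // k Hk; apply: Hpg; lia.
Qed.

(** Storing a new pointer thus leaves the depth of all earlier positions unchanged. *)
Lemma depth_eq pg pg' j : (forall k, k < j -> pg k <= k) -> (forall k, k < j -> pg k = pg' k) ->
  depth pg j = depth pg' j.
Proof.
move=> Hpg E.
suff H f i : i <= j -> depth_fuel pg f i = depth_fuel pg' f i by exact: H.
elim: f i => [|f IH] [|i] //= Hi; have Hp := Hpg i Hi.
by rewrite -E // IH //; lia.
Qed.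

End Depth.

(** * Linear-time scan for previous larger values and minima *)

Section Scan.
Variables (R : realType) (n : nat).
Local Notation hst := (hst R).
Local Notation wp := (@wp R n).
Implicit Types (s : hst) (g : nat -> R).

(** [true] is for the scan to the left and [false] for the one to the right, in accordance with the
    tie rule for maxima. *)
Definition popped (b : bool) (x y : R) : bool := if b then x < y else x <= y.

(** For [j > 0], [j.-1] is the nearest earlier position whose value stops the scan, and [m] is the
    minimum over the run from [j] to [i]. *)
Definition scanned b g i j m : Prop :=
  [/\ (j <= i)%N, forall k, (j <= k < i)%N -> popped b (g k) (g i),
      (0 < j)%N -> ~~ popped b (g j.-1) (g i),
      forall k, (j <= k <= i)%N -> m <= g k & exists k, (j <= k <= i)%N /\ m = g k].

Definition if_popped (b : bool) (P S : cmd) : cmd :=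
  if b then If (TR 1 3) S P else If (TR 3 1) P S.

Lemma wp_if_popped b P S s Q :
  (popped b (hr s 3) (hr s 1) -> wp P s (fun s' k => Q s' (k + 2)%N)) ->
  (~~ popped b (hr s 3) (hr s 1) -> wp S s (fun s' k => Q s' (k + 2)%N)) ->
  wp (if_popped b P S) s Q.
Proof.
by case: b => /= HP HS; apply: wp_if => //=; rewrite -?ltNge -?leNgt // => H; apply: HS; rewrite -leNgt.
Qed.

(** Integer register 5 is the left end reached so far and 6 a stop flag; real register 1 is the
    value at the current point and 2 the minimum so far. A pop skips a whole earlier run, whose
    minimum is in array 3. *)
Definition scan_step (b : bool) : cmd :=
  If (TI 5 3) (Blk [:: OConst 6 1])
    (Seq (Blk [:: OSub 7 5 2; QLd 3 2 7])
      (if_popped b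
        (Seq (Blk [:: QLd 4 3 7; OLd 5 0 7]) (If (TR 2 4) (Blk [::]) (Blk [:: QLd 2 3 7])))
        (Blk [:: OConst 6 1]))).

Definition scan (b : bool) : cmd :=
  For 4 0 (Seq (Blk [:: QLd 1 2 4; QLd 2 2 4; OAdd 5 4 3; OConst 6 0])
    (Seq (Until (TI 2 6) (scan_step b)) (Blk [:: OSt 0 4 5; QSt 3 4 2]))).

Lemma popped_trans b x y z : popped b x y -> popped b y z -> popped b x z.
Proof. by case: b; [exact: lt_trans|exact: le_trans]. Qed.

Definition scan_inv b g i s : Prop :=
  [/\ (hi s 5 <= i)%N, forall k, (hi s 5 <= k < i)%N -> popped b (g k) (g i),
      (0 < hi s 6)%N -> (0 < hi s 5)%N -> ~~ popped b (g (hi s 5).-1) (g i),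
      forall k, (hi s 5 <= k <= i)%N -> hr s 2 <= g k &
      exists k, (hi s 5 <= k <= i)%N /\ hr s 2 = g k].

(** A pop shortens the path of pointers by one and releases 40; the last step raises the stop flag,
    which releases the other 40. *)
Lemma scan_step_ok b g i s : (i < n)%N -> hi s 2 = 1%N -> hi s 3 = 0%N -> hr s 1 = g i ->
  hb s 2 = g -> (forall k, (k < i)%N -> scanned b g k (ha s 0 k) (hb s 3 k)) ->
  scan_inv b g i s -> hi s 6 = 0%N ->
  wp (scan_step b) s (fun s' t => scan_inv b g i s' /\
   (t + 2 + (40 * depth (ha s 0) (hi s' 5) + 40 * (1 - hi s' 6)) <= 40 * depth (ha s 0) (hi s 5) + 40)%N).
Proof.
move=> Hi E2 E3 E1 Eg Hsc [I1 I2 I3 I4 [x [I5 I6]]] E6.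
apply: wp_if => /=; rewrite E3 => Hj.
  have Hj0 : hi s 5 = 0%N by lia.
  apply: wp_blk => //=; split; last by rewrite addn0; lia.
  by split=> //=; [rewrite Hj0|exists x].
have Hjn : ((hi s 5).-1 < n)%N by lia.
apply: wp_seq; apply: wp_blk; first by rewrite /= ?E2 ?subn1 Hjn.
apply: wp_if_popped => /=; rewrite Eg E1 E2 subn1 => Hp.
  have [S1 S2 S3 S4 [y [S5 S6]]] := Hsc (hi s 5).-1 ltac:(lia).
  apply: wp_seq; apply: wp_blk; first by rewrite /= ?E2 ?subn1 Hjn.
  set j' := ha s 0 (hi s 5).-1 in S1 S2 S3 S4 S5.
  have Hdep : depth (ha s 0) (hi s 5) = (depth (ha s 0) j').+1.
    rewrite -[in LHS](prednK (_ : 0 < hi s 5)%N); last by lia.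
    rewrite depthS // => k Hk; have : (k < i)%N by lia.
    by move=> /Hsc [].
  have P1 k : (j' <= k < i)%N -> popped b (g k) (g i).
    move=> Hk; case: (ltnP k (hi s 5).-1) => Hk1.
      by apply: popped_trans Hp; apply: S2; lia.
    have [->//|Hne] := eqVneq k (hi s 5).-1.
    by apply: I2; lia.
  apply: wp_if => /= Hm; apply: wp_blk => //=; rewrite ?E2 ?subn1 ?Hjn //= -/j'.
    split; last by rewrite Hdep; lia.
    split=> //=; [lia|by rewrite E6| |].
      move=> k Hk; case: (ltnP k (hi s 5)) => Hk1; last by apply: I4; lia.
      by apply: le_trans Hm _; apply: S4; lia.
    by exists x; split=> //; lia.
  move: Hm; rewrite -ltNge => Hm.
  split; last by rewrite Hdep; lia.
  split=> //=; rewrite ?E2 ?subn1; [lia|by rewrite E6| |].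
    move=> k Hk; case: (ltnP k (hi s 5)) => Hk1; first by apply: S4; lia.
    by apply: le_trans (ltW Hm) _; apply: I4; lia.
  by exists y; split=> //; lia.
apply: wp_blk => //=; split; last by lia.
by split=> //; exists x.
Qed.

(** The inner loop is paid by the fall of the depth from that of [k] to that of the final left end.
    The new pointer makes the depth only one larger than the latter, so the total is linear. *)
Lemma scan_ok b s Q : hi s 0 = n -> hi s 2 = 1%N -> hi s 3 = 0%N ->
  (forall s' t, frame (scan b) s s' ->
    (forall i, (i < n)%N -> scanned b (hb s 2) i (ha s' 0 i) (hb s' 3 i)) ->
    (t <= 300 * n + 3)%N -> Q s' t) ->
  wp (scan b) s Q.
Proof.
move=> E0 E2 E3 HQ.
apply: (@wp_for _ _ _ _ _ _ (fun k s' => forall i, (i < k)%N -> scanned b (hb s 2) i (ha s' 0 i) (hb s' 3 i))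
  (fun k s' => 300 * (n - k) + 40 * depth (ha s' 0) k)%N) => //.
- by case: b {HQ}.
- by case: b {HQ}.
- by case: b {HQ}.
- move=> k s' Hf; rewrite E0 => Hk Hk4 HI.
  have [F1 F2 F3 F4] := Hf.
  have e2 : hi s' 2 = 1%N by rewrite F1 //; case: (b).
  have e3 : hi s' 3 = 0%N by rewrite F1 //; case: (b).
  have eg : hb s' 2 = hb s 2 by rewrite F4 //; case: (b).
  apply: wp_seq; apply: wp_blk; first by rewrite /= Hk4 Hk.
  apply: wp_seq.
  apply: (@wp_until _ _ _ _ _ (scan_inv b (hb s 2) k)
    (fun s1 => 40 * depth (ha s' 0) (hi s1 5) + 40 * (1 - hi s1 6))%N).
  + rewrite /= Hk4 e3 addn0; split=> //=.
    * by move=> i; lia.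
    * by move=> i; rewrite ?Hk4 ?e3 ?addn0 eg => Hi; have -> : i = k by lia.
    * by exists k; rewrite eg leqnn.
  + move=> s1 [G1 G2 G3 G4] HI1 Ht.
    have h2 : hi s1 2 = 1%N by rewrite G1 //=; case: (b).
    have h6 : hi s1 6 = 0%N by move: Ht; rewrite /= h2; lia.
    have h1 : hr s1 1 = hb s 2 k by rewrite G2 //= ?Hk4 ?eg //; case: (b).
    have hg : hb s1 2 = hb s 2 by rewrite G4 //=; case: (b).
    have hp : ha s1 0 = ha s' 0 by rewrite G3 //=; case: (b).
    have h3 : hi s1 3 = 0%N by rewrite G1 //=; case: (b).
    have hm : hb s1 3 = hb s' 3 by rewrite G4 //=; case: (b).
    have Hsc i : (i < k)%N -> scanned b (hb s 2) i (ha s1 0 i) (hb s1 3 i).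
      by move=> Hi; rewrite hp hm; exact: HI.
    have := scan_step_ok Hk h2 h3 h1 hg Hsc HI1 h6.
    rewrite hp => /wp_frame; apply=> s2 t [K1 K2 K3 K4] [HI2 Ht2].
    by rewrite h6; split=> //; lia.
  + move=> s1 t1 [G1 G2 G3 G4] [J1 J2 J3 J4 J5] Ht Ht1.
    have h2 : hi s1 2 = 1%N by rewrite G1 //=; case: (b).
    have h4 : hi s1 4 = k by rewrite G1 //=; case: (b).
    have hp : ha s1 0 = ha s' 0 by rewrite G3 //=; case: (b).
    have hm : hb s1 3 = hb s' 3 by rewrite G4 //=; case: (b).
    rewrite /= h2 in Ht.
    have Hle i : (i < k)%N -> (ha s' 0 i <= i)%N by move=> /HI [].
    apply: wp_blk; first by rewrite /= h4 Hk.
    rewrite /= h4 hp hm; split.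
      move=> i Hi; rewrite /aupd; case: eqP => [->|Hne]; last by apply: HI; lia.
      by split=> //; exact: J3.
    move: Ht1; rewrite /= Hk4 e3 addn0 => Ht1.
    have Hle' i : (i < k.+1)%N -> (aupd (ha s' 0) k (hi s1 5) i <= i)%N.
      by move=> Hi; rewrite /aupd; case: eqP => [->|Hne] //; apply: Hle; lia.
    have D1 : depth (aupd (ha s' 0) k (hi s1 5)) k.+1 =
        (depth (aupd (ha s' 0) k (hi s1 5)) (hi s1 5)).+1.
      by rewrite depthS // /aupd eqxx.
    have D2 : depth (aupd (ha s' 0) k (hi s1 5)) (hi s1 5) = depth (ha s' 0) (hi s1 5).
      apply: depth_eq => i Hi; first by apply: Hle'; lia.
      by rewrite /aupd; case: eqP => // E; lia.
    by rewrite D1 D2; lia.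
- move=> s' t Hf HI Ht; apply: HQ => //; rewrite -?E0 //.
  by move: Ht; rewrite /= E0 /depth /=; lia.
Qed.
End Scan.

(** * Persistence of maxima from the scans in both directions *)

Section Persistence.
Variables (R : realType) (n : nat).
Local Notation hst := (hst R).
Local Notation wp := (@wp R n).
Implicit Types (s : hst) (g : nat -> R).

Lemma scanned_eq b g g' i j (m : R) : (forall k, (k <= i)%N -> g k = g' k) ->
  scanned b g i j m -> scanned b g' i j m.
Proof.
move=> E [S1 S2 S3 S4 [y [S5 S6]]]; split=> //.
- by move=> k Hk; rewrite -!E; [exact: S2|lia|lia].
- by move=> Hj; rewrite -!E; [exact: S3|lia|lia].
- by move=> k Hk; rewrite -E; [exact: S4|lia].
- by exists y; rewrite -E //; lia.
Qed.

(** [l] and [r] are the pointers found by the two scans; 0 means that nothing stopped the scan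
    before the end of the domain. *)
Definition combine (l r : nat) (x y : R) : R :=
  if (l <= 0)%N then (if (r <= 0)%N then Num.max x y else y)
  else if (r <= 0)%N then x else Num.min x y.

Lemma threshold_max (big : R -> bool) x y : threshold big ->
  big (Num.max x y) = big x || big y.
Proof.
move=> th; case: (leP x y) => H.
  by case Hx: (big x) => //=; rewrite (bigW th Hx).
by case Hy: (big y); rewrite ?orbF ?orbT // (bigW th Hy) ?ltW.
Qed.

Lemma threshold_min (big : R -> bool) x y : threshold big ->
  big (Num.min x y) = big x && big y.
Proof.
move=> th; case: (leP x y) => H.
  by case Hx: (big x) => //=; rewrite (bigW th Hx).
by case Hy: (big y); rewrite ?andbF ?andbT // (bigW th Hy) ?ltW.
Qed.

(** Before the value that stops the scan, the deepest drop is the one to [m]; so some drop there is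
    big exactly if this one is. *)
Lemma left_scanned big g p j m : threshold big -> scanned true g p j m ->
  left_max big g p <-> j = 0%N \/ big (g p - m).
Proof.
move=> th [S1 S2 S3 S4 [y [S5 S6]]]; rewrite /popped in S2 S3; split.
  case: (posnP j) => [->|Hj]; first by left.
  have := S3 Hj; rewrite -leNgt => Hjp.
  have Hj1 : (j.-1 < p)%N by lia.
  case=> [[q [Hq Hb Hk]]|/(_ _ Hj1)]; last by rewrite ltNge Hjp.
  right; apply: (bigW th Hb); rewrite lerD2l lerN2; apply: S4; rewrite (ltnW Hq) andbT.
  rewrite leqNgt; apply/negP => Hqj.
  have [E|Hne] := eqVneq q j.-1; first by move: (big_gt0 th Hb); rewrite E; lra.
  by have := Hk j.-1 ltac:(lia); rewrite ltNge Hjp.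
case=> [Hj|Hb]; first by right=> k Hk; apply: S2; lia.
left; exists y; rewrite -S6; split=> //; last by move=> k Hk; apply: S2; lia.
rewrite ltn_neqAle; apply/andP; split; last lia.
by apply/eqP => E; move: (big_gt0 th Hb); rewrite S6 E subrr ltxx.
Qed.

Lemma right_scanned big g p j m : threshold big -> (p < n)%N ->
  scanned false (fun i => g (n.-1 - i)%N) (n.-1 - p) j m ->
  right_max n big g p <-> j = 0%N \/ big (g p - m).
Proof.
move=> th Hp [S1 S2 S3 S4 [y [S5 S6]]]; rewrite /popped /= in S2 S3 S4 S6.
have Ep : (n.-1 - (n.-1 - p))%N = p by lia.
rewrite Ep in S2 S3.
have S2' k : (p < k < n)%N -> (k <= n.-1 - j)%N -> g k <= g p.
  move=> Hk Hk2; have := S2 (n.-1 - k)%N ltac:(lia).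
  by rewrite (_ : (n.-1 - (n.-1 - k))%N = k) //; lia.
have S4' k : (p <= k < n)%N -> (k <= n.-1 - j)%N -> m <= g k.
  move=> Hk Hk2; have := S4 (n.-1 - k)%N ltac:(lia).
  by rewrite (_ : (n.-1 - (n.-1 - k))%N = k) //; lia.
split.
  case: (posnP j) => [->|Hj]; first by left.
  have := S3 Hj; rewrite -ltNge => Hjp.
  have Hj1 : (p < n.-1 - j.-1 < n)%N by lia.
  case=> [[q [Hq Hb Hk]]|/(_ _ Hj1)]; last by rewrite leNgt Hjp.
  right; apply: (bigW th Hb); rewrite lerD2l lerN2; apply: S4'; first lia.
  rewrite leqNgt; apply/negP => Hqj.
  have [E|Hne] := eqVneq q (n.-1 - j.-1)%N; first by move: (big_gt0 th Hb); rewrite E; lra.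
  by have := Hk (n.-1 - j.-1)%N ltac:(lia); rewrite leNgt Hjp.
case=> [Hj|Hb]; first by right=> k Hk; apply: S2'; lia.
left; exists (n.-1 - y)%N; rewrite -S6; split=> //; last by move=> k Hk; apply: S2'; lia.
apply/andP; split; last lia.
rewrite ltn_neqAle; apply/andP; split; last lia.
by apply/eqP => E; move: (big_gt0 th Hb); rewrite S6 -E subrr ltxx.
Qed.

Lemma combine_max big g p j m j' m' : threshold big -> (p < n)%N ->
  scanned true g p j m -> scanned false (fun i => g (n.-1 - i)%N) (n.-1 - p) j' m' ->
  big (combine j j' (g p - m) (g p - m')) <-> is_max n big g p.
Proof.
move=> th Hp SL SR.
have HL := left_scanned th SL; have HR := right_scanned th Hp SR.
have [_ _ _ L4 [y [L5 L6]]] := SL; have [_ _ _ R4 [z [R5 R6]]] := SR.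
have EL : big (g p - m) -> exists q, (q < n)%N /\ big (g p - g q).
  by move=> H; exists y; rewrite -L6; split=> //; lia.
have ER : big (g p - m') -> exists q, (q < n)%N /\ big (g p - g q).
  by move=> H; exists (n.-1 - z)%N; rewrite -R6; split=> //; lia.
have EE : j = 0%N -> j' = 0%N -> (exists q, (q < n)%N /\ big (g p - g q)) ->
    big (g p - m) || big (g p - m').
  move=> Ej Ej' [q [Hq Hb]]; case: (leqP q p) => Hqp; apply/orP; [left|right].
    by apply: (bigW th Hb); rewrite lerD2l lerN2; apply: L4; lia.
  apply: (bigW th Hb); rewrite lerD2l lerN2; have := R4 (n.-1 - q)%N ltac:(lia).
  by rewrite (_ : (n.-1 - (n.-1 - q))%N = q) //; lia.
rewrite /combine !leqn0; case: eqP => Ej; case: eqP => Ej'; rewrite ?threshold_max ?threshold_min //; split.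
- move=> H; split; [by apply/HL; left|by apply/HR; left|].
  by case/orP: H.
- by case=> _ _; exact: EE.
- move=> H; split; [by apply/HL; left|by apply/HR; right|exact: ER].
- by case=> _ /HR [].
- move=> H; split; [by apply/HL; right|by apply/HR; left|exact: EL].
- by case=> /HL [].
- by move=> /andP [H1 H2]; split; [apply/HL; right|apply/HR; right|exact: EL].
- by case=> /HL [//|->] /HR [].
Qed.

Definition copy_f : cmd := For 4 0 (Blk [:: QLd 1 1 4; QSt 2 4 1]).
Definition save_left : cmd :=
  For 4 0 (Blk [:: OLd 5 0 4; OSt 1 4 5; QLd 1 2 4; QLd 2 3 4; QSub 1 1 2; QSt 4 4 1]).
Definition copy_rev_f : cmd :=
  For 4 0 (Blk [:: OSub 5 0 2; OSub 5 5 4; QLd 1 1 5; QSt 2 4 1]).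
(** Real register 0 is kept at 0, so adding it copies a register. *)
Definition combine_cmd : cmd :=
  If (TI 6 3) (If (TI 7 3) (If (TR 1 2) (Blk [:: QAdd 1 2 0]) (Blk [::])) (Blk [:: QAdd 1 2 0]))
    (If (TI 7 3) (Blk [::]) (If (TR 1 2) (Blk [::]) (Blk [:: QAdd 1 2 0]))).
(** The second scan runs on the reversed values, so its entry [i] belongs to the point [n.-1 - i],
    and the results of the first scan are read backwards. *)
Definition update_cost : cmd :=
  For 4 0 (Seq (Blk [:: OSub 5 0 2; OSub 5 5 4; OLd 6 1 5; QLd 1 4 5; OLd 7 0 4; QLd 2 2 4;
      QLd 3 3 4; QSub 2 2 3])
    (Seq combine_cmd
      (Seq (Blk [:: QLd 3 5 5]) (If (TR 3 1) (Blk [:: QSt 5 5 1]) (Blk [::]))))).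
Definition add_maxima : cmd :=
  Seq copy_f (Seq (scan true) (Seq save_left (Seq copy_rev_f (Seq (scan false) update_cost)))).

Definition ready s : Prop := [/\ hi s 0 = n, hi s 2 = 1%N, hi s 3 = 0%N & hr s 0 = 0].

Lemma ready_frame c s s' : ready s -> frame c s s' ->
  ~~ has (mem [:: 0; 2; 3]%N) (writes op_hi c) -> 0%N \notin writes op_hr c -> ready s'.
Proof.
move=> [r1 r2 r3 r4] [F1 F2 _ _] /hasPn H0 H3.
have H k : k \in [:: 0; 2; 3]%N -> k \notin writes op_hi c.
  by move=> Hk; apply/negP => /H0 /negP; apply.
by split; rewrite ?F1 ?F2 ?H.
Qed.

Lemma copy_f_ok s Q : ready s ->
  (forall s' t, frame copy_f s s' -> (forall i, (i < n)%N -> hb s' 2 i = hb s 1 i) ->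
    (t <= 20 * n + 3)%N -> Q s' t) -> wp copy_f s Q.
Proof.
move=> [r0 r2 _ _] HQ.
apply: (@wp_for_const _ _ _ _ _ _ (fun k s' => forall i, (i < k)%N -> hb s' 2 i = hb s 1 i) 20) => //.
  move=> k s' [_ _ _ F4]; rewrite r0 => Hk H4 HI.
  apply: wp_blk; rewrite /= H4 ?Hk //; split=> // i Hi.
  rewrite /aupd; case: eqP => [->|Hne]; first by rewrite F4.
  by apply: HI; lia.
by move=> s' t Hf; rewrite r0; exact: HQ.
Qed.

Lemma copy_rev_f_ok s Q : ready s ->
  (forall s' t, frame copy_rev_f s s' -> (forall i, (i < n)%N -> hb s' 2 i = hb s 1 (n.-1 - i)%N) ->
    (t <= 20 * n + 3)%N -> Q s' t) -> wp copy_rev_f s Q.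
Proof.
move=> [r0 r2 _ _] HQ.
apply: (@wp_for_const _ _ _ _ _ _ (fun k s' => forall i, (i < k)%N -> hb s' 2 i = hb s 1 (n.-1 - i)%N) 20) => //.
  move=> k s' [F1 _ _ F4]; rewrite r0 => Hk H4 HI.
  have E2 : hi s' 2 = 1%N by rewrite F1.
  have E0 : hi s' 0 = n by rewrite F1.
  have Hn : (n - 1 - k < n)%N by lia.
  apply: wp_blk; rewrite /= H4 E0 E2 ?Hk ?Hn //; split=> // i Hi.
  rewrite /aupd; case: eqP => [->|Hne]; first by rewrite F4 // subn1.
  by apply: HI; lia.
by move=> s' t Hf; rewrite r0; exact: HQ.
Qed.

Lemma save_left_ok s Q : ready s ->
  (forall s' t, frame save_left s s' ->
     (forall i, (i < n)%N -> ha s' 1 i = ha s 0 i /\ hb s' 4 i = hb s 2 i - hb s 3 i) ->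
    (t <= 40 * n + 3)%N -> Q s' t) -> wp save_left s Q.
Proof.
move=> [r0 r2 _ _] HQ.
apply: (@wp_for_const _ _ _ _ _ _ (fun k s' => forall i, (i < k)%N ->
  ha s' 1 i = ha s 0 i /\ hb s' 4 i = hb s 2 i - hb s 3 i) 40) => //.
  move=> k s' [_ _ F3 F4]; rewrite r0 => Hk H4 HI.
  apply: wp_blk; rewrite /= H4 ?Hk //; split=> // i Hi.
  rewrite /aupd; case: eqP => [->|Hne]; first by rewrite F3 // !F4.
  by apply: HI; lia.
by move=> s' t Hf; rewrite r0; exact: HQ.
Qed.

Lemma combine_cmd_ok s Q : hi s 3 = 0%N -> hr s 0 = 0 ->
  (forall s' t, frame combine_cmd s s' ->
    hr s' 1 = combine (hi s 6) (hi s 7) (hr s 1) (hr s 2) -> (t <= 8)%N -> Q s' t) ->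
  wp combine_cmd s Q.
Proof.
move=> E3 E0 HQ.
have H : wp combine_cmd s (fun s' t =>
    hr s' 1 = combine (hi s 6) (hi s 7) (hr s 1) (hr s 2) /\ (t <= 8)%N).
  apply: wp_if => /= H6; apply: wp_if => /= H7; rewrite E3 in H6 H7;
  rewrite /combine ?H6 ?(negPf H6) ?H7 ?(negPf H7); try apply: wp_if => /= Hr;
  apply: wp_blk => //=; rewrite ?E0 ?addr0; split=> //; move: Hr; case: leP => // *; exfalso; lra.
by apply: wp_frame H _ => s' t Hf [H1 H2]; exact: HQ.
Qed.

Lemma update_cost_ok s Q : ready s ->
  (forall s' t, frame update_cost s s' ->
     (forall i, (i < n)%N -> hb s' 5 (n.-1 - i)%N = Num.max (hb s 5 (n.-1 - i)%N)
        (combine (ha s 1 (n.-1 - i)%N) (ha s 0 i) (hb s 4 (n.-1 - i)%N) (hb s 2 i - hb s 3 i))) ->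
    (t <= 80 * n + 3)%N -> Q s' t) -> wp update_cost s Q.
Proof.
move=> [r0 r2 r3 r4] HQ.
apply: (@wp_for_const _ _ _ _ _ _ (fun k s' => (forall i, (i < k)%N ->
  hb s' 5 (n.-1 - i)%N = Num.max (hb s 5 (n.-1 - i)%N)
        (combine (ha s 1 (n.-1 - i)%N) (ha s 0 i) (hb s 4 (n.-1 - i)%N) (hb s 2 i - hb s 3 i))) /\
  (forall p, (p < n - k)%N -> hb s' 5 p = hb s 5 p)) 80) => //.
  move=> k s' [F1 F2 F3 F4]; rewrite r0 => Hk H4 [HI1 HI2].
  have E2 : hi s' 2 = 1%N by rewrite F1.
  have E0 : hi s' 0 = n by rewrite F1.
  have E3 : hi s' 3 = 0%N by rewrite F1.
  have Hn : (n - 1 - k < n)%N by lia.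
  have Enk : (n - 1 - k = n.-1 - k)%N by lia.
  apply: wp_seq; apply: wp_blk; first by rewrite /= H4 E0 E2 ?Hk ?Hn.
  apply: wp_seq; apply: combine_cmd_ok; rewrite /= ?E3 ?F2 //.
  rewrite H4 E0 E2 Enk => s1 t1 [G1 G2 G3 G4]; rewrite /= => H1 Ht1.
  have K4 : hi s1 4 = k by rewrite G1 //= H4.
  have K5 : hi s1 5 = (n.-1 - k)%N by rewrite G1 //= H4 E0 E2 Enk.
  have K2 : hi s1 2 = 1%N by rewrite G1.
  have Kb : hb s1 5 = hb s' 5 by rewrite G4.
  apply: wp_seq; apply: wp_blk; first by rewrite /= K5 -Enk Hn.
  rewrite !F3 // !F4 // in H1.
  have Eold : hb s' 5 (n.-1 - k)%N = hb s 5 (n.-1 - k)%N by apply: HI2; lia.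
  apply: wp_if => /= Hle; apply: wp_blk => //=; rewrite ?K5 ?Kb ?H1 -?Enk ?Hn //; rewrite ?Enk;
    rewrite /= K5 Kb Eold H1 in Hle; (split; last by lia); split=> i Hi.
  - rewrite /aupd; case: eqP => [E|Hne].
      have Eik : i = k by lia.
      by rewrite Eik; apply/esym/max_idPr.
    by apply: HI1; lia.
  - by rewrite /aupd; case: eqP => [E|Hne]; [lia|apply: HI2; lia].
  - have [->|Hne] := eqVneq i k; last by apply: HI1; lia.
    by rewrite Eold; apply/esym/max_idPl; move: Hle; rewrite -ltNge => /ltW.
  - by apply: HI2; lia.
by move=> s' t Hf; rewrite r0 => -[HI _]; exact: HQ.
Qed.

Lemma add_maxima_ok s Q : ready s -> 
  (forall s' t, frame add_maxima s s' ->
    (forall p, (p < n)%N -> exists v, hb s' 5 p = Num.max (hb s 5 p) v /\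
       forall big, threshold big -> big v <-> is_max n big (hb s 1) p) ->
    (t <= 800 * n + 50)%N -> Q s' t) -> wp add_maxima s Q.
Proof.
move=> Hr HQ.
suff H : wp add_maxima s (fun s' t =>
    (forall p, (p < n)%N -> exists v, hb s' 5 p = Num.max (hb s 5 p) v /\
       forall big, threshold big -> big v <-> is_max n big (hb s 1) p) /\ (t <= 800 * n + 50)%N).
  by apply: wp_frame H _ => s' t Hf [H1 H2]; exact: HQ.
apply: wp_seq; apply: copy_f_ok => // s1 t1 f1 H1 T1.
have r1 := ready_frame Hr f1 isT isT; have [a0 a2 a3 _] := r1.
apply: wp_seq; apply: scan_ok => // s2 t2 f2 H2 T2.
have r2 := ready_frame r1 f2 isT isT.
apply: wp_seq; apply: save_left_ok => // s3 t3 f3 H3 T3.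
have r3 := ready_frame r2 f3 isT isT.
apply: wp_seq; apply: copy_rev_f_ok => // s4 t4 f4 H4 T4.
have r4 := ready_frame r3 f4 isT isT; have [b0 b2 b3 _] := r4.
apply: wp_seq; apply: scan_ok => // s5 t5 f5 H5 T5.
have r5 := ready_frame r4 f5 isT isT.
apply: update_cost_ok => // s6 t6 f6 H6 T6.
split; last by clear -T1 T2 T3 T4 T5 T6; lia.
have [_ _ A1 B1] := f1; have [_ _ A2 B2] := f2; have [_ _ A3 B3] := f3.
have [_ _ A4 B4] := f4; have [_ _ A5 B5] := f5.
have Ef : hb s3 1 = hb s 1 by rewrite B3 // B2 // B1.
move=> p Hp; set i := (n.-1 - p)%N.
have Hi : (i < n)%N by rewrite /i; lia.
have Ei : (n.-1 - i)%N = p by rewrite /i; lia.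
have [C1 C2] := H3 p Hp.
have SL : scanned true (hb s 1) p (ha s5 1 p) (hb s2 3 p).
  rewrite A5 // A4 // C1; apply: scanned_eq (H2 p Hp) => k Hk; apply: H1; lia.
have SR : scanned false (fun i => hb s 1 (n.-1 - i)%N) i (ha s5 0 i) (hb s5 3 i).
  by apply: scanned_eq (H5 i Hi) => k Hk; rewrite H4 ?Ef //; lia.
exists (combine (ha s5 1 p) (ha s5 0 i) (hb s 1 p - hb s2 3 p) (hb s 1 p - hb s5 3 i)); split.
  have := H6 i Hi; rewrite Ei => ->; congr (Num.max _ (combine _ _ _ _)).
  - by rewrite B5 // B4 // B3 // B2 // B1.
  - by rewrite B5 // B4 // C2 B2 // H1.
  - by rewrite B5 // H4 // Ef Ei.
move=> big th; exact: combine_max.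
Qed.

End Persistence.

(** * Persistence of maxima and minima together *)

Section Costs.
Variables (R : realType) (n : nat).
Local Notation hst := (hst R).
Local Notation wp := (@wp R n).
Implicit Types (s : hst) (g : nat -> R).

Lemma is_max_eq big g g' p : (forall i, (i < n)%N -> g i = g' i) -> (p < n)%N ->
  is_max n big g p -> is_max n big g' p.
Proof.
move=> E Hp [L Rt [q [Hq Hb]]]; split; last by exists q; rewrite -!E.
  case: L => [[r [H1 H2 H3]]|H]; [left; exists r|right=> k Hk].
    split=> //; first by rewrite -!E //; lia.
    by move=> k Hk; rewrite -!E //; [exact: H3|lia].
  by rewrite -!E //; [exact: H|lia].
case: Rt => [[r [H1 H2 H3]]|H]; [left; exists r|right=> k Hk].
  split=> //; first by rewrite -!E //; lia.
  by move=> k Hk; rewrite -!E //; [exact: H3|lia].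
by rewrite -!E //; [exact: H|lia].
Qed.

Definition negate_f : cmd := For 4 0 (Blk [:: QLd 1 1 4; QSub 1 0 1; QSt 1 4 1]).

Lemma negate_f_ok s Q : ready n s ->
  (forall s' t, frame negate_f s s' -> (forall i, (i < n)%N -> hb s' 1 i = - hb s 1 i) ->
    (t <= 20 * n + 3)%N -> Q s' t) -> wp negate_f s Q.
Proof.
move=> [r0 r2 _ r4] HQ.
apply: (@wp_for_const _ _ _ _ _ _ (fun k s' => (forall i, (i < k)%N -> hb s' 1 i = - hb s 1 i) /\
   (forall i, (k <= i)%N -> hb s' 1 i = hb s 1 i)) 20) => //.
  move=> k s' [_ F2 _ F4]; rewrite r0 => Hk H4 [HI1 HI2].
  have E4 : hr s' 0 = 0 by rewrite F2.
  apply: wp_blk; rewrite /= H4 ?Hk //; split=> //; split=> i Hi; rewrite /aupd; case: eqP => [E|Hne].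
  - by rewrite E E4 sub0r HI2.
  - by apply: HI1; lia.
  - by lia.
  - by apply: HI2; lia.
by move=> s' t Hf; rewrite r0 => -[HI _]; exact: HQ.
Qed.

(** Minima are maxima of the negated values. Array 5 keeps the larger result, and the last negation
    restores the values of F. *)
Definition costs_cmd : cmd := Seq add_maxima (Seq negate_f (Seq add_maxima negate_f)).

Lemma costs_ok s f Q : ready n s -> (forall p, (p < n)%N -> hb s 5 p = 0) ->
  (forall i, (i < n)%N -> hb s 1 i = f i) ->
  (forall s' t, frame costs_cmd s s' -> persistence n f (hb s' 5) ->
    (forall p, (p < n)%N -> 0 <= hb s' 5 p) -> (forall i, (i < n)%N -> hb s' 1 i = f i) ->
    (t <= 1700 * n + 150)%N -> Q s' t) -> wp costs_cmd s Q.
Proof.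
move=> Hr H0 Hf HQ.
suff H : wp costs_cmd s (fun s' t => [/\ persistence n f (hb s' 5),
    forall p, (p < n)%N -> 0 <= hb s' 5 p, forall i, (i < n)%N -> hb s' 1 i = f i
    & (t <= 1700 * n + 150)%N]).
  by apply: wp_frame H _ => s' t Hfr [*]; exact: HQ.
apply: wp_seq; apply: add_maxima_ok => // s1 t1 f1 H1 T1.
have r1 := ready_frame Hr f1 isT isT.
apply: wp_seq; apply: negate_f_ok => // s2 t2 f2 H2 T2.
have r2 := ready_frame r1 f2 isT isT.
apply: wp_seq; apply: add_maxima_ok => // s3 t3 f3 H3 T3.
have r3 := ready_frame r2 f3 isT isT.
apply: negate_f_ok => // s4 t4 f4 H4 T4.
have [_ _ _ B1] := f1; have [_ _ _ B2] := f2; have [_ _ _ B3] := f3; have [_ _ _ B4] := f4.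
have E5 : hb s4 5 = hb s3 5 by rewrite B4.
have Ef i : (i < n)%N -> hb s2 1 i = - f i by move=> Hi; rewrite H2 // B1 // Hf.
have key p : (p < n)%N -> exists v w, [/\ hb s4 5 p = Num.max (Num.max 0 v) w,
    forall big, threshold big -> big v <-> is_max n big f p &
    forall big, threshold big -> big w <-> is_max n big (fun i => - f i) p].
  move=> Hp; have [v [Ev Hv]] := H1 p Hp; have [w [Ew Hw]] := H3 p Hp.
  exists v, w; split.
  - by rewrite E5 Ew B2 // Ev H0.
  - move=> big th; split=> [/(Hv big th)|H]; first exact: is_max_eq.
    by apply/(Hv big th); apply: is_max_eq H => // i Hi; rewrite Hf.
  - move=> big th; split=> [/(Hw big th)|H]; first exact: is_max_eq.
    by apply/(Hw big th); apply: is_max_eq H => // i Hi; rewrite Ef.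
split; last by clear -T1 T2 T3 T4; lia.
- move=> p big Hp th; have [v [w [-> Hv Hw]]] := key p Hp.
  rewrite !threshold_max // (negPf (proj2 th)) /=; split.
    by case/orP => [/(Hv big th)|/(Hw big th)] H; [exists true|exists false].
  by move=> [[/(Hv big th) -> //|/(Hw big th) ->]]; rewrite orbT.
- by move=> p Hp; have [v [w [-> _ _]]] := key p Hp; rewrite !le_max lexx.
- by move=> i Hi; rewrite H4 // B3 // Ef // opprK.
Qed.

End Costs.

(** * Sorting by persistence *)

Section Segments.
Local Open Scope nat_scope.
Implicit Types A B : nat -> nat.

Definition seg A l h : seq nat := [seq A i | i <- iota l (h - l)].

Lemma seg_nil A l h : h <= l -> seg A l h = [::].
Proof. by rewrite -subn_eq0 /seg => /eqP ->. Qed.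

Lemma seg_cons A l h : l < h -> seg A l h = A l :: seg A l.+1 h.
Proof. by move=> H; rewrite /seg (_ : h - l = (h - l.+1).+1) //; lia. Qed.

Lemma seg_cat A l m h : l <= m <= h -> seg A l h = seg A l m ++ seg A m h.
Proof.
move=> H; rewrite /seg (_ : h - l = (m - l) + (h - m)); last by lia.
by rewrite iotaD map_cat (_ : l + (m - l) = m) //; lia.
Qed.

Lemma seg_rcons A l h v : l <= h -> seg (aupd A h v) l h.+1 = rcons (seg A l h) v.
Proof.
move=> H; rewrite (@seg_cat _ l h) ?H ?leqnSn // (seg_cons _ (ltnSn h)) (seg_nil _ (leqnn h.+1)) cats1.
rewrite {2}/aupd eqxx; congr rcons; apply/eq_in_map => i; rewrite mem_iota /aupd.
by case: eqP => // E; lia.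
Qed.

Lemma seg_eq A B l h : (forall i, l <= i < h -> A i = B i) -> seg A l h = seg B l h.
Proof. by move=> H; apply/eq_in_map => i; rewrite mem_iota => Hi; apply: H; lia. Qed.

Lemma size_seg A l h : size (seg A l h) = h - l.
Proof. by rewrite size_map size_iota. Qed.

Lemma nth_seg A h i : i < h -> nth 0 (seg A 0 h) i = A i.
Proof. by move=> H; rewrite /seg subn0 (nth_map 0) ?size_iota // nth_iota. Qed.

Lemma seg_id h A : (forall i, i < h -> A i = i) -> seg A 0 h = iota 0 h.
Proof.
by move=> H; rewrite /seg subn0 -[RHS]map_id; apply/eq_in_map => i; rewrite mem_iota => /= /H.
Qed.

End Segments.

(** * Bottom-up merge sort *)

Section Sort.
Variables (R : realType) (n : nat).
Local Notation hst := (hst R).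
Local Notation wp := (@wp R n).
Implicit Types (s : hst) (cost : nat -> R).

Lemma cost_order_total cost : total (cost_order cost).
Proof. by move=> x y; rewrite /cost_order; case: ltgtP => //= _; exact: leq_total. Qed.

(** Register 15 is 1 for the left run and 0 for the right one. Equal persistences are recognized by
    two opposite comparisons, as [<=] is the only test on reals. *)
Definition choose_side : cmd :=
  If (TI 10 12) (Blk [:: OConst 15 0]) (If (TI 11 13) (Blk [:: OConst 15 1])
   (Seq (Blk [:: OLd 16 2 12; OLd 17 2 13; QLd 1 5 16; QLd 2 5 17])
     (If (TR 1 2) (If (TR 2 1) (If (TI 16 17) (Blk [:: OConst 15 1]) (Blk [:: OConst 15 0]))
        (Blk [:: OConst 15 0])) (Blk [:: OConst 15 1])))).
Definition merge_step : cmd :=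
  Seq choose_side (If (TI 2 15)
    (Blk [:: OLd 16 2 12; OSt 3 14 16; OAdd 12 12 2; OAdd 14 14 2])
    (Blk [:: OLd 16 2 13; OSt 3 14 16; OAdd 13 13 2; OAdd 14 14 2])).
Definition merge_cmd : cmd :=
  Seq (Blk [:: OAdd 12 9 3; OAdd 13 10 3; OAdd 14 9 3]) (Until (TI 11 14) merge_step).

Lemma choose_side_ok s Q : (hi s 10 <= n)%N -> (hi s 11 <= n)%N ->
  (forall i, (i < n)%N -> (ha s 2 i < n)%N) ->
  (forall s' t, frame choose_side s s' ->
    hi s' 15 = ((hi s 12 < hi s 10) && ((hi s 11 <= hi s 13) ||
       cost_order (hb s 5) (ha s 2 (hi s 12)) (ha s 2 (hi s 13))))%N :> nat ->
    (t <= 40)%N -> Q s' t) -> wp choose_side s Q.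
Proof.
move=> H10 H11 HA HQ.
suff H : wp choose_side s (fun s' t =>
   hi s' 15 = ((hi s 12 < hi s 10) && ((hi s 11 <= hi s 13) ||
       cost_order (hb s 5) (ha s 2 (hi s 12)) (ha s 2 (hi s 13))))%N :> nat /\ (t <= 40)%N).
  by apply: wp_frame H _ => s' t Hf [H1 H2]; exact: HQ.
apply: wp_if => /= Hi; first by apply: wp_blk => //=; rewrite ltnNge Hi.
rewrite -ltnNge in Hi; rewrite Hi.
apply: wp_if => /= Hj; first by apply: wp_blk => //=; rewrite Hj.
rewrite (negPf Hj); rewrite -ltnNge in Hj.
have Hi' : (hi s 12 < n)%N by exact: leq_trans Hi H10.
have Hj' : (hi s 13 < n)%N by exact: leq_trans Hj H11.
apply: wp_seq; apply: wp_blk; first by rewrite /= Hi' Hj' !HA.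
rewrite /cost_order /=; apply: wp_if => /= H1; last first.
  by apply: wp_blk => //=; rewrite ltNge H1.
rewrite ltNge H1 /=; apply: wp_if => /= H2; last first.
  by apply: wp_blk => //=; rewrite eq_le H1 (negPf H2).
rewrite eq_le H1 H2 /=.
by apply: wp_if => /= H3; apply: wp_blk => //=; rewrite ?H3 ?(negPf H3).
Qed.

Lemma merge_cons (T : eqType) (leT : rel T) x u y v : merge leT (x :: u) (y :: v) =
  if leT x y then x :: merge leT u (y :: v) else y :: merge leT (x :: u) v.
Proof. by []. Qed.

Lemma merge_nil (T : eqType) (leT : rel T) u : merge leT u [::] = u.
Proof. by case: u. Qed.

(** Phrased by the work left: what is written, followed by the merge of the two remainders, is
    always the final result. *)
Definition merge_inv cost A B0 lo mid hi0 s : Prop :=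
  [/\ [/\ (lo <= hi s 12 <= mid)%N, (mid <= hi s 13 <= hi0)%N &
       (hi s 14 + mid = hi s 12 + hi s 13)%N],
      seg (ha s 3) lo (hi s 14) ++
        merge (cost_order cost) (seg A (hi s 12) mid) (seg A (hi s 13) hi0) =
      merge (cost_order cost) (seg A lo mid) (seg A mid hi0)
    & forall i, (i < lo)%N -> ha s 3 i = B0 i].

Lemma merge_ok s Q : hi s 2 = 1%N -> hi s 3 = 0%N ->
  (hi s 9 <= hi s 10 <= hi s 11)%N -> (hi s 11 <= n)%N ->
  (forall i, (i < n)%N -> (ha s 2 i < n)%N) ->
  (forall s' t, frame merge_cmd s s' ->
    seg (ha s' 3) (hi s 9) (hi s 11) = merge (cost_order (hb s 5))
       (seg (ha s 2) (hi s 9) (hi s 10)) (seg (ha s 2) (hi s 10) (hi s 11)) ->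
    (forall i, (i < hi s 9)%N -> ha s' 3 i = ha s 3 i) ->
    (t <= 80 * (hi s 11 - hi s 9) + 5)%N -> Q s' t) -> wp merge_cmd s Q.
Proof.
move=> E2 E3 Hlh Hhn HA HQ.
suff H : wp merge_cmd s (fun s' t => [/\
    seg (ha s' 3) (hi s 9) (hi s 11) = merge (cost_order (hb s 5))
       (seg (ha s 2) (hi s 9) (hi s 10)) (seg (ha s 2) (hi s 10) (hi s 11)),
    (forall i, (i < hi s 9)%N -> ha s' 3 i = ha s 3 i) &
    (t <= 80 * (hi s 11 - hi s 9) + 5)%N]).
  by apply: wp_frame H _ => s' t Hf [H1 H2 H3]; exact: HQ.
apply: wp_seq; apply: wp_blk => //=; rewrite !E3 !addn0.
set s0 := Hst _ _ _ _.
apply: (@wp_until _ _ _ _ _ (merge_inv (hb s 5) (ha s 2) (ha s 3) (hi s 9) (hi s 10) (hi s 11))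
  (fun s' => 80 * (hi s 11 - hi s' 14))%N).
- split=> //=; first by rewrite !leqnn; split; lia.
  by rewrite seg_nil.
- move=> s1 [F1 F2 F3 F4] [[I1 I2 I3] I4 I5]; rewrite /= (F1 11%N) //= -ltnNge => Hk.
  have e2 : hi s1 2 = 1%N by rewrite F1.
  have e10 : hi s1 10 = hi s 10 by rewrite F1.
  have e11 : hi s1 11 = hi s 11 by rewrite F1.
  have eA : ha s1 2 = ha s 2 by rewrite F3.
  have eC : hb s1 5 = hb s 5 by rewrite F4.
  apply: wp_seq; apply: choose_side_ok; rewrite ?e10 ?e11 ?eA //; first lia.
  rewrite eC => s2 t2 [G1 G2 G3 G4] Hfl Ht2.
  have h2 : hi s2 2 = 1%N by rewrite G1.
  have h12 : hi s2 12 = hi s1 12 by rewrite G1.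
  have h13 : hi s2 13 = hi s1 13 by rewrite G1.
  have h14 : hi s2 14 = hi s1 14 by rewrite G1.
  have hA : ha s2 2 = ha s 2 by rewrite G3.
  have hB : ha s2 3 = ha s1 3 by rewrite G3.
  have Hkn : (hi s1 14 < n)%N by lia.
  have Hlk : (hi s 9 <= hi s1 14)%N by lia.
  have Hold v i : (i < hi s 9)%N -> aupd (ha s2 3) (hi s1 14) v i = ha s 3 i.
    by move=> Hi; rewrite hB /aupd; case: eqP => [E|_]; [lia|exact: I5].
  apply: wp_if => /=; rewrite h2 Hfl lt0b => Hc; apply: wp_blk;
    rewrite /= ?h12 ?h13 ?h14 ?h2 ?hA ?hB ?addn1 ?Hkn ?andbT /=.
  + by move/andP: Hc => [? _]; lia.
  + move/andP: Hc => [Hc1 Hc2]; split; last by lia.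
    split=> /=; [by rewrite ?h12 ?h13 ?h14; split; lia| |exact: Hold].
    rewrite h13 hB seg_rcons // -I4 cat_rcons (seg_cons _ Hc1); congr (_ ++ _).
    case: (leqP (hi s 11) (hi s1 13)) Hc2 => /= [Hj _|Hj Ho].
      by rewrite (seg_nil _ Hj) !merge_nil.
    by rewrite (seg_cons _ Hj) merge_cons Ho.
  + by move: Hc; rewrite negb_and -leqNgt => /orP [?|]; [|rewrite negb_or -ltnNge]; lia.
  + split; last by lia.
    have Hj : (hi s1 13 < hi s 11)%N.
      by move: Hc; rewrite negb_and -leqNgt => /orP [?|/norP [? _]]; lia.
    split=> /=; [by rewrite ?h12 ?h13 ?h14; split; lia| |exact: Hold].
    rewrite h12 hB seg_rcons // -I4 cat_rcons (seg_cons _ Hj); congr (_ ++ _).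
    case: (ltnP (hi s1 12) (hi s 10)) Hc => /= [Hi|Hi _].
      by rewrite (leqNgt (hi s 11)) Hj /= (seg_cons _ Hi) merge_cons => /negPf ->.
    by rewrite (seg_nil _ Hi).
- move=> s1 t1 [F1 _ _ _] [[I1 I2 I3] I4 I5]; rewrite /= (F1 11%N) //= => Hk Ht.
  have Ek : hi s1 14 = hi s 11 by lia.
  split=> //; last by move: Ht; rewrite Ek; lia.
  have E12 : hi s1 12 = hi s 10 by lia.
  have E13 : hi s1 13 = hi s 11 by lia.
  by rewrite -I4 Ek E12 E13 (seg_nil _ (leqnn (hi s 10))) (seg_nil _ (leqnn (hi s 11))) cats0.
Qed.

Definition sort_pass : cmd :=
  Seq (Blk [:: OConst 9 0]) (Until (TI 0 9)
    (Seq (Blk [:: OAdd 10 9 8]) (Seq (If (TI 0 10) (Blk [:: OAdd 10 0 3]) (Blk [::]))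
      (Seq (Blk [:: OAdd 11 10 8]) (Seq (If (TI 0 11) (Blk [:: OAdd 11 0 3]) (Blk [::]))
        (Seq merge_cmd (Blk [:: OAdd 9 11 3]))))))).

(** Blocks are cut off at [n] and may be empty, so [n] need not be a multiple of the width. *)
Definition blocks_sorted cost w A : Prop :=
  forall q, sorted (cost_order cost) (seg A (q * w) (minn (q * w + w) n)).


Lemma wp_cap r s Q : hi s 0 = n -> hi s 3 = 0%N ->
  (forall s' t, frame (Blk [:: OAdd r 0 3]) s s' -> hi s' r = minn (hi s r) n ->
    (t <= 3)%N -> Q s' t) ->
  wp (If (TI 0 r) (Blk [:: OAdd r 0 3]) (Blk [::])) s Q.
Proof.
move=> E0 E3 HQ; apply: wp_if => /=; rewrite E0 => H; apply: wp_blk => //; apply: HQ => //=.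
- exact: (frame_blk [:: OAdd r 0 3]).
- by rewrite eqxx E0 E3 addn0; lia.
- by lia.
Qed.

Lemma sort_pass_ok w s Q : ready n s -> hi s 8 = w -> (0 < w)%N ->
  (forall i, (i < n)%N -> (ha s 2 i < n)%N) -> blocks_sorted (hb s 5) w (ha s 2) ->
  (forall s' t, frame sort_pass s s' -> blocks_sorted (hb s 5) (w + w) (ha s' 3) ->
    perm_eq (seg (ha s' 3) 0 n) (seg (ha s 2) 0 n) -> (t <= 120 * n + 10)%N -> Q s' t) ->
  wp sort_pass s Q.
Proof.
move=> [E0 E2 E3 _] E8 Hw HA Hbl HQ.
suff H : wp sort_pass s (fun s' t => [/\ blocks_sorted (hb s 5) (w + w) (ha s' 3),
    perm_eq (seg (ha s' 3) 0 n) (seg (ha s 2) 0 n) & (t <= 120 * n + 10)%N]).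
  by apply: wp_frame H _ => s' t Hf [*]; exact: HQ.
apply: wp_seq; apply: wp_blk => //=; set s0 := Hst _ _ _ _.
pose I (s' : hst) := exists q, [/\ hi s' 9 = minn (q * (w + w)) n,
  forall q', (q' < q)%N -> sorted (cost_order (hb s 5))
    (seg (ha s' 3) (q' * (w + w)) (minn (q' * (w + w) + (w + w)) n)) &
  perm_eq (seg (ha s' 3) 0 (hi s' 9)) (seg (ha s 2) 0 (hi s' 9))].
apply: (@wp_until _ _ _ _ _ I (fun s' => 120 * (n - hi s' 9))%N).
- by exists 0%N; split=> //=; rewrite mul0n min0n.
- move=> s1 [F1 F2 F3 F4] [q [Hq9 Hq Hperm]]; rewrite /= (F1 0%N) //= E0 -ltnNge => Hlt.
  have e0 : hi s1 0 = n by rewrite F1.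
  have e2 : hi s1 2 = 1%N by rewrite F1.
  have e3 : hi s1 3 = 0%N by rewrite F1.
  have e8 : hi s1 8 = w by rewrite F1.
  have eA : ha s1 2 = ha s 2 by rewrite F3.
  have eC : hb s1 5 = hb s 5 by rewrite F4.
  set lo := hi s1 9 in Hq9 Hperm Hlt *.
  have Elo : lo = (q * (w + w))%N by move: Hq9 Hlt; rewrite /minn; case: ltnP; lia.
  apply: wp_seq; apply: wp_blk => //=; set sa := Hst _ _ _ _.
  apply: wp_seq; apply: wp_cap => // sb tb [fb1 _ fb3 fb4]; rewrite /= -/lo e8 => Hmid Tb.
  apply: wp_seq; apply: wp_blk => //=; set sc := Hst _ _ _ _.
  have c8 : hi sb 8 = w by rewrite fb1.
  apply: wp_seq; apply: wp_cap; [by rewrite /= fb1|by rewrite /= fb1|].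
  move=> sd td [fd1 _ fd3 fd4]; rewrite /sc /= Hmid c8 => Hhi Td.
  have Hb0 r : r \notin [:: 10; 11]%N -> hi sd r = hi s1 r.
    rewrite !inE negb_or => /andP [/negPf H1 /negPf H2].
    by rewrite fd1 /= ?inE ?H2 // fb1 /= ?inE ?H1.
  have hA : ha sd 2 = ha s 2 by rewrite fd3 //= fb3 //= eA.
  have hB : ha sd 3 = ha s1 3 by rewrite fd3 //= fb3.
  have hC : hb sd 5 = hb s 5 by rewrite fd4 //= fb4 //= eC.
  have h9 : hi sd 9 = lo by rewrite Hb0.
  have h10 : hi sd 10 = minn (lo + w) n by rewrite fd1.
  have h11 : hi sd 11 = minn (lo + (w + w)) n by rewrite Hhi; clear; lia.
  have h3 : hi sd 3 = 0%N by rewrite Hb0.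
  have Hlm : (lo <= minn (lo + w) n <= minn (lo + (w + w)) n)%N by clear -Hlt; lia.
  have Hhn : (minn (lo + (w + w)) n <= n)%N by exact: geq_minr.
  have Hlh : (lo < minn (lo + (w + w)) n)%N by rewrite leq_min; lia.
  apply: wp_seq; apply: merge_ok; rewrite ?h9 ?h10 ?h11 ?hA ?hB ?hC ?h3 //.
    by rewrite Hb0.
  move=> se te [fe1 _ fe3 fe4] Hmerge Hold Te.
  apply: wp_blk => //=; rewrite fe1 // h11 fe1 // h3 addn0.
  set h := minn _ n in h11 Hlm Hhn Hlh Hmerge Te *.
  split; last by lia.
  exists q.+1; split=> /=.
  + by rewrite /h Elo; congr minn; lia.
  + move=> q' Hq'; case: (ltnP q' q) => Hqq.
      rewrite (@seg_eq _ (ha s1 3)); first exact: Hq.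
      move=> i Hi; apply: Hold; have : (q' * (w + w) + (w + w) <= q * (w + w))%N.
        by rewrite -mulSnr leq_mul2r Hqq orbT.
      by move: Hi; rewrite leq_min; lia.
    have -> : q' = q by lia.
    rewrite -Elo -/h Hmerge; apply: merge_sorted; first exact: cost_order_total.
      have := Hbl (q + q)%N; rewrite (_ : ((q + q) * w)%N = lo) //; rewrite Elo; lia.
    have := Hbl (q + q).+1; rewrite (_ : ((q + q).+1 * w)%N = lo + w)%N; last by rewrite Elo; lia.
    rewrite -addnA -/h; case: (leqP (lo + w) n) => // Hc.
    by move=> _; rewrite seg_nil.
  + have Hl : (0 <= lo <= h)%N by rewrite (ltnW Hlh).
    rewrite !(seg_cat _ Hl) Hmerge; apply: perm_cat.
      by rewrite (@seg_eq _ (ha s1 3)) // => i Hi; apply: Hold.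
    by rewrite perm_merge -(seg_cat _ Hlm).
- move=> s1 t1 [F1 _ _ _] [q [Hq9 Hq Hperm]]; rewrite /= (F1 0%N) //= E0 => Hge Ht.
  have E9 : hi s1 9 = n by move: Hq9; rewrite /minn; case: ifP; lia.
  rewrite E9 in Hperm; split=> //; last by move: Ht; rewrite /= subn0; lia.
  move=> q'; case: (ltnP q' q) => Hqq; first exact: Hq.
  rewrite seg_nil //; have : (q * (w + w) <= q' * (w + w))%N by rewrite leq_mul2r Hqq orbT.
  by move: Hq9; rewrite E9 geq_min /minn; case: ifP; lia.
Qed.

Definition copy_back : cmd := For 4 0 (Blk [:: OLd 5 3 4; OSt 2 4 5]).
Definition init_perm : cmd := For 4 0 (Blk [:: OSt 2 4 4]).
Definition sort_cmd : cmd :=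
  Seq init_perm (Seq (Blk [:: OConst 8 1])
    (Until (TI 0 8) (Seq sort_pass (Seq copy_back (Blk [:: OAdd 8 8 8]))))).

Lemma copy_back_ok s Q : ready n s ->
  (forall s' t, frame copy_back s s' -> (forall i, (i < n)%N -> ha s' 2 i = ha s 3 i) ->
    (t <= 20 * n + 3)%N -> Q s' t) -> wp copy_back s Q.
Proof.
move=> [r0 r2 _ _] HQ.
apply: (@wp_for_const _ _ _ _ _ _ (fun k s' => forall i, (i < k)%N -> ha s' 2 i = ha s 3 i) 20) => //.
  move=> k s' [_ _ F3 _]; rewrite r0 => Hk H4 HI.
  apply: wp_blk; rewrite /= H4 ?Hk //; split=> // i Hi.
  rewrite /aupd; case: eqP => [->|Hne]; first by rewrite F3.
  by apply: HI; lia.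
by move=> s' t Hf; rewrite r0; exact: HQ.
Qed.

Lemma init_perm_ok s Q : ready n s ->
  (forall s' t, frame init_perm s s' -> (forall i, (i < n)%N -> ha s' 2 i = i) ->
    (t <= 20 * n + 3)%N -> Q s' t) -> wp init_perm s Q.
Proof.
move=> [r0 r2 _ _] HQ.
apply: (@wp_for_const _ _ _ _ _ _ (fun k s' => forall i, (i < k)%N -> ha s' 2 i = i) 20) => //.
  move=> k s' _; rewrite r0 => Hk H4 HI.
  apply: wp_blk; rewrite /= H4 ?Hk //; split=> // i Hi.
  by rewrite /aupd; case: eqP => [->|Hne] //; apply: HI; lia.
by move=> s' t Hf; rewrite r0; exact: HQ.
Qed.

Lemma sort_ok s Q : ready n s -> (2 <= n)%N ->
  (forall s' t, frame sort_cmd s s' -> perm_eq (seg (ha s' 2) 0 n) (iota 0 n) ->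
    sorted (cost_order (hb s 5)) (seg (ha s' 2) 0 n) ->
    (t <= (180 * n + 60) * (trunc_log 2 n).+1)%N -> Q s' t) -> wp sort_cmd s Q.
Proof.
move=> Hr Hn HQ.
suff H : wp sort_cmd s (fun s' t => [/\ perm_eq (seg (ha s' 2) 0 n) (iota 0 n),
    sorted (cost_order (hb s 5)) (seg (ha s' 2) 0 n) & 
    (t <= (180 * n + 60) * (trunc_log 2 n).+1)%N]).
  by apply: wp_frame H _ => s' t Hf [*]; exact: HQ.
apply: wp_seq; apply: init_perm_ok => // s1 t1 f1 H1 T1.
have r1 := ready_frame Hr f1 isT isT.
apply: wp_seq; apply: wp_blk => //=; set s2 := Hst _ _ _ _.
have r2 : ready n s2 by case: r1.
have eC : hb s1 5 = hb s 5 by case: f1 => _ _ _ ->.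
(* Bounds one pass together with copying back, doubling the width and the loop test. *)
set M := (140 * n + 40)%N.
apply: (@wp_until _ _ _ _ _ (fun s' => exists k, [/\ hi s' 8 = (2 ^ k)%N,
   perm_eq (seg (ha s' 2) 0 n) (iota 0 n) & blocks_sorted (hb s 5) (2 ^ k) (ha s' 2)])
   (fun s' => M * ((trunc_log 2 n).+1 - trunc_log 2 (hi s' 8)))%N).
- exists 0%N; split=> //=; first by rewrite (seg_id H1).
  move=> q; rewrite expn0 muln1 addn1; case: (leqP q.+1 n) => Hq.
    by rewrite (seg_cons _ (ltnSn q)) (seg_nil _ (leqnn q.+1)).
  by rewrite seg_nil.
- move=> s' Hf [k [E8 Hperm Hbl]].
  have r' := ready_frame r2 Hf isT isT; have [a0 a2 a3 _] := r'.
  have cC : hb s' 5 = hb s 5 by case: Hf => _ _ _ ->.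
  rewrite /= a0 E8 -ltnNge => Hlt.
  have HA i : (i < n)%N -> (ha s' 2 i < n)%N.
    move=> Hi; have : ha s' 2 i \in seg (ha s' 2) 0 n.
      by rewrite -(nth_seg _ Hi); apply: mem_nth; rewrite size_seg subn0.
    by rewrite (perm_mem Hperm) mem_iota.
  apply: wp_seq; apply: (sort_pass_ok r' E8) => //; rewrite ?expn_gt0 ?cC // => s3 t3 f3 Hb3 Hp3 T3.
  have r3 := ready_frame r' f3 isT isT.
  apply: wp_seq; apply: copy_back_ok => // s4 t4 f4 H4 T4.
  have e8 : hi s4 8 = (2 ^ k)%N.
    by case: f4 => -> // _ _ _; case: f3 => -> //.
  have Eseg l h : (h <= n)%N -> seg (ha s4 2) l h = seg (ha s3 3) l h.
    by move=> Hh; apply: seg_eq => i Hi; apply: H4; lia.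
  apply: wp_blk => //=; rewrite e8; split.
    exists k.+1; split; first by rewrite /= expnS mul2n addnn.
      by rewrite /= Eseg // (perm_trans Hp3).
    move=> q /=; rewrite Eseg ?geq_minr //.
    by have := Hb3 q; rewrite expnS mul2n addnn.
  rewrite addnn -mul2n -expnS !trunc_expnK //.
  have Hk : (k <= trunc_log 2 n)%N by apply: trunc_log_max => //; exact: ltnW.
  rewrite (_ : (trunc_log 2 n).+1 - k = ((trunc_log 2 n).+1 - k.+1).+1)%N; last lia.
  by rewrite mulnS /M; lia.
- move=> s' t' Hf [k [E8 Hperm Hbl]].
  have [a0 _ _ _] := ready_frame r2 Hf isT isT.
  rewrite /= a0 E8 => Hge Ht; split=> //.
    by have := Hbl 0%N; rewrite mul0n add0n (minn_idPr Hge).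
  move: Ht; rewrite /= trunc_log1 subn0 => Ht.
  (* The initial filling is charged to the slack between [M] and the final bound, as 140 + 20 <= 180
     and 40 + 3 < 60. *)
  have HT1 : (t1 <= (20 * n + 3) * (trunc_log 2 n).+1)%N by nia.
  move: Ht; rewrite /M; nia.
Qed.

End Sort.

(** * Tables *)

Section Tables.
Variables (R : realType) (D : seq R) (F : R -> R).
Hypothesis domD : is_domain D.
Local Notation n := (size D).
Local Notation f := (fun i : nat => F D`_i).
Local Notation hst := (hst R).
Local Notation wp := (@wp R n).
Implicit Types (s : hst).

Definition main_array : cmd := For 4 0 (Blk [:: OLd 5 2 4; QLd 1 0 5; QSt 6 4 1]).

Lemma main_array_ok s Q : ready n s -> (forall i, (i < n)%N -> (ha s 2 i < n)%N) ->
  (forall s' t, frame main_array s s' -> (forall i, (i < n)%N -> hb s' 6 i = hb s 0 (ha s 2 i)) ->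
    (t <= 30 * n + 3)%N -> Q s' t) -> wp main_array s Q.
Proof.
move=> [r0 r2 _ _] HA HQ.
apply: (@wp_for_const _ _ _ _ _ _ (fun k s' => forall i, (i < k)%N -> hb s' 6 i = hb s 0 (ha s 2 i)) 30) => //.
  move=> k s' [_ _ F3 F4]; rewrite r0 => Hk H4 HI.
  apply: wp_blk; rewrite /= H4 F3 // ?Hk ?HA //; split=> // i Hi.
  rewrite /aupd; case: eqP => [->|Hne]; first by rewrite F4.
  by apply: HI; lia.
by move=> s' t Hf; rewrite r0; exact: HQ.
Qed.

Definition raise (a b : nat) : cmd := If (TR a b) (Blk [:: QAdd a b 0]) (Blk [::]).

Lemma raise_ok a b s Q : hr s 0 = 0 ->
  (forall s' t, frame (raise a b) s s' -> hr s' a = Num.max (hr s a) (hr s b) -> (t <= 3)%N -> Q s' t) ->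
  wp (raise a b) s Q.
Proof.
move=> E0 HQ; suff H : wp (raise a b) s (fun s' t => hr s' a = Num.max (hr s a) (hr s b) /\ (t <= 3)%N).
  by apply: wp_frame H _ => s' t Hf [*]; exact: HQ.
apply: wp_if => /= H; apply: wp_blk => //=; split=> //.
  by rewrite eqxx E0 addr0; apply/esym/max_idPr.
by apply/esym/max_idPl; move: H; rewrite -ltNge => /ltW.
Qed.

(** One pass suffices: the largest drop to the current point starts at the running maximum, the
    largest rise at the running minimum. *)
Definition swings_cmd : cmd :=
  Seq (Blk [:: QLd 10 1 3; QLd 11 1 3; QSub 11 0 11; QConst 12 0; QConst 13 0])
   (For 4 0 (Seq (Blk [:: QLd 1 1 4; QSub 2 0 1]) (Seq (raise 10 1) (Seq (raise 11 2)
     (Seq (Blk [:: QSub 3 10 1; QSub 4 11 2]) (Seq (raise 12 3) (raise 13 4))))))).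

(* [mx] and [- mn] are the maxima of [f] and [- f] seen so far. *)
Definition swings_inv k s : Prop :=
  [/\ (forall i, (i < k)%N -> f i <= hr s 10 /\ - f i <= hr s 11),
      (exists i, (i < k \/ i = 0)%N /\ hr s 10 = f i),
      (exists i, (i < k \/ i = 0)%N /\ hr s 11 = - f i),
      (forall a b, (a <= b < k)%N -> f a - f b <= hr s 12 /\ f b - f a <= hr s 13) &
      (exists a b, [/\ (a <= b < n)%N & hr s 12 = f a - f b]) /\
      (exists a b, [/\ (a <= b < n)%N & hr s 13 = f b - f a])].

Lemma swings_ok s Q : ready n s -> (forall i, (i < n)%N -> hb s 1 i = f i) ->
  (forall s' t, frame swings_cmd s s' -> swings_inv n s' ->
    (t <= 60 * n + 30)%N -> Q s' t) -> wp swings_cmd s Q.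
Proof.
move=> Hr Hf HQ; have Hn := dom_gt0 domD.
suff H : wp swings_cmd s (fun s' t => swings_inv n s' /\ (t <= 60 * n + 30)%N).
  by apply: wp_frame H _ => s' t Hfr [*]; exact: HQ.
have [r0 r2 r3 r4] := Hr.
apply: wp_seq; apply: wp_blk; first by rewrite /= r3 Hn.
rewrite /= r3 r4 sub0r Hf //; set s0 := Hst _ _ _ _.
apply: (@wp_for_const _ _ _ _ _ _ swings_inv 60) => //.
- split=> //=; try by exists 0%N; split=> //; right.
    by move=> a b; rewrite andbF.
  by split; exists 0%N, 0%N; rewrite subrr Hn.
- move=> k s' [F1 F2 F3 F4]; rewrite /= r0 => Hk H4 [I1 I2 I3 I4 [I5 I6]].
  have e0 : hr s' 0 = 0 by rewrite F2 //= r4.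
  have eb : hb s' 1 k = f k by rewrite F4 //= Hf.
  apply: wp_seq; apply: wp_blk; first by rewrite /= H4 Hk.
  rewrite /= H4 e0 sub0r eb.
  apply: wp_seq; apply: raise_ok => //= sa ta [_ fa _ _] Ha Ta.
  have a0 : hr sa 0 = 0 by rewrite fa //= e0.
  apply: wp_seq; apply: raise_ok => // sb tb [_ fb _ _] Hb Tb.
  rewrite !fa //= in Hb.
  have b0 : hr sb 0 = 0 by rewrite fb.
  have b1 : hr sb 1 = f k by rewrite fb // fa.
  have b2 : hr sb 2 = - f k by rewrite fb // fa.
  have b10 : hr sb 10 = Num.max (hr s' 10) (f k) by rewrite fb.
  have b12 : hr sb 12 = hr s' 12 by rewrite fb // fa.
  have b13 : hr sb 13 = hr s' 13 by rewrite fb // fa.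
  apply: wp_seq; apply: wp_blk => //=; rewrite b10 Hb b1 b2.
  apply: wp_seq; apply: raise_ok => //= sc tc [_ fc _ _]; rewrite b12 => Hc Tc.
  have c0 : hr sc 0 = 0 by rewrite fc //= b0.
  apply: raise_ok => // sd td [_ fd _ _]; rewrite !fc //= b13 => Hd Td.
  have d10 : hr sd 10 = Num.max (hr s' 10) (f k) by rewrite fd // fc.
  have d11 : hr sd 11 = Num.max (hr s' 11) (- f k) by rewrite fd // fc.
  have d12 : hr sd 12 = Num.max (hr s' 12) (Num.max (hr s' 10) (f k) - f k) by rewrite fd.
  split; last by clear -Ta Tb Tc Td; lia.
  rewrite /swings_inv /= d10 d11 d12 Hd; split.
  + move=> i Hi; rewrite !le_max; have [->|Hne] := eqVneq i k; first by rewrite !lexx !orbT.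
    by have [-> ->] := I1 i ltac:(clear -Hi Hne; lia).
  + have [i [Hi Ei]] := I2; case: (leP (hr s' 10) (f k)) => _; first by exists k; split=> //; left.
    by exists i; split=> //; case: Hi => Hi; [left; lia|right].
  + have [i [Hi Ei]] := I3; case: (leP (hr s' 11) (- f k)) => _; first by exists k; split=> //; left.
    by exists i; split=> //; case: Hi => Hi; [left; lia|right].
  + move=> a b Hab; rewrite !le_max; have [Eb|Hne] := eqVneq b k; last first.
      by have [-> ->] := I4 a b ltac:(clear -Hab Hne; lia).
    rewrite Eb; suff [H1 H2] : f a <= Num.max (hr s' 10) (f k) /\ - f a <= Num.max (hr s' 11) (- f k).
      by split; apply/orP; right; lra.
    rewrite !le_max; have [->|Hne] := eqVneq a k; first by rewrite !lexx !orbT.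
    by have [-> ->] := I1 a ltac:(clear -Hab Hne Eb; lia).
  + split.
      case: (leP (hr s' 12)) => _; last exact: I5.
      case: (leP (hr s' 10) (f k)) => _; first by exists k, k; rewrite leqnn Hk.
      have [i [Hi Ei]] := I2; exists i, k; rewrite -Ei Hk; split=> //.
      by case: Hi => Hi; rewrite ?Hi // ltnW.
    case: (leP (hr s' 13)) => _; last exact: I6.
    case: (leP (hr s' 11) (- f k)) => _; first by exists k, k; rewrite leqnn Hk opprK addrC.
    have [i [Hi Ei]] := I3; exists i, k; rewrite Ei opprK addrC Hk; split=> //.
    by case: Hi => Hi; rewrite ?Hi // ltnW.
- by move=> s' t _; rewrite /= r0 => HI Ht; split=> //; lia.
Qed.

(** The error is half the largest swing against the direction, or half the range if there is no
    direction. Register 20 is the prefix length for [b = 0]. *)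
Definition one_segment : cmd :=
  Seq (Blk [:: QLd 1 1 3; OSub 5 0 2; QLd 2 1 5; QConst 3 2; OConst 20 2])
   (Seq (If (TR 1 2) (If (TR 2 1) (Blk [:: QAdd 14 10 11; OConst 20 3]) (Blk [:: QAdd 14 12 0]))
     (Blk [:: QAdd 14 13 0])) (Blk [:: QDiv 14 14 3])).

Lemma one_segment_ok s Q : ready n s -> (forall i, (i < n)%N -> hb s 1 i = f i) -> swings_inv n s ->
  (forall s' t, frame one_segment s s' ->
    hr s' 14 = omafe D F (pts D [:: 0%N; n.-1]) -> hr s' 3 = 2 ->
    hr s' 1 = f 0 -> hr s' 2 = f n.-1 ->
    hi s' 20 = (if f 0 == f n.-1 then 3 else 2)%N ->
    (t <= 50)%N -> Q s' t) -> wp one_segment s Q.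
Proof.
move=> [r0 r2 r3 r4] Hf [I1 [i1 [Hi1 I2]] [i2 [Hi2 I3]] I4 [[a [b [Hab I5]]] [a' [b' [Hab' I6]]]]] HQ.
have Hn := dom_gt0 domD; have Hn1 : (n - 1 < n)%N by lia.
suff H : wp one_segment s (fun s' t => [/\ hr s' 14 = omafe D F (pts D [:: 0%N; n.-1]), hr s' 3 = 2,
    hr s' 1 = f 0 /\ hr s' 2 = f n.-1, hi s' 20 = (if f 0 == f n.-1 then 3 else 2)%N & (t <= 50)%N]).
  by apply: wp_frame H _ => s' t Hfr [? ? [? ?] ? ?]; exact: HQ.
apply: wp_seq; apply: wp_blk; first by rewrite /= r0 r2 r3 Hn Hn1.
rewrite /= r0 r2 r3 !Hf // subn1.
have Hdown : f 0 < f n.-1 -> omafe D F (pts D [:: 0%N; n.-1]) = hr s 12 / 2.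
  move=> Hlt; apply: (@omafe_one _ _ _ domD false); first by rewrite /flip ltrN2.
  split; last by exists a, b; split=> //; rewrite /flip I5; lra.
  by move=> u v Huv; have [H _] := I4 u v Huv; rewrite /flip; lra.
have Hup : f n.-1 < f 0 -> omafe D F (pts D [:: 0%N; n.-1]) = hr s 13 / 2.
  move=> Hlt; apply: (@omafe_one _ _ _ domD true) => //.
  split; last by exists a', b'; split=> //; rewrite /flip I6.
  by move=> u v Huv; have [_ H] := I4 u v Huv.
have Hflat : f 0 = f n.-1 -> omafe D F (pts D [:: 0%N; n.-1]) = (hr s 10 + hr s 11) / 2.
  move=> E; rewrite -[hr s 11]opprK; apply: omafe_one_flat => //.
  - by move=> i Hi; have [] := I1 i Hi; lra.
  - by exists i1; split=> //; case: Hi1 => [//|->].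
  - by exists i2; rewrite I3 opprK; split=> //; case: Hi2 => [//|->].
apply: wp_seq; apply: wp_if => /= H1; last first.
  apply: wp_blk => //=; apply: wp_blk => //=; rewrite r4 addr0; split=> //.
    by rewrite Hup // ltNge.
  by case: eqP H1 => // ->; rewrite lexx.
apply: wp_if => /= H2; apply: wp_blk => //=; apply: wp_blk => //=.
  have E : f 0 = f n.-1 by apply/le_anti; rewrite H1 H2.
  by rewrite E eqxx; split=> //; rewrite Hflat.
rewrite r4 addr0; split=> //; first by rewrite Hdown // ltNge.
by case: eqP H2 => // ->; rewrite lexx.
Qed.

(** For the case of exactly two extrema, registers 21 and 22 hold prefix length and array base for K
    = 2, and 23 the length for larger K. With n = 2 there is no third point to read. *)
Definition flags_cmd : cmd :=
  Seq (Blk [:: OConst 21 2; OAdd 22 24 3; OConst 23 2; OConst 27 2])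
   (If (TI 0 27) (Blk [::])
     (Seq (Blk [:: OLd 6 2 3; OLd 7 2 2; OLd 8 2 27; QLd 4 1 6; QLd 5 1 7; QSub 5 5 4;
                   QSub 4 2 1; QMul 4 4 5])
       (If (TR 4 0)
         (Seq (Blk [:: OConst 21 3; OAdd 22 25 3; OConst 23 3; OSub 9 0 2; QLd 4 0 3; QSt 7 3 4;
                       QLd 4 0 7; QSt 7 2 4; QLd 4 0 9; QSt 7 27 4])
           (If (TI 8 6) (Blk [::]) (If (TI 7 8) (Blk [::]) (Blk [:: OConst 23 4]))))
         (Blk [::])))).

Section Sorted.
Variables (cost : nat -> R) (sg : seq nat).
Local Notation cs := (cs cost sg).
Local Notation agreeF := (agree D F sg).
Local Notation "'s_ i" := (nth 0%N sg i) (at level 8, i at level 2, format "''s_' i").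

Definition flags_set s : Prop :=
  [/\ hi s 21 = (if agreeF then 2 else 3)%N,
      hi s 22 = (if agreeF then hi s 24 else hi s 25),
      hi s 23 = (if agreeF then 2 else if ('s_0 < 's_2 < 's_1) then 4 else 3)%N &
      ~~ agreeF -> [/\ hb s 7 0 = D`_0, hb s 7 1 = D`_('s_1) & hb s 7 2 = D`_n.-1]].

Lemma flags_ok s Q : ready n s -> (forall i, (i < n)%N -> hb s 1 i = f i) ->
  (forall i, (i < n)%N -> hb s 0 i = D`_i) ->
  (forall i, (i < n)%N -> ha s 2 i = 's_i) -> (forall i, (i < n)%N -> ('s_i < n)%N) ->
  hr s 1 = f 0 -> hr s 2 = f n.-1 ->
  (forall s' t, frame flags_cmd s s' -> ((2 < n)%N -> flags_set s') -> hi s' 27 = 2 ->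
    (t <= 120)%N -> Q s' t) -> wp flags_cmd s Q.
Proof.
move=> [r0 r2 r3 r4] Hf HD Hs Hsn E1 E2 HQ.
suff H : wp flags_cmd s (fun s' t => [/\ (2 < n)%N -> flags_set s', hi s' 27 = 2 & (t <= 120)%N]).
  by apply: wp_frame H _ => s' t Hfr [*]; exact: HQ.
apply: wp_seq; apply: wp_blk => //=; rewrite r3 addn0.
apply: wp_if => /=; rewrite r0 => Hn.
  by apply: wp_blk => //=; split=> //; move: Hn; case: ltngtP.
rewrite -ltnNge in Hn.
have Hn1 : (1 < n)%N := ltnW Hn; have Hn0 : (0 < n)%N := ltnW Hn1.
have Hl : (n - 1 < n)%N by lia.
apply: wp_seq; apply: wp_blk.
  by rewrite /= r3 r2 Hn Hn0 Hn1 !Hs // !Hsn.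
rewrite /= r3 r2 !Hs // !Hf ?Hsn // E1 E2.
set st := Hst _ _ _ _.
apply: wp_if => /=; rewrite r4 => Ha.
  have Na : agreeF = false by rewrite /agree ltNge Ha.
  apply: wp_seq; apply: wp_blk; first by rewrite /= r0 r2 r3 Hn Hn0 Hn1 Hl Hsn.
  rewrite /= r0 r2 r3 subn1 addn0 !HD ?Hsn //; last by rewrite -subn1.
  have X0 u v w (h : nat -> R) : aupd (aupd (aupd h 0 u) 1 v) 2 w 0 = u by [].
  have X1 u v w (h : nat -> R) : aupd (aupd (aupd h 0 u) 1 v) 2 w 1 = v by [].
  have X2 u v w (h : nat -> R) : aupd (aupd (aupd h 0 u) 1 v) 2 w 2 = w by [].
  apply: wp_if => /= H8.
    apply: wp_blk => //=; split=> // _; rewrite /flags_set /= Na X0 X1 X2; split=> //.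
    by rewrite ltnNge H8.
  rewrite -ltnNge in H8.
  apply: wp_if => /= H7.
    apply: wp_blk => //=; split=> // _; rewrite /flags_set /= Na X0 X1 X2; split=> //.
    by rewrite H8 ltnNge H7.
  rewrite -ltnNge in H7.
  apply: wp_blk => //=; split=> // _; rewrite /flags_set /= Na X0 X1 X2; split=> //.
  by rewrite H8 H7.
apply: wp_blk => //=; split=> // _.
have Ya : agreeF = true by rewrite /agree ltNge Ha.
by rewrite /flags_set /= Ya; split.
Qed.

Definition lookup_cmd : cmd :=
  If (TI 26 3) (Blk [:: OAdd 10 20 3; OAdd 11 24 3])
    (If (TI 26 27) (If (TI 4 27) (Blk [:: OAdd 10 21 3; OAdd 11 22 3])
        (Blk [:: OAdd 10 23 3; OAdd 11 24 3]))
      (Blk [:: OAdd 10 26 3; OAdd 11 24 3])).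

(** Register 26 follows the last strict drop. Past the last point the value 0 is used, in agreement
    with [cs n = 0]. *)
Definition table_cmd : cmd :=
  Seq (Blk [:: OConst 26 0])
   (For 4 0 (Seq (Blk [:: OLd 5 2 4; QLd 1 5 5; OAdd 6 4 2])
     (Seq (If (TI 0 6) (Blk [:: QConst 2 0]) (Blk [:: OLd 7 2 6; QLd 2 5 7]))
       (Seq (If (TR 1 2) (Blk [::]) (Blk [:: OAdd 26 6 3]))
         (Seq lookup_cmd (Blk [:: OSt 4 4 10; OSt 5 4 11; QDiv 2 2 3; QSt 8 4 2])))))).

Lemma lookup_ok s b Q : hi s 3 = 0%N -> hi s 26 = b -> hi s 27 = 2 -> (1 < hi s 4 < n)%N ->
  flags_set s -> hi s 20 = (if f 0 == f n.-1 then 3 else 2)%N ->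
  (forall s' t, frame lookup_cmd s s' -> hi s' 10 = position D F sg (hi s 4) b ->
    hi s' 11 = (if use_special D F sg (hi s 4) b then hi s 25 else hi s 24) ->
    (t <= 10)%N -> Q s' t) -> wp lookup_cmd s Q.
Proof.
move=> E3 E26 E27 HK [F21 F22 F23 _] E20 HQ.
suff H : wp lookup_cmd s (fun s' t => [/\ hi s' 10 = position D F sg (hi s 4) b,
    hi s' 11 = (if use_special D F sg (hi s 4) b then hi s 25 else hi s 24) & (t <= 10)%N]).
  by apply: wp_frame H _ => s' t Hfr [*]; exact: HQ.
rewrite /position /use_special.
apply: wp_if => /=; rewrite E26 E3 leqn0 => Hb.
  by apply: wp_blk => //=; rewrite E3 !addn0 E20 Hb (eqP Hb).
rewrite (negPf Hb) lt0n Hb /=.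
apply: wp_if => /=; rewrite E26 E27 => Hb2; last first.
  by apply: wp_blk => //=; rewrite E26 E3 !addn0 (negPf Hb2).
rewrite Hb2 /=; apply: wp_if => /=; rewrite E27 => HK2; apply: wp_blk => //=; rewrite E3 !addn0.
  by rewrite HK2 F21 F22 andbT; case: agreeF.
by rewrite (negPf HK2) F23 andbF; case: agreeF.
Qed.

Definition entry s K : Prop := (1 < K)%N -> exists b,
  [/\ last_boundary cost sg K b, ha s 4 K = position D F sg K b,
      ha s 5 K = (if use_special D F sg K b then hi s 25 else hi s 24) &
      hb s 8 K = cs K.+1 / 2].

(** At [K.+1] this is [last_boundary K]; the shift lets the loop start from 0. *)
Definition boundary_upto k b : Prop :=
  [/\ (b <= k)%N, (0 < b)%N -> cs b < cs b.-1 & forall i, (b < i <= k)%N -> ~~ (cs i < cs i.-1)].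

(** For [K <= 1] the entry is overwritten later or never read, so only the time of the lookup
    matters. *)
Lemma lookup_any s Q :
  (forall s' t, frame lookup_cmd s s' -> (t <= 10)%N -> Q s' t) -> wp lookup_cmd s Q.
Proof.
move=> HQ; suff H : wp lookup_cmd s (fun s' t => (t <= 10)%N).
  by apply: wp_frame H _ => s' t Hfr; exact: HQ.
by apply: wp_if => _; [apply: wp_blk | apply: wp_if => _; [apply: wp_if => _; apply: wp_blk|apply: wp_blk]].
Qed.

Lemma table_ok s Q : ready n s -> hi s 27 = 2 -> hr s 3 = 2 ->
  (forall i, (i < n)%N -> ha s 2 i = 's_i) -> (forall i, (i < n)%N -> ('s_i < n)%N) ->
  (forall i, (i < n)%N -> cs i = cost 's_i) -> cs n = 0 -> hb s 5 = cost ->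
  ((2 < n)%N -> flags_set s) -> hi s 20 = (if f 0 == f n.-1 then 3 else 2)%N ->
  (forall s' t, frame table_cmd s s' -> (forall K, (K < n)%N -> entry s' K) ->
    (t <= 100 * n + 10)%N -> Q s' t) -> wp table_cmd s Q.
Proof.
move=> [r0 r2 r3 r4] E27 Er3 Hs Hsn Hcs Hcsn Ec Hfl E20 HQ.
suff H : wp table_cmd s (fun s' t => (forall K, (K < n)%N -> entry s' K) /\ (t <= 100 * n + 10)%N).
  by apply: wp_frame H _ => s' t Hfr [*]; exact: HQ.
apply: wp_seq; apply: wp_blk => //=; set s0 := Hst _ _ _ _.
apply: (@wp_for_const _ _ _ _ _ _ (fun k s' => boundary_upto k (hi s' 26) /\
  forall K, (K < k)%N -> entry s' K) 100) => //.
- by split=> //; split=> //= i; lia.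
- move=> k s' [F1 F2 F3 F4]; rewrite /= r0 => Hk H4 [[B1 B2 B3] HE].
  have e0 : hi s' 0 = n by rewrite F1 //= r0.
  have e2 : hi s' 2 = 1%N by rewrite F1 //= r2.
  have e3 : hi s' 3 = 0%N by rewrite F1 //= r3.
  have e20 : hi s' 20 = hi s 20 by rewrite F1.
  have e21 : hi s' 21 = hi s 21 by rewrite F1.
  have e22 : hi s' 22 = hi s 22 by rewrite F1.
  have e23 : hi s' 23 = hi s 23 by rewrite F1.
  have e24 : hi s' 24 = hi s 24 by rewrite F1.
  have e25 : hi s' 25 = hi s 25 by rewrite F1.
  have e27 : hi s' 27 = 2 by rewrite F1 //= E27.
  have er3 : hr s' 3 = 2 by rewrite F2 //= Er3.
  have eA : forall i, (i < n)%N -> ha s' 2 i = 's_i by move=> i Hi; rewrite F3 //= Hs.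
  have eC : hb s' 5 = cost by rewrite F4.
  have e7 : hb s' 7 = hb s 7 by rewrite F4.
  apply: wp_seq; apply: wp_blk; first by rewrite /= H4 Hk eA // Hsn.
  rewrite /= H4 e2 eA // eC -Hcs // addn1; set s1 := Hst _ _ _ _.
  have Hnext : wp (If (TI 0 6) (Blk [:: QConst 2 0]) (Blk [:: OLd 7 2 6; QLd 2 5 7])) s1
      (fun s2 t => hr s2 2 = cs k.+1 /\ (t <= 20)%N).
    apply: wp_if => /=; rewrite e0 => Hk1.
      apply: wp_blk => //=; split=> //.
      by have -> : k.+1 = n by lia.
    rewrite -ltnNge in Hk1.
    by apply: wp_blk; rewrite /= ?Hk1 ?eA ?Hsn // eC Hcs.
  apply: wp_seq; apply: wp_frame Hnext _ => s2 t2 [G1 G2 G3 G4] [Hr2 T2].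
  have h6 : hi s2 6 = k.+1 by rewrite G1.
  have h26 : hi s2 26 = hi s' 26 by rewrite G1.
  have h3 : hi s2 3 = 0%N by rewrite G1.
  have h1 : hr s2 1 = cs k by rewrite G2.
  have Hb : wp (If (TR 1 2) (Blk [::]) (Blk [:: OAdd 26 6 3])) s2
      (fun s3 t => boundary_upto k.+1 (hi s3 26) /\ (t <= 5)%N).
    apply: wp_if => /=; rewrite h1 Hr2 => Hle; apply: wp_blk => //=; rewrite ?h26 ?h6 ?h3 ?addn0; split=> //.
      split=> //; first exact: leqW.
      move=> i Hi; have [->|Hne] := eqVneq i k.+1; first by rewrite -leNgt.
      by apply: B3; lia.
    by split=> // [_|i]; [rewrite ltNge|lia].
  apply: wp_seq; apply: wp_frame Hb _ => s3 t3 [K1 K2 K3 K4] [HB T3].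
  have i3 : hi s3 3 = 0%N by rewrite K1.
  have j k0 : k0 \in [:: 0; 2; 3; 20; 21; 22; 23; 24; 25; 27]%N -> hi s3 k0 = hi s' k0.
    by rewrite !inE => /or4P [/eqP ->|/eqP ->|/eqP ->|/or4P [/eqP ->|/eqP ->|/eqP ->|
      /or4P [/eqP ->|/eqP ->|/eqP ->|/eqP ->]]]; rewrite K1 // G1.
  have i4 : hi s3 4 = k by rewrite K1 // G1.
  have iA4 : ha s3 4 = ha s' 4 by rewrite K3 // G3.
  have iA5 : ha s3 5 = ha s' 5 by rewrite K3 // G3.
  have iB8 : hb s3 8 = hb s' 8 by rewrite K4 // G4.
  have iB7 : hb s3 7 = hb s 7 by rewrite K4 // G4.
  have ir2 : hr s3 2 = cs k.+1 by rewrite K2.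
  have ir3 : hr s3 3 = 2 by rewrite K2 // G2 //= er3.
  have Hfin s4 t4 : frame lookup_cmd s3 s4 -> (t4 <= 10)%N ->
    ((1 < k)%N -> hi s4 10 = position D F sg k (hi s3 26) /\
      hi s4 11 = (if use_special D F sg k (hi s3 26) then hi s3 25 else hi s3 24)) ->
    wp (Blk [:: OSt 4 4 10; OSt 5 4 11; QDiv 2 2 3; QSt 8 4 2]) s4 (fun s'' t =>
     (boundary_upto k.+1 (hi (opexec (OAdd 4 4 2) s'') 26) /\
      forall K, (K < k.+1)%N -> entry (opexec (OAdd 4 4 2) s'') K) /\
     (t2 + (t3 + (t4 + t)) + 20 <= 100)%N).
    move=> [L1 L2 L3 L4] T4 Hv.
    have m4 : hi s4 4 = k by rewrite L1.
    have m26 : hi s4 26 = hi s3 26 by rewrite L1.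
    have m24 : hi s4 24 = hi s' 24 by rewrite L1 // j.
    have m25 : hi s4 25 = hi s' 25 by rewrite L1 // j.
    have mA4 : ha s4 4 = ha s' 4 by rewrite L3.
    have mA5 : ha s4 5 = ha s' 5 by rewrite L3.
    have mB8 : hb s4 8 = hb s' 8 by rewrite L4.
    have mr2 : hr s4 2 = cs k.+1 by rewrite L2.
    have mr3 : hr s4 3 = 2 by rewrite L2.
    apply: wp_blk; first by rewrite /= m4 Hk.
    rewrite /= m4 mr2 mr3; split; last by clear -T2 T3 T4; lia.
    split; first by rewrite m26.
    move=> K HK; have [EK|Hne] := eqVneq K k.
      rewrite EK => Hk1; have [V1 V2] := Hv Hk1.
      exists (hi s3 26); rewrite /= /aupd !eqxx; split=> //.
      by rewrite V2 m24 m25 (j 24%N) // (j 25%N).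
    move=> /= H1K; have [|b [W1 W2 W3 W4]] := HE K _ H1K; first by clear -HK Hne; lia.
    by exists b; rewrite /= /aupd (negPf Hne) m24 m25 mA4 mA5 mB8; split.
  apply: wp_seq; case: (ltnP 1 k) => Hk1.
    apply: (lookup_ok (b := hi s3 26)); rewrite ?i3 ?i4 ?Hk ?Hk1 //.
    - by rewrite j.
    - have [X1 X2 X3 X4] := Hfl (leq_ltn_trans Hk1 Hk).
      by split; rewrite ?iB7 // !j // ?e21 ?e22 ?e23 ?e24 ?e25.
    - by rewrite j // e20.
    move=> s4 t4 f4 V1 V2 T4.
    apply: wp_frame (Hfin s4 t4 f4 T4 (fun _ => conj V1 V2)) _ => s5 t5 _ [W1 W2].
    by split=> //; clear -W2; lia.
  apply: lookup_any => s4 t4 f4 T4.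
  apply: wp_frame (Hfin s4 t4 f4 T4 _) _ => [|s5 t5 _ [W1 W2]]; first by rewrite ltnNge Hk1.
  by split=> //; clear -W2; lia.
- by move=> s' t _; rewrite /= r0 => -[_ HI] Ht; split=> //; lia.
Qed.

End Sorted.
End Tables.

(** * The whole program *)

Section Precomputation.
Variables (R : realType) (D : seq R) (F : R -> R).
Hypothesis domD : is_domain D.
Local Notation n := (size D).
Local Notation f := (fun i : nat => F D`_i).
Local Notation hst := (hst R).
Local Notation wp := (@wp R n).
Implicit Types (s : hst).

(** Registers 24 and 25 receive 6 n and 7 n, the addresses of the sorted array and of the separate
    one for K = 2. *)
Definition setup_cmd : cmd :=
  Blk [:: OConst 2 1; OConst 3 0; QConst 0 0; OAdd 24 0 0; OAdd 24 24 0; OAdd 24 24 24; OAdd 25 24 0].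
(* Registers 3 to 6 pass [n - 1] and the bases of the tables to the query. *)
Definition finish_cmd : cmd :=
  Blk [:: OSt 4 2 27; OSt 5 2 24; QSt 8 2 14; OAdd 8 0 0; OAdd 5 8 8; OAdd 4 5 0; OAdd 6 5 5; OSub 3 0 2].
Definition precomp_cmd : cmd :=
  Seq setup_cmd (Seq costs_cmd (Seq sort_cmd (Seq main_array (Seq swings_cmd (Seq one_segment
    (Seq flags_cmd (Seq table_cmd finish_cmd))))))).

Definition initial : hst :=
  Hst (ireg (input_state D F)) (fun _ => 0) (fun _ _ => 0%N)
    (fun k i => nth 0 (D ++ [seq F x | x <- D]) (k * n + i)).

Definition tables_of (cost : nat -> R) (sg : seq nat) s : Prop :=
  [/\ [/\ hi s 3 = n.-1, hi s 4 = (5 * n)%N, hi s 5 = (4 * n)%N & hi s 6 = (8 * n)%N],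
      [/\ ha s 4 1 = 2, ha s 5 1 = (6 * n)%N & hb s 8 1 = omafe D F (pts D [:: 0%N; n.-1])],
      forall K, (1 < K < n)%N -> exists b,
        [/\ last_boundary cost sg K b, ha s 4 K = position D F sg K b,
            ha s 5 K = (if use_special D F sg K b then 7 * n else 6 * n)%N &
            hb s 8 K = cs cost sg K.+1 / 2],
      forall i, (i < n)%N -> hb s 6 i = D`_(nth 0%N sg i)
    & (2 < n)%N -> ~~ agree D F sg ->
      [/\ hb s 7 0 = D`_0, hb s 7 1 = D`_(nth 0%N sg 1) & hb s 7 2 = D`_n.-1]].

Lemma precomp_ok : wp precomp_cmd initial (fun s t => exists cost sg,
  [/\ persistence n f cost, forall p, (p < n)%N -> 0 <= cost p,
      perm_eq sg (iota 0 n), sorted (cost_order cost) sg & tables_of cost sg s /\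
      (t <= 1900 * n + 500 + (180 * n + 60) * (trunc_log 2 n).+1)%N]).
Proof.
have Hn := dom_size domD.
apply: wp_seq; apply: wp_blk => //=; set s0 := Hst _ _ _ _.
have r0 : ready n s0 by [].
have z24 : hi s0 24 = (6 * n)%N by rewrite /= /upd /=; clear; lia.
have z25 : hi s0 25 = (7 * n)%N by rewrite /= /upd /=; clear; lia.
have D0 i : (i < n)%N -> hb s0 0 i = D`_i by move=> Hi; rewrite /= mul0n nth_cat Hi.
have F0 i : (i < n)%N -> hb s0 1 i = f i.
  move=> Hi; rewrite /= mul1n nth_cat ltnNge leq_addr /= addnC addnK.
  by rewrite (nth_map 0).
have C0 i : (i < n)%N -> hb s0 5 i = 0.
  move=> Hi; rewrite /= nth_default // size_cat size_map; move: Hi; clear; lia.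
apply: wp_seq; apply: (costs_ok r0 C0 F0) => s1 t1 f1 HP H0 HF1 T1.
have r1 := ready_frame r0 f1 isT isT.
set cost := hb s1 5 in HP H0.
apply: wp_seq; apply: sort_ok => // s2 t2 f2 Hperm Hsort T2; rewrite -/cost in Hsort.
have r2 := ready_frame r1 f2 isT isT.
set sg := seg (ha s2 2) 0 n in Hperm Hsort.
have Hsg i : (i < n)%N -> ha s2 2 i = nth 0%N sg i by move=> Hi; rewrite nth_seg.
have Hsgn i : (i < n)%N -> (nth 0%N sg i < n)%N by exact: (sg_lt Hperm).
apply: wp_seq; apply: main_array_ok => //; first by move=> i Hi; rewrite Hsg // Hsgn.
move=> s3 t3 f3 HA T3.
have r3 := ready_frame r2 f3 isT isT.
have [a1 b1 c1 d1] := f1; have [a2 b2 c2 d2] := f2; have [a3 b3 c3 d3] := f3.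
have HF3 i : (i < n)%N -> hb s3 1 i = f i by move=> Hi; rewrite d3 // d2 // HF1.
apply: wp_seq; apply: (swings_ok domD r3 HF3) => s4 t4 f4 Hsw T4.
have r4 := ready_frame r3 f4 isT isT; have [a4 b4 c4 d4] := f4.
have HF4 i : (i < n)%N -> hb s4 1 i = f i by move=> Hi; rewrite d4 // HF3.
apply: wp_seq; apply: (one_segment_ok domD r4 HF4 Hsw) => s5 t5 f5 V14 V3 V1 V2 V20 T5.
have r5 := ready_frame r4 f5 isT isT; have [a5 b5 c5 d5] := f5.
have HF5 i : (i < n)%N -> hb s5 1 i = f i by move=> Hi; rewrite d5 // HF4.
have HD5 i : (i < n)%N -> hb s5 0 i = D`_i by move=> Hi; rewrite d5 // d4 // d3 // d2 // d1 // D0.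
have HS5 i : (i < n)%N -> ha s5 2 i = nth 0%N sg i by move=> Hi; rewrite c5 // c4 // c3 // Hsg.
apply: wp_seq; apply: (flags_ok r5 HF5 HD5 HS5 Hsgn V1 V2) => s6 t6 f6 Hfl H27 T6.
have r6 := ready_frame r5 f6 isT isT; have [a6 b6 c6 d6] := f6.
apply: wp_seq; apply: (table_ok (F := F) (cost := cost) (sg := sg) r6 H27) => //.
- by rewrite b6.
- by move=> i Hi; rewrite c6 // HS5.
- by move=> i Hi; rewrite (csE cost Hperm).
- by rewrite (cs_out cost Hperm).
- by rewrite d6 // d5 // d4 // d3 // d2.
- by rewrite a6.
move=> s7 t7 f7 Hent T7.
have r7 := ready_frame r6 f7 isT isT; have [a7 b7 c7 d7] := f7.
have [x0 x2 x3 _] := r7.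
have x24 : hi s7 24 = (6 * n)%N by rewrite a7 // a6 // a5 // a4 // a3 // a2 // a1.
have x25 : hi s7 25 = (7 * n)%N by rewrite a7 // a6 // a5 // a4 // a3 // a2 // a1.
have x27 : hi s7 27 = 2 by rewrite a7.
have x14 : hr s7 14 = omafe D F (pts D [:: 0%N; n.-1]) by rewrite b7 // b6.
apply: wp_blk; first by rewrite /= x2 Hn.
exists cost, sg; split=> //; split.
  rewrite /= ; split=> /=.
  - by rewrite x0 x2; clear; split; lia.
  - by rewrite x2 x27 x24 x14 /aupd eqxx.
  - move=> K /andP [HK1 HKn]; have [b [W1 W2 W3 W4]] := Hent K HKn HK1.
    have NK : (K == 1)%N = false by move: HK1; clear; lia.
    by exists b; rewrite x2 /aupd NK W2 W3 W4 x24 x25.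
  - move=> i Hi; rewrite d7 // d6 // d5 // d4 // HA // Hsg //.
    by rewrite d2 // d1 // D0 // Hsgn.
  - by move=> H2 Ha; have [_ _ _ Hx] := Hfl H2; rewrite d7 //; exact: Hx.
rewrite /=; clear -T1 T2 T3 T4 T5 T6 T7; lia.
Qed.

End Precomputation.

Definition precomp_prog : program := compile 0 precomp_cmd.

(** The first three instructions cap K at n - 1, held in register 3. Registers 4, 5 and 6 are the
    bases of the tables of array starts, positions and values. The last two instructions move the
    start from register 8 to the output register 0. *)
Definition query_prog : program :=
  [:: IJumpLe 0 3 3; IConst 0 0; IAdd 0 0 3;
      IAdd 7 4 0; ILoad 8 7; IAdd 7 5 0; ILoad 1 7; IAdd 7 6 0; RLoad 0 7;
      IConst 9 0; IAdd 0 8 9].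

Lemma run_step (R : realType) P k (s : state R) c : onth P (pc s) = Some c ->
  run P k.+1 s = run P k (exec c s).
Proof. by move=> H; rewrite /run iterSr [in LHS]/step H. Qed.

Lemma query_tail (R : realType) i (r : nat -> R) im rm : exists s',
  [/\ run query_prog 8 (State 3 i r im rm) = s', pc s' = 11%N, out_start s' = im (i 4 + i 0)%N,
      out_position s' = im (i 5 + i 0)%N & out_value s' = rm (i 6 + i 0)%N].
Proof.
exists (foldl (fun s c => exec c s) (State 3 i r im rm) (drop 3 query_prog)); split.
- rewrite (@run_step _ _ _ _ (IAdd 7 4 0)) // (@run_step _ _ _ _ (ILoad 8 7)) //.
- by [].
- by rewrite /out_start /= /upd /= addn0.
- by [].
- by [].
Qed.

Lemma query_run (R : realType) (s : state R) K : exists s',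
  [/\ halts_within query_prog 11 (query_state s K) s',
      out_start s' = imem s (ireg s 4 + minn K (ireg s 3))%N,
      out_position s' = imem s (ireg s 5 + minn K (ireg s 3))%N
    & out_value s' = rmem s (ireg s 6 + minn K (ireg s 3))%N].
Proof.
rewrite /query_state; case: s => pc0 i r im rm /=.
case: (leqP K (i 3)) => HK.
  have [s' [H1 H2 H3 H4 H5]] := query_tail (upd i 0 K) r im rm.
  exists s'; split=> //; exists 9%N => //; rewrite /halted H2; split=> //.
  by rewrite (@run_step _ _ _ _ (IJumpLe 0 3 3)) //= [upd i 0 K 0]/upd [upd i 0 K 3]/upd /= HK.
have [s' [H1 H2 H3 H4 H5]] := query_tail (upd (upd (upd i 0 K) 0 0%N) 0 (i 3)) r im rm.
exists s'; split=> //; exists 11%N => //; rewrite /halted H2; split=> //.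
by rewrite (@run_step _ _ _ _ (IJumpLe 0 3 3)) //= [upd i 0 K 0]/upd [upd i 0 K 3]/upd /= leqNgt HK.
Qed.

(** [uses_storage] speaks about all times, including those after halting, when the state no longer
    changes. *)
Lemma trace_halted (R : realType) P M (l l' : state R) t : trace P M l t l' -> halted P l' ->
  uses_storage P M l.
Proof.
move=> [H1 H2] Hh k; case: (ltnP k t) => [/H2 //|Hk].
have Hrun j : run P j l' = l'.
  elim: j => [//|j IH]; rewrite /run iterS -[iter j _ _]/(run _ _ _) IH /step.
  by rewrite onth_default.
have -> : run P k l = l'.
  by rewrite -(subnK Hk) /run iterD -[iter t _ _]/(run _ _ _) H1 -/(run _ _ _) Hrun.
by rewrite /cells_needed onth_default.
Qed.

Lemma run_compiled (R : realType) (D : seq R) (F : R -> R) c h t :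
  eval (size D) c (initial D F) h t -> wf c -> exists l,
  [/\ halts_within (compile 0 c) t (input_state D F) l,
      uses_storage (compile 0 c) (9 * size D) (input_state D F) & simulates (size D) h l].
Proof.
move=> Hev Hw.
have Hrel : simulates (size D) (initial D F) (input_state D F) by split.
have Hcode : code_at (compile 0 c) 0 (compile 0 c).
  by exists [::], [::]; rewrite cats0.
have [t' [l [Htt Htr Hpc Hl]]] := compile_sim Hev Hw Hcode (erefl : pc (input_state D F) = 0%N) Hrel.
have Hhalt : halted (compile 0 c) l by rewrite /halted Hpc.
exists l; split=> //; last exact: trace_halted Htr Hhalt.
by exists t'; last by case: Htr.
Qed.

Local Close Scope ring_scope.
Unset Implicit Arguments.

(* One precomputed array serves every K except K = 2, where another one may be
   used: for F = 4, 0, 6, 1, 7, 3 the segmentations for K = 2 and K = 3 are not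
   given by two positions in the same array. *)
Theorem lemma3p9 (R : realType) :
  exists (precomputation query : program) (C : nat),
  forall (D : seq R) (F : R -> R),
    is_domain D -> no_equal_neighbours D F ->
  exists s : state R,
    [/\ halts_within precomputation (C * (size D * trunc_log 2 (size D)))
          (input_state D F) s,
        uses_storage precomputation (C * size D) (input_state D F)
      & exists array : nat,
        forall K : nat, (1 <= K)%N ->
        exists s' : state R,
          [/\ halts_within query C (query_state s K) s',
              K <> 2 -> out_start s' = array
            & query_answer D F K
                (array_prefix s (out_start s') (out_position s'))
                (out_value s')]].
Proof.
(* One generous constant for all bounds. Since n >= 2 the logarithm is at least 1, which absorbs the
   lower order terms. *)
exists precomp_prog, query_prog, 5000 => D F domD neqF.
have Hn := dom_size domD.
have [h [t [Hev [cost [sg [HP H0 Hperm Hsort [Htab Ht]]]]]]] := precomp_ok F domD.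
have Hw : wf precomp_cmd by [].
have [l [Hhalt Hstore Hl]] := run_compiled Hev Hw.
exists l; split.
- have [t' Ht' Hrun] := Hhalt; exists t' => //.
  have HL : (1 <= trunc_log 2 (size D))%N by apply: trunc_log_max.
  apply: leq_trans Ht' _; apply: leq_trans Ht _.
  move: Hn HL; clear; move: (size D) (trunc_log 2 (size D)) => n L; nia.
- move=> k; apply: leq_trans (Hstore k) _.
  by rewrite leq_mul2r orbT.
have [E1 E2 E3 E4 E5] := Hl.
have [[a3 a4 a5 a6] [b4 b5 b8] Hent HA HX] := Htab.
exists (6 * size D)%N => K HK.
have [s' [Q1 Q2 Q3 Q4]] := query_run l K.
set K' := minn K (size D).-1.
have HK'n : (K' < size D)%N by apply: leq_ltn_trans (geq_minr _ _) _; exact: dom_pred.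
have HK'0 : (1 <= K')%N by rewrite leq_min HK; move: Hn; clear; lia.
rewrite !E1 // a3 a4 a5 a6 -/K' in Q2 Q3 Q4.
rewrite E4 // in Q2; rewrite E4 // in Q3; rewrite E5 // in Q4.
have Hprefix k len : (k < 9)%N -> (len <= size D)%N ->
    array_prefix l (k * size D) len = [seq hb h k i | i <- iota 0 len].
  move=> Hk Hlen; rewrite /array_prefix -[(k * size D)%N]addn0 iotaDl -map_comp.
  apply/eq_in_map => i; rewrite mem_iota /= => Hi; apply: E5 => //.
  exact: leq_trans Hi Hlen.
have Hmain len : (len <= size D)%N -> array_prefix l (6 * size D) len = pts D (take len sg).
  move=> Hlen; rewrite Hprefix //; apply: (@eq_from_nth _ 0%R).
    by rewrite !size_map size_iota size_takel ?(size_sg Hperm).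
  move=> i; rewrite size_map size_iota => Hi.
  rewrite (nth_map 0%N) ?size_iota // nth_iota // add0n HA; last exact: leq_trans Hi Hlen.
  by rewrite nth_pts ?nth_take // size_takel ?(size_sg Hperm).
have Hans : query_answer D F K' (array_prefix l (out_start s') (out_position s')) (out_value s').
  rewrite Q2 Q3 Q4; have [EK|NK] := eqVneq K' 1%N.
    by rewrite EK b4 b5 b8 Hmain //; exact: answer_one HP H0 Hperm Hsort.
  have HK1 : (1 < K' < size D)%N by rewrite HK'n andbT; move: NK HK'0; clear; lia.
  have [b [W1 -> -> ->]] := Hent K' HK1.
  have := select domD neqF HP H0 Hperm Hsort HK1 W1.
  case: ifP => Hsp; last first.
    by rewrite Hmain //; apply: position_le => //; case: W1.
  have n4 := special_size domD HP H0 Hperm Hsort HK1 W1 Hsp.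
  have /and3P [Hb Ha HK2] := Hsp.
  have -> : position D F sg K' b = 3.
    by rewrite /position (negPf Ha) HK2; move: Hb; case: (b) => [|[|[|]]].
  rewrite Hprefix //; last exact: ltnW.
  by have [X0 X1 X2] := HX (ltnW n4) Ha; rewrite /= X0 X1 X2.
exists s'; split.
- by case: Q1 => q Hq Hs; exists q => //; apply: leq_trans Hq _.
- move=> K2; rewrite Q2; have [->|NK] := eqVneq K' 1%N; first exact: b5.
  have HK1 : (1 < K' < size D)%N by rewrite HK'n andbT; move: NK HK'0; clear; lia.
  have [b [W1 _ -> _]] := Hent K' HK1; case: ifP => // Hsp.
  have n4 := special_size domD HP H0 Hperm Hsort HK1 W1 Hsp.
  have /and3P [_ _ HK2] := Hsp.
  by move: n4 HK2 HK1 K2; rewrite /K'; clear; lia.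
- case: (leqP K (size D).-1) => HKn; first by move: Hans; rewrite /K' (minn_idPl HKn).
  apply: (answer_large domD) => //; last by move: Hans; rewrite /K' (minn_idPr (ltnW HKn)).
  by rewrite -(prednK (dom_gt0 domD)).
Qed.
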